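(* Let $\frac32<p<\infty$ and let $A=(a_1,a_2,a_3,a_4)\in (L_\infty(G;\mathbb{H}_{\mathbb{C}}))^4$. For every compact set $K\subset G$ there exists a constant $C_K>0$ such that $$\max_{x\in K}|w(x)|_{\mathbb{H}_{\mathbb{C}}}\leqslant C_K\|w\|_{L_p(G;\mathbb{H}_{\mathbb{C}})}\qquad\text{for all } w\in\mathfrak{V}_A^p(G;\mathbb{H}_{\mathbb{C}}).$$
   Context: Biquaternions: $\mathbb{H}_{\mathbb{C}}$ is the complex algebra of elements $p=p_0+\vec p$, $\vec p=\sum_{k=1}^3 p_ke_k$, $p_0,\dots,p_3\in\mathbb{C}$ (with $e_0=1$), with product $pq=p_0q_0+p_0\vec q+q_0\vec p-\vec p\cdot\vec q+\vec p\times\vec q$ (bilinear dot and cross products on $\mathbb{C}^3$, so $e_k^2=-1$ for $k=1,2,3$). Quaternionic conjugate: $\overline{p}=p_0-\vec p$. Norm: $|p|_{\mathbb{H}_{\mathbb{C}}}=(\sum_{k=0}^3|p_k|^2)^{1/2}$. Domain: $G\subset\mathbb{R}^3$ is a bounded domain whose boundary $\Gamma$ is a Liapunov surface (in particular a $C^1$ surface with Hölder continuous unit normal), with $\mathbb{R}^3\setminus\overline{G}$ connected. Function spaces: a function $u=\sum_{k=0}^3u_ke_k:G\to\mathbb{H}_{\mathbb{C}}$ belongs to $\mathscr{F}(G;\mathbb{H}_{\mathbb{C}})$ if each $u_k\in\mathscr{F}(G)$ (complex-valued space). $\|u\|_{L_p(G;\mathbb{H}_{\mathbb{C}})}=(\int_G|u|_{\mathbb{H}_{\mathbb{C}}}^p\,dV)^{1/p}$.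 Operators: $\mathbf{D}=\sum_{k=1}^3e_k\frac{\partial}{\partial x_k}$ (acting from the left). A function $v\in L_{1,loc}(G;\mathbb{H}_{\mathbb{C}})$ is the weak $\mathbf{D}$-derivative of $u\in L_{1,loc}(G;\mathbb{H}_{\mathbb{C}})$, written $v=\mathbf{D}u$, if $\int_G\overline{u}(\mathbf{D}\varphi)=\int_G\overline{v}\varphi$ for all $\varphi\in C_0^\infty(G;\mathbb{H}_{\mathbb{C}})$. For $A=(a_1,a_2,a_3,a_4)\in(L_\infty(G;\mathbb{H}_{\mathbb{C}}))^4$, $\mathbf{Q}_Aw=wa_1+\overline{w}a_2+a_3w+a_4\overline{w}$. $\mathfrak{V}_A^p(G;\mathbb{H}_{\mathbb{C}})$ is the set of weak solutions $w\in L_p(G;\mathbb{H}_{\mathbb{C}})$ of $\mathbf{D}w-\mathbf{Q}_Aw=0$ in $G$, i.e. those $w\in L_p(G;\mathbb{H}_{\mathbb{C}})$ having a weak $\mathbf{D}$-derivative equal to $\mathbf{Q}_Aw$. For $\frac32<p<\infty$ every element of $\mathfrak{V}_A^p(G;\mathbb{H}_{\mathbb{C}})$ has a continuous representative on $G$, and $w(x)$ denotes the value of that representative. *)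

(* Defs.v *)
From HB Require Import structures.
From mathcomp Require Import all_boot all_order all_algebra.
From mathcomp Require Import complex.
From mathcomp Require Import all_classical all_reals all_analysis.

Set Implicit Arguments.
Unset Strict Implicit.
Unset Printing Implicit Defensive.

Import Order.TTheory GRing.Theory Num.Theory.
Import numFieldNormedType.Exports.

Local Open Scope classical_set_scope.
Local Open Scope ring_scope.
Local Open Scope complex_scope.

(* The iterated product carries at once the product topology, a normed module
   structure (whose norm is the maximum norm, equivalent to the Euclidean one)
   and the Borel sigma-algebra. *)
Notation R3 R := (R * R * R)%type.

(* Row vectors (p_0, p_1, p_2, p_3); 1 + 3 splits off the scalar part. *)
Notation biquat R := 'rV[R[i]]_(1 + 3).

Section Biquaternions.
Variable R : realType.
Implicit Types (p q : biquat R) (u v : 'rV[R[i]]_3).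

Definition bq (s : R[i]) (v : 'rV[R[i]]_3) : biquat R := row_mx s%:M v.
Definition bq_scal p : R[i] := lsubmx p 0 0.
Definition bq_vec p : 'rV[R[i]]_3 := rsubmx p.

Definition bq_unit (k : 'I_3) : biquat R := bq 0 (delta_mx 0 k).

(* The dot product is bilinear: there is no complex conjugation. *)
Definition cdot u v : R[i] := \sum_(k < 3) u 0 k * v 0 k.

(* The index arithmetic is modulo 3. *)
Definition ccross u v : 'rV[R[i]]_3 :=
  \row_(k < 3) (u 0 (k + 1) * v 0 (k + 2%:R) - u 0 (k + 2%:R) * v 0 (k + 1)).

Definition bq_mul p q : biquat R :=
  bq (bq_scal p * bq_scal q - cdot (bq_vec p) (bq_vec q))
     (bq_scal p *: bq_vec q + bq_scal q *: bq_vec p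
      + ccross (bq_vec p) (bq_vec q)).

Definition bq_conj p : biquat R := bq (bq_scal p) (- bq_vec p).

Definition bq_norm p : R :=
  Num.sqrt (\sum_(k < 1 + 3) Normc.normc (p 0 k) ^+ 2).

End Biquaternions.

Section Calculus.
Variable R : realType.

Definition coord3 (k : 'I_3) (x : R3 R) : R := tnth [tuple x.1.1; x.1.2; x.2] k.

Definition basis3 (k : 'I_3) : R3 R :=
  ((k == 0)%:R, (k == 1)%:R, (k == 2%:R)%:R).

Definition enorm3 (x : R3 R) : R := Num.sqrt (\sum_(k < 3) coord3 k x ^+ 2).

Definition pderiv (k : 'I_3) (f : R3 R -> R) (x : R3 R) : R :=
  'D_(basis3 k) f x.

Definition gradient3 (f : R3 R -> R) (x : R3 R) : R3 R :=
  (pderiv 0 f x, pderiv 1 f x, pderiv 2%:R f x).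

Definition C1_on (U : set (R3 R)) (f : R3 R -> R) : Prop :=
  forall (k : 'I_3) x, U x ->
    derivable f x (basis3 k) /\ {for x, continuous (pderiv k f)}.

Definition iter_pderiv (s : seq 'I_3) (f : R3 R -> R) : R3 R -> R :=
  foldr pderiv f s.

Definition smooth (f : R3 R -> R) : Prop :=
  forall s : seq 'I_3,
    continuous (iter_pderiv s f) /\
    forall (k : 'I_3) x, derivable (iter_pderiv s f) x (basis3 k).

Definition cpderiv (k : 'I_3) (f : R3 R -> R[i]) (x : R3 R) : R[i] :=
  pderiv k (fun y => complex.Re (f y)) x +i*
  pderiv k (fun y => complex.Im (f y)) x.

Definition bq_pderiv (k : 'I_3) (u : R3 R -> biquat R) (x : R3 R) : biquat R :=
  \row_(j < 1 + 3) cpderiv k (fun y => u y 0 j) x.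

Definition bq_D (u : R3 R -> biquat R) (x : R3 R) : biquat R :=
  \sum_(k < 3) bq_mul (bq_unit R k) (bq_pderiv k u x).

End Calculus.

Section Domains.
Variable R : realType.

Definition bdry (G : set (R3 R)) : set (R3 R) := closure G `\` interior G.

(* S is an embedded C^1 surface (locally a regular level set), and the unit
   vector n y is normal to S at each point y of S. *)
Definition C1_surface_with_normal (S : set (R3 R)) (n : R3 R -> R3 R) : Prop :=
  (forall y, S y -> enorm3 (n y) = 1) /\
  forall x, S x -> exists (U : set (R3 R)) (F : R3 R -> R),
    [/\ open U, U x, C1_on U F, forall y, U y -> (S y <-> F y = 0) &
        forall y, U y -> S y ->
          exists2 c : R, c != 0 & gradient3 F y = c *: n y].

(* Liapunov's three conditions: a tangent plane at every point, a Hoelder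
   continuous unit normal, and a radius d such that, inside the ball of radius
   d about any x on S, lines parallel to the normal at x meet S at most once. *)
Definition liapunov_surface (S : set (R3 R)) : Prop :=
  compact S /\
  exists (n : R3 R -> R3 R) (c lam d : R),
    [/\ [/\ 0 < c, 0 < lam, lam <= 1 & 0 < d],
        C1_surface_with_normal S n,
        forall x y, S x -> S y ->
          enorm3 (n x - n y) <= c * enorm3 (x - y) `^ lam &
        forall x y z (t : R), S x -> S y -> S z ->
          enorm3 (y - x) < d -> enorm3 (z - x) < d ->
          z = y + t *: n x -> z = y].

Definition liapunov_domain (G : set (R3 R)) : Prop :=
  [/\ [/\ G !=set0, open G & connected G], bounded_set G,
      liapunov_surface (bdry G) & connected (~` closure G)].

End Domains.

Section FunctionSpaces.
Variable R : realType.
Implicit Types (G K : set (R3 R)) (f : R3 R -> R[i]) (u v w : R3 R -> biquat R).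

(* Lebesgue measure on the Borel sets.  Every class of Lebesgue measurable
   functions modulo a.e. equality has a Borel representative, so elements of
   L_p and L_oo are represented by functions that are Borel measurable on G;
   values outside G are irrelevant. *)
Definition leb3 :
    {measure set (measurableTypeR R * measurableTypeR R * measurableTypeR R)
     -> \bar R} :=
  ((@lebesgue_measure R \x @lebesgue_measure R) \x @lebesgue_measure R)%E.

Definition cmeasurable G f : Prop :=
  measurable_fun G (fun x => complex.Re (f x)) /\
  measurable_fun G (fun x => complex.Im (f x)).

Definition in_Lp (p : R) G f : Prop :=
  cmeasurable G f /\
  (\int[leb3]_(x in G) ((Normc.normc (f x)) `^ p)%:E < +oo)%E.

Definition in_Linfty G f : Prop :=
  cmeasurable G f /\
  exists M : R, {ae leb3, forall x, G x -> Normc.normc (f x) <= M}.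

Definition in_L1loc G f : Prop :=
  forall K, compact K -> K `<=` G -> in_Lp 1 K f.

(* Test functions are extended by zero to the whole space. *)
Definition in_Cc_infty G f : Prop :=
  [/\ smooth (fun x => complex.Re (f x)), smooth (fun x => complex.Im (f x)) &
      exists K, [/\ compact K, K `<=` G & forall x, ~ K x -> f x = 0]].

Definition continuous_on G f : Prop :=
  {within G, continuous (fun x => complex.Re (f x))} /\
  {within G, continuous (fun x => complex.Im (f x))}.

(* u belongs to F(G; H_C) when each of its components belongs to F(G). *)
Definition bq_in (F : (R3 R -> R[i]) -> Prop) u : Prop :=
  forall k : 'I_(1 + 3), F (fun x => u x 0 k).

Definition Lp_norm (p : R) G u : \bar R :=
  ((\int[leb3]_(x in G) ((bq_norm (u x)) `^ p)%:E) `^ p^-1)%E.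

Definition cintegral G f : R[i] :=
  Rintegral leb3 G (fun x => complex.Re (f x)) +i*
  Rintegral leb3 G (fun x => complex.Im (f x)).

Definition bq_integral G u : biquat R :=
  \row_(k < 1 + 3) cintegral G (fun x => u x 0 k).

Definition weak_D G u v : Prop :=
  [/\ bq_in (in_L1loc G) u, bq_in (in_L1loc G) v &
      forall phi : R3 R -> biquat R, bq_in (in_Cc_infty G) phi ->
        bq_integral G (fun x => bq_mul (bq_conj (u x)) (bq_D phi x)) =
        bq_integral G (fun x => bq_mul (bq_conj (v x)) (phi x))].

Definition Q_op (a1 a2 a3 a4 w : R3 R -> biquat R) (x : R3 R) : biquat R :=
  bq_mul (w x) (a1 x) + bq_mul (bq_conj (w x)) (a2 x)
  + bq_mul (a3 x) (w x) + bq_mul (a4 x) (bq_conj (w x)).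

Definition weak_solution (p : R) G (a1 a2 a3 a4 w : R3 R -> biquat R) : Prop :=
  bq_in (in_Lp p G) w /\ weak_D G w (Q_op a1 a2 a3 a4 w).

Definition continuous_representative G w w' : Prop :=
  bq_in (continuous_on G) w' /\ {ae leb3, forall x, G x -> w x = w' x}.

End FunctionSpaces.

(* Main.v *)
Require Import Defs.
From HB Require Import structures.
From mathcomp Require Import all_boot all_order all_algebra.
From mathcomp Require Import complex.
From mathcomp Require Import all_classical all_reals all_analysis.
From mathcomp Require Import measurable_realfun ring lra.
Set Implicit Arguments.
Unset Strict Implicit.
Unset Printing Implicit Defensive.
Import Order.TTheory GRing.Theory Num.Theory.
Import numFieldNormedType.Exports.
Local Open Scope classical_set_scope.
Local Open Scope ring_scope.

(* The equation is tested only with the differences E(r/2) - E(r) of regularized Newton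
   fields of scale r, each the gradient of a C_c^oo function.  Since D is a square root of
   minus the Laplacian, this gives |w * delta_(r/2) - w * delta_r|(x) <= C r^-2 int_Q(x,r) |w|,
   where delta_r is a mollifier of constant mass.  Along dyadic radii r_k these increments
   bound |w - w * delta_(r_k)|, hence the averages of |w| over cubes of radius r_k+1 in terms
   of those of radius r_0, ..., r_k; since sum r_k is finite, a discrete Gronwall argument
   bounds all of them by the average over the largest cube.  The mollifications therefore
   converge geometrically and locally uniformly; their limit is the continuous
   representative, bounded by the L_1 norm of w on a cube, and so by its L_p norm. *)

(* The carrier is that of [R3 R]; written this way, unification finds its Borel sigma-algebra. *)
Notation M3 R := (measurableTypeR R * measurableTypeR R * measurableTypeR R)%type.

(** The kernel z |z|^-3 attached to D is neither smooth nor compactly supported, but two of its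
    regularizations coincide off a cube, so their difference is an admissible test field, of size
    r^-2. The obstacle: r^-2 times the mass of w on a cube of radius r is summable over dyadic r
    only once that mass is known to be O(r^3), which is nearly the claim itself. Averaging breaks
    the circle. Integrated over a cube, the increment at scale r is, by Tonelli, at most C r times
    the mass of w on a slightly larger cube. This yields convergence almost everywhere, and it also
    handles the scales finer than the current one in the Gronwall step, where only the coarser
    scales are estimated pointwise. The almost everywhere limit is recognized as a multiple of w by
    integrating over sets with negligible boundary: they form a pi-system generating the Borel sets,
    and mollifying their indicators converges by mere domination. The final bound lives on cubes of
    one fixed size centred at the points of K, hence is uniform over K. *)

(** * Sigma-finite Lebesgue measure on R^3 and its behaviour under x -> (y - x) / r *)

Section AffineChange.
Context {R : realType}.
Local Notation lam := (@lebesgue_measure R).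
Local Open Scope ereal_scope.

(** The image of Lebesgue measure under x -> (y - x) / r, divided by r, gives half-open intervals
    their length, hence is Lebesgue measure. *)
Lemma ge0_integral_affine (y r : R) (f : measurableTypeR R -> \bar R) : (0 < r)%R ->
  measurable_fun setT f -> (forall x, 0 <= f x) ->
  \int[lam]_x f (r^-1 * (y - x))%R = r%:E * \int[lam]_x f x.
Proof.
move=> r0 mf f0.
pose phi : measurableTypeR R -> measurableTypeR R := fun x => (r^-1 * (y - x))%R.
have mphi : measurable_fun setT phi.
  by apply: measurable_funM => //; exact: measurable_funB.
pose mphi_mixin := isMeasurableFun.Build _ _ _ _ _ mphi.
pose phi' : {mfun measurableTypeR R >-> measurableTypeR R} := HB.pack phi mphi_mixin.
have ri0 : (0 <= r^-1)%R by rewrite invr_ge0 ltW.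
have E (A : set R) : measurable A ->
    lam A = mscale (NngNum ri0) (pushforward lam phi') A.
  move=> mA; apply: (lebesgue_measure_unique
    (mu := mscale (NngNum ri0) (pushforward lam phi'))) => //.
  move=> _ [[a b]] _ <- /=; rewrite /mscale /=.
  (* The map is decreasing, so the open and the closed end are exchanged. *)
  have -> : pushforward lam phi `]a, b]%classic = lam `[(y - r * b)%R, (y - r * a)%R[%classic.
    rewrite /pushforward; congr (lam _); apply/seteqP; split => x /=; rewrite /phi !in_itv /= => /andP[h1 h2].
      rewrite ltr_pdivlMl// in h1; rewrite ler_pdivrMl// in h2.
      by apply/andP; split; lra.
    by rewrite ltr_pdivlMl// ler_pdivrMl//; apply/andP; split; lra.
  rewrite !lebesgue_measure_itv/= !lte_fin.
  have -> : (y - r * b < y - r * a)%R = (a < b)%R by rewrite ltrD2l ltrN2 ltr_pM2l.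
  case: ifP => _; last by rewrite mule0.
  rewrite -!EFinB -EFinM; congr EFin; field; lra.
rewrite [in RHS](eq_measure_integral (mscale (NngNum ri0) (pushforward lam phi'))); last first.
  by move=> A mA _; exact: E.
rewrite ge0_integral_mscale//= ge0_integral_pushforward//= muleA -EFinM mulfV ?mul1e//; lra.
Qed.

Lemma mem_itv_ceil (M z : R) : (`|z| <= M)%R ->
  z \in `[(- `|Num.ceil M|%N%:R)%R, `|Num.ceil M|%N%:R].
Proof.
move=> zm; rewrite in_itv /= -ler_norml (le_trans zm)// natr_absz.
have M0 : (0 <= M)%R := le_trans (normr_ge0 z) zm.
have cM : (0 <= Num.ceil M)%R by rewrite ceil_ge0 (lt_le_trans _ M0)// ltrN10.
by rewrite (ger0_norm cM) ceil_ge.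
Qed.

Lemma lebesgue_box_sigma_finite2 : sigma_finite setT (lam \x lam).
Proof.
exists (fun n => `[(- n%:R)%R, n%:R]%classic `*` `[(- n%:R)%R, n%:R]%classic).
  apply/esym; rewrite -subTset => -[a b] _.
  exists `|Num.ceil (Num.max `|a|%R `|b|%R)|%N => //=.
  by split; apply: mem_itv_ceil; rewrite le_max lexx ?orbT.
move=> n; split; first exact: measurableX.
rewrite product_measure1E//= !lebesgue_measure_itv/=.
by case: ifP => _; rewrite ?mule0 ?ltry// -EFinB -EFinM ltry.
Qed.

(** The product measure itself, packed with the sigma-finite structure that Tonelli and Fubini ask
    of a factor. *)
Definition lebesgue2 : {sigma_finite_measure set (measurableTypeR R * measurableTypeR R)%type -> \bar R} :=
  HB.pack (lam \x lam) (Measure_isSigmaFinite.Build _ _ _ (lam \x lam) lebesgue_box_sigma_finite2).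

Lemma lebesgue_box_sigma_finite3 : sigma_finite setT (leb3 R : set (M3 R) -> \bar R).
Proof.
exists (fun n => `[(- n%:R)%R, n%:R]%classic `*` `[(- n%:R)%R, n%:R]%classic `*` `[(- n%:R)%R, n%:R]%classic).
  apply/esym; rewrite -subTset => -[[a b] c] _.
  exists `|Num.ceil (Num.max `|a|%R (Num.max `|b|%R `|c|%R))|%N => //=.
  by split; first split; apply: mem_itv_ceil; rewrite !le_max lexx ?orbT.
move=> n; split; first by do ! apply: measurableX.
have E := (@product_measure1E _ _ _ _ R lebesgue2 lam (`[(- n%:R)%R, n%:R]%classic `*` `[(- n%:R)%R, n%:R]%classic) (`[(- n%:R)%R, n%:R]%classic)).
rewrite [X in X < _]E//; last exact: measurableX.
rewrite [X in X * _]product_measure1E//= !lebesgue_measure_itv/=.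
by case: ifP => _; rewrite ?mule0 ?ltry// -EFinB -!EFinM ltry.
Qed.

(** The same set function as [leb3], so estimates proved for it apply to the measure of the
    statement. *)
Definition lebesgue3 : {sigma_finite_measure set (M3 R) -> \bar R} :=
  HB.pack (lebesgue2 \x lam) (Measure_isSigmaFinite.Build _ _ _ (lebesgue2 \x lam) lebesgue_box_sigma_finite3).

Lemma ge0_integral_leb3 (f : M3 R -> \bar R) :
  measurable_fun setT f -> (forall x, 0 <= f x) ->
  \int[leb3 R]_x f x = \int[lam]_a \int[lam]_b \int[lam]_c f (a, b, c).
Proof.
move=> mf f0; transitivity (\int[lebesgue2]_p fubini_F lam f p).
  exact: (@fubini_tonelli1 _ _ _ _ R lebesgue2 lam f mf f0).
apply: (@fubini_tonelli1 _ _ _ _ R lam lam (fubini_F lam f)).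
  exact: (@measurable_fun_fubini_tonelli_F _ _ _ _ R lam f mf f0).
by move=> x; exact: integral_ge0.
Qed.

Lemma ge0_integral_affine3 (y : R3 R) (r : R) (f : M3 R -> \bar R) : (0 < r)%R ->
  measurable_fun setT f -> (forall x, 0 <= f x) ->
  \int[leb3 R]_x f (r^-1 *: ((y : R3 R) - x))%R = (r ^+ 3)%:E * \int[leb3 R]_x f x.
Proof.
move=> r0 mf f0.
have m1 (s : R) : measurable_fun setT (fun x : measurableTypeR R => (r^-1 * (s - x))%R : measurableTypeR R).
  by apply: measurable_funM => //; exact: measurable_funB.
have mphi : measurable_fun setT (fun x : M3 R => (r^-1 *: ((y : R3 R) - x))%R : M3 R).
  apply/measurable_fun_pairP; split; first apply/measurable_fun_pairP; first split.
  - apply: (measurableT_comp (m1 y.1.1)); apply: (measurableT_comp measurable_fst); exact: measurable_fst.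
  - apply: (measurableT_comp (m1 y.1.2)); apply: (measurableT_comp measurable_snd); exact: measurable_fst.
  - apply: (measurableT_comp (m1 y.2)); exact: measurable_snd.
rewrite !ge0_integral_leb3//; last exact: (measurableT_comp mf mphi).
have i1 a b : \int[lam]_c f (r^-1 * (y.1.1 - a), r^-1 * (y.1.2 - b), r^-1 * (y.2 - c))%R
   = r%:E * \int[lam]_c f (r^-1 * (y.1.1 - a), r^-1 * (y.1.2 - b), c)%R.
  rewrite (ge0_integral_affine _ (f := fun c => f (r^-1 * (y.1.1 - a), r^-1 * (y.1.2 - b), c)%R))//.
  exact: measurableT_comp.
under eq_integral do under eq_integral do rewrite i1.
have mF : measurable_fun setT (fun p : measurableTypeR R * measurableTypeR R => \int[lam]_c f (p, c)).
  exact: (@measurable_fun_fubini_tonelli_F _ _ _ _ R lam f mf f0).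
have F0 p : 0 <= \int[lam]_c f (p, c) by exact: integral_ge0.
have i2 a : \int[lam]_b (r%:E * \int[lam]_c f (r^-1 * (y.1.1 - a), r^-1 * (y.1.2 - b), c)%R)
  = r%:E * (r%:E * \int[lam]_b \int[lam]_c f (r^-1 * (y.1.1 - a), b, c)%R).
  rewrite (ge0_integral_affine _ (f := fun b => r%:E * \int[lam]_c f (r^-1 * (y.1.1 - a), b, c)%R))//.
  - rewrite ge0_integralZl_EFin//; [exact: (measurableT_comp mF)|lra].
  - apply: emeasurable_funM => //; exact: (measurableT_comp mF).
  - by move=> b; apply: mule_ge0 => //; rewrite lee_fin; lra.
under eq_integral do rewrite i2.
have mG : measurable_fun setT (fun a : measurableTypeR R => \int[lam]_b \int[lam]_c f (a, b, c)).
  exact: (@measurable_fun_fubini_tonelli_F _ _ _ _ R lam _ mF F0).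
have G0 a : 0 <= \int[lam]_b \int[lam]_c f (a, b, c) by exact: integral_ge0.
rewrite (ge0_integral_affine _ (f := fun a => r%:E * (r%:E * \int[lam]_b \int[lam]_c f (a, b, c))))//.
- rewrite ge0_integralZl_EFin//; last 3 first.
  + by move=> x _; apply: mule_ge0 => //; rewrite lee_fin ltW.
  + exact: emeasurable_funM.
  + exact: ltW.
  rewrite ge0_integralZl_EFin//; last exact: ltW.
  by rewrite !muleA -!EFinM -expr2 -exprSr.
- by do 2 apply: emeasurable_funM => //.
- by move=> b; do 2 (apply: mule_ge0; first by rewrite lee_fin ltW).
Qed.
End AffineChange.

(** * The flat functions t^-m exp(-1/t) *)

Section FlatFunctions.
Context {R : realType}.
Implicit Types (t s : R).

(** The whole family in m is introduced because differentiation stays inside its linear span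
    ([is_derive_flat]). *)
Definition flat (m : nat) t : R := if 0 < t then t^-1 ^+ m * expR (- t^-1) else 0.

Lemma flat_ge0 m t : 0 <= flat m t.
Proof.
rewrite /flat; case: ifP => // t0.
by rewrite mulr_ge0 ?expR_ge0// exprn_ge0// invr_ge0 ltW.
Qed.

Lemma flat_gt0 m t : 0 < t -> 0 < flat m t.
Proof.
by move=> t0; rewrite /flat t0 mulr_gt0 ?expR_gt0// exprn_gt0// invr_gt0.
Qed.

Lemma flat_le0 m t : t <= 0 -> flat m t = 0.
Proof. by move=> t0; rewrite /flat ltNge t0. Qed.

Lemma flat_mulV m t : t^-1 * flat m t = flat m.+1 t.
Proof. by rewrite /flat; case: ifP => _; rewrite ?mulr0// mulrA exprS. Qed.

(** From v <= e^v at v = 1 / ((m + 1) t), raised to the power m + 1. *)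
Lemma flat_le m t : 0 < t -> flat m t <= m.+1%:R ^+ m.+1 * t.
Proof.
move=> t0; rewrite /flat t0.
have ti0 : 0 < t^-1 by rewrite invr_gt0.
have k0 : 0 < m.+1%:R :> R by rewrite ltr0n.
have H : (t^-1 / m.+1%:R) ^+ m.+1 <= expR t^-1.
  have -> : t^-1 = m.+1%:R * (t^-1 / m.+1%:R) by field; rewrite ?nat1r; lra.
  rewrite expRM_natl mulrC mulKf ?gt_eqF//.
  have h0 : 0 <= t^-1 / m.+1%:R by apply/ltW/divr_gt0.
  apply: lerXn2r; rewrite ?nnegrE ?expR_ge0//.
  by apply: le_trans (expR_ge1Dx _); rewrite lerDr.
rewrite expRN ler_pdivrMr ?expR_gt0//.
apply: le_trans (_ : m.+1%:R ^+ m.+1 * t * (t^-1 / m.+1%:R) ^+ m.+1 <= _).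
  have -> : m.+1%:R ^+ m.+1 * t * (t^-1 / m.+1%:R) ^+ m.+1 = t^-1 ^+ m.
    rewrite expr_div_n (mulrC _ t) -mulrA (mulrCA (m.+1%:R ^+ m.+1)).
    rewrite mulfV ?expf_neq0 ?gt_eqF// mulr1.
    by rewrite exprS mulrA mulfV ?mul1r// gt_eqF.
  exact: lexx.
by apply: ler_wpM2l H; apply: mulr_ge0; [exact: exprn_ge0|exact: ltW].
Qed.


Lemma continuous_flat0 m : {for 0, continuous (flat m)}.
Proof.
rewrite /prop_for /continuous_at flat_le0//.
apply: (@squeeze_cvgr _ _ _ _ (cst 0) (fun t => m.+1%:R ^+ m.+1 * `|t|)).
- near=> t; rewrite flat_ge0/=.
  have [t0|t0] := ltP 0 t; first by rewrite gtr0_norm// flat_le.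
  by rewrite flat_le0// mulr_ge0// exprn_ge0.
- exact: cvg_cst.
- have H : (fun t : R => m.+1%:R ^+ m.+1 * `|t|) t @[t --> 0] --> m.+1%:R ^+ m.+1 * `|0 : R|.
    by apply: cvgM; [exact: cvg_cst|apply: cvg_norm; exact: cvg_id].
  by rewrite normr0 mulr0 in H.
Unshelve. all: by end_near. Qed.

Lemma is_derive_flat m t :
  is_derive t 1 (flat m) (flat m.+2 t - m%:R * flat m.+1 t).
Proof.
have [t0|t0|->] := ltgtP t 0.
- rewrite !flat_le0 ?(ltW t0)// mulr0 subr0.
  have D : is_derive t 1 (cst 0 : R -> R) (0 : R) by exact: is_derive_cst.
  apply: near_eq_is_derive D.
  near=> s; rewrite flat_le0//; near: s.
  by apply: filterS (lt_nbhsl t0) => s; exact: ltW.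
- apply: (@near_eq_is_derive _ _ _ (fun s => s^-1 ^+ m * expR (- s^-1))).
    near=> s; rewrite /flat ifT//; near: s; exact: lt_nbhsr.
  have tn : t != 0 by rewrite gt_eqF.
  have dV : is_derive t 1 (fun s : R => s^-1) (- t ^- 2).
    apply: is_derive_eq (is_deriveV tn (is_derive_id _ _)) _.
    by rewrite /GRing.scale/= mulr1.
  have dE : is_derive t 1 (expR \o (fun s => - s^-1)) (expR (- t^-1) * t ^- 2).
    apply: is_derive1_comp.
    by apply: is_derive_eq (is_deriveN dV) _; rewrite opprK.
  have dX : is_derive t 1 (fun s : R => s^-1 ^+ m) ((m%:R * t^-1 ^+ m.-1) *: - t ^- 2).
    have -> : (fun s : R => s^-1 ^+ m) = (fun s => s^-1) ^+ m by rewrite exprfctE.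
    exact: is_deriveX.
  apply: is_derive_eq (is_deriveM dX dE) _.
  have q : t ^- 2 = t^-1 * t^-1 by rewrite -exprVn expr2.
  rewrite /GRing.scale/= /flat t0 q !exprS; clear dX.
  case: m => [|m]; first by rewrite expr0; ring.
  by rewrite /= exprS; ring.
(* At 0 the difference quotient of [flat m] is [flat m.+1], which is continuous there with value
   0. *)
- apply/is_derive1_caratheodory; exists (flat m.+1); split.
  + move=> z; rewrite subr0 (flat_le0 m (lexx 0)) subr0.
    have [->|z0] := eqVneq z 0; first by rewrite mulr0 flat_le0.
    by rewrite -flat_mulV mulrAC mulVf// mul1r.
  + exact: continuous_flat0.
  + by rewrite !flat_le0// mulr0 subr0.
Unshelve. all: by end_near. Qed.

Lemma continuous_is_derive (f df : R -> R) :
  (forall t, is_derive t 1 f (df t)) -> continuous f.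
Proof.
by move=> fd t; apply/differentiable_continuous/derivable1_diffP/(@ex_derive _ _ _ _ _ _ _ (fd t)).
Qed.

Lemma continuous_flat m : continuous (flat m).
Proof. exact: continuous_is_derive (is_derive_flat m). Qed.

End FlatFunctions.

(** * A smooth step from 0 to 1 *)

Section SmoothStep.
Context {R : realType}.
Implicit Types (t s : R).
Local Notation flat := (@flat R).

Definition stepden t : R := flat 0 t + flat 0 (1 - t).
(** The quotient is written with [powR] so that its smoothness follows from the closure properties
    of flat functions and of real powers. *)
Definition step t : R := flat 0 t * stepden t `^ (-1).
Definition dstep t : R :=
  (flat 2 t * flat 0 (1 - t) + flat 0 t * flat 2 (1 - t)) * stepden t `^ (-2).

Lemma stepden_gt0 t : 0 < stepden t.
Proof.
rewrite /stepden; have [t0|t0] := ltP 0 t.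
  by rewrite ltr_wpDr ?flat_ge0// flat_gt0.
by rewrite ltr_wpDl ?flat_ge0// flat_gt0//; lra.
Qed.

Lemma step_le0 t : t <= 0 -> step t = 0.
Proof. by move=> t0; rewrite /step flat_le0// mul0r. Qed.

Lemma step_ge1 t : 1 <= t -> step t = 1.
Proof.
move=> t1; rewrite /step /stepden (flat_le0 _ (t := 1 - t)) ?addr0; last by lra.
have f0 : 0 < flat 0 t by apply: flat_gt0; lra.
by rewrite powRN powRr1 ?mulfV ?gt_eqF// ltW.
Qed.

Lemma step_ge0 t : 0 <= step t.
Proof. by rewrite mulr_ge0 ?flat_ge0 ?powR_ge0. Qed.

Lemma step_le1 t : step t <= 1.
Proof.
rewrite /step powRN powRr1 ?(ltW (stepden_gt0 t))//.
by rewrite ler_pdivrMr ?stepden_gt0// mul1r lerDl flat_ge0.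
Qed.

Lemma dstep_ge0 t : 0 <= dstep t.
Proof. by rewrite mulr_ge0 ?powR_ge0// addr_ge0// mulr_ge0 ?flat_ge0. Qed.

Lemma dstep_gt0 t : 0 < t < 1 -> 0 < dstep t.
Proof.
move=> /andP[t0 t1]; rewrite mulr_gt0 ?powR_gt0 ?stepden_gt0//.
have t2 : 0 < 1 - t by lra.
by rewrite addr_gt0// mulr_gt0// flat_gt0.
Qed.

Lemma dstep_ge1 t : 1 <= t -> dstep t = 0.
Proof. by move=> t0; rewrite /dstep !(flat_le0 _ (t := 1 - t)) ?mulr0 ?addr0 ?mul0r//; lra. Qed.

Lemma is_derive_flat_rev m t : is_derive t 1 (fun s => flat m (1 - s))
  (- (flat m.+2 (1 - t) - m%:R * flat m.+1 (1 - t))).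
Proof.
rewrite -mulrN1; apply: (is_derive1_comp (f := flat m) (g := fun s => 1 - s)).
  exact: is_derive_flat.
apply: is_derive_eq (is_deriveB (is_derive_cst _ _ _) (is_derive_id _ _)) _.
by rewrite sub0r.
Qed.

Lemma is_derive_powR_comp (a : R) (f : R -> R) t df : 0 < f t ->
  is_derive t 1 f df ->
  is_derive t 1 (fun s => f s `^ a) (a * f t `^ (a - 1) * df).
Proof.
by move=> f0 fd; apply: (is_derive1_comp (f := fun s => s `^ a) _ fd); exact: is_derive1_powR.
Qed.

Lemma is_derive_step t : is_derive t 1 step (dstep t).
Proof.
have d1 := is_derive_flat 0 t; have d2 := is_derive_flat_rev 0 t.
rewrite mul0r subr0 in d1; rewrite mul0r subr0 in d2.
have dd : is_derive t 1 stepden (flat 2 t - flat 2 (1 - t)) := is_deriveD d1 d2.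
have dp := is_derive_powR_comp (-1) (stepden_gt0 t) dd.
apply: is_derive_eq (is_deriveM d1 dp) _; rewrite /GRing.scale/= /dstep.
have -> : -1 - 1 = -2 :> R by ring.
have -> : stepden t `^ (-1) = stepden t * stepden t `^ (-2).
  have s0 := stepden_gt0 t.
  by rewrite -{2}(powRr1 (ltW s0)) -powRD ?(gt_eqF s0) ?implybT//; congr (_ `^ _); ring.
rewrite {2}/stepden; ring.
Qed.

End SmoothStep.

(** * Classes C^n on R^3 and their closure properties *)

Section R3Calc.
Context {R : realType}.
(** Restricting f to the line through x along v makes the one-variable chain rule available. *)
Lemma is_derive_dirP (f : R3 R -> R) x v d :
  is_derive x v f d <-> is_derive (0 : R) 1 (fun t : R => f (t *: v + x)) d.
Proof.
have E : 'D_v f x = 'D_1 (fun t : R => f (t *: v + x)) 0.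
  pose g (t : R) : R := f (t *: v + x).
  have F : (fun h : R => h^-1 *: ((f \o shift x) (h *: v) - f x)) =
           (fun h : R => h^-1 *: ((g \o shift 0) (h *: 1) - g 0)).
    by apply/funext => h /=; rewrite /g scale0r add0r addr0 [h *: 1]mulr1.
  by rewrite /derive F.
split=> -[h1 h2].
  by split; [exact/(derivable1P f x v)|rewrite -E].
by split; [exact/(derivable1P f x v)|rewrite E].
Qed.

Lemma is_derive_comp_dir (h : R -> R) (f : R3 R -> R) x v df dh :
  is_derive x v f df -> is_derive (f x) 1 h dh ->
  is_derive x v (h \o f) (dh * df).
Proof.
move=> /is_derive_dirP fd hd; apply/is_derive_dirP.
by apply: (is_derive1_comp (f := h) (g := fun t => f (t *: v + x))); rewrite ?scale0r ?add0r.
Qed.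

(** Recursion on the order turns each closure property into an induction on n in which only the
    partial derivatives have to be exhibited. *)
Fixpoint Cn (n : nat) (f : R3 R -> R) : Prop := continuous f /\
  (if n is n'.+1 then
     forall k, (forall x, derivable f x (basis3 R k)) /\ Cn n' (pderiv k f)
   else True).

Lemma Cn_continuous n f : Cn n f -> continuous f.
Proof. by case: n => [|n] []. Qed.

Lemma CnS n f : Cn n.+1 f -> Cn n f.
Proof.
elim: n f => [|n IH] f [cf df]; split => // k.
by have [d c] := df k; split => //; exact: IH.
Qed.

Lemma smooth_Cn f : (forall n, Cn n f) -> smooth f.
Proof.
move=> fC s.
have H : forall n, Cn n (iter_pderiv s f).
  by elim: s => [|k s IH] n //=; have [_ /(_ k)[]] := IH n.+1.
split; first exact: (Cn_continuous (H 0)).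
by move=> k x; have [_ /(_ k)[]] := H 1.
Qed.

Lemma pderivE k (f df : R3 R -> R) :
  (forall x, is_derive x (basis3 R k) f (df x)) -> pderiv k f = df.
Proof. by move=> fd; apply/funext => x; rewrite /pderiv (@derive_val _ _ _ _ _ _ _ (fd x)). Qed.

Lemma Cn_is_derive n f (df : 'I_3 -> R3 R -> R) : continuous f ->
  (forall k x, is_derive x (basis3 R k) f (df k x)) ->
  (forall k, Cn n (df k)) -> Cn n.+1 f.
Proof.
move=> cf fd dC; split => // k; split; last by rewrite (pderivE (fd k)).
by move=> x; exact: (@ex_derive _ _ _ _ _ _ _ (fd k x)).
Qed.

Lemma Cn_derive n f k x : Cn n.+1 f -> is_derive x (basis3 R k) f (pderiv k f x).
Proof. by move=> [_ /(_ k)[d _]]; split. Qed.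

Lemma Cn_cst n a : Cn n (cst a).
Proof.
elim: n a => [|n IH] a; first by split => //; exact: cst_continuous.
apply: (@Cn_is_derive _ _ (fun _ => cst 0)) => //; first exact: cst_continuous.
Qed.

Lemma CnD n f g : Cn n f -> Cn n g -> Cn n (fun x => f x + g x).
Proof.
elim: n f g => [|n IH] f g Cf Cg.
  by split => // x; apply: cvgD; [exact: Cf.1|exact: Cg.1].
apply: (@Cn_is_derive _ _ (fun k x => pderiv k f x + pderiv k g x)).
- by move=> x; apply: cvgD; [exact: Cf.1|exact: Cg.1].
- by move=> k x; apply: is_deriveD; exact: (Cn_derive (n := n)).
- by move=> k; apply: IH; [exact: (Cf.2 k).2|exact: (Cg.2 k).2].
Qed.

Lemma CnM n f g : Cn n f -> Cn n g -> Cn n (fun x => f x * g x).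
Proof.
elim: n f g => [|n IH] f g Cf Cg.
  by split => // x; apply: cvgM; [exact: Cf.1|exact: Cg.1].
apply: (@Cn_is_derive _ _ (fun k x => f x * pderiv k g x + g x * pderiv k f x)).
- by move=> x; apply: cvgM; [exact: Cf.1|exact: Cg.1].
- by move=> k x; apply: (is_deriveM (f := f) (g := g)); exact: (Cn_derive (n := n)).
- move=> k; apply: CnD; apply: IH.
  + exact: CnS. + exact: (Cg.2 k).2. + exact: CnS. + exact: (Cf.2 k).2.
Qed.


Lemma coord3E (x : R3 R) (k : 'I_3) : coord3 k x = if k == 0 then x.1.1 else if k == 1 then x.1.2 else x.2.
Proof. by case: k => -[|[|[|//]]] i. Qed.

Lemma continuous_coord3 k : continuous (@coord3 R k).
Proof.
have -> : @coord3 R k = fun x => if k == 0 then x.1.1 else if k == 1 then x.1.2 else x.2.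
  by apply/funext => x; rewrite coord3E.
case: (k == 0); [|case: (k == 1)] => x.
- by apply: (continuous_comp (f := fst) (g := fst)); exact: cvg_fst.
- by apply: (continuous_comp (f := fst) (g := snd)); [exact: cvg_fst|exact: cvg_snd].
- exact: cvg_snd.
Qed.

Lemma is_derive_coord3 k j x : is_derive x (basis3 R k) (@coord3 R j) (j == k)%:R.
Proof.
apply/is_derive_dirP.
have -> : (fun t : R => coord3 j (t *: basis3 R k + x)) = (fun t => (j == k)%:R * t + coord3 j x).
  apply/funext => t; rewrite !coord3E /= /GRing.scale/=.
  by case: j => -[|[|[|//]]] ? /=; case: k => -[|[|[|//]]] ? /=; rewrite ?mulr1 ?mulr0 ?mul1r ?mul0r.
apply: is_derive_eq; rewrite ?addr0 ?scaler1//; ring.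
Qed.

Lemma Cn_coord3 n k : Cn n (@coord3 R k).
Proof.
case: n => [|n]; first by split => //; exact: continuous_coord3.
apply: (@Cn_is_derive _ _ (fun j => cst (k == j)%:R)).
- exact: continuous_coord3.
- by move=> j x; exact: is_derive_coord3.
- by move=> j; exact: Cn_cst.
Qed.

(** The induction on n carries all m at once, since the derivative of [flat m] involves the next two
    indices. *)
Lemma Cn_flat n m f : Cn n f -> Cn n (flat m \o f).
Proof.
elim: n m f => [|n IH] m f Cf.
  by split => // x; apply: continuous_comp; [exact: Cf.1|exact: continuous_flat].
apply: (@Cn_is_derive _ _ (fun k x => (flat m.+2 (f x) + (- m%:R) * flat m.+1 (f x)) * pderiv k f x)).
- by move=> x; apply: continuous_comp; [exact: Cf.1|exact: continuous_flat].
- move=> k x; rewrite mulNr; apply: is_derive_comp_dir; last exact: is_derive_flat.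
  exact: (Cn_derive (n := n)).
- move=> k; apply: CnM; last exact: (Cf.2 k).2.
  apply: CnD; first by apply: IH; exact: CnS.
  by apply: CnM; [exact: Cn_cst|apply: IH; exact: CnS].
Qed.

Lemma Cn_powR n a f : (forall x, 0 < f x) -> Cn n f -> Cn n (fun x => f x `^ a).
Proof.
move=> f0; elim: n a => [|n IH] a Cf.
  split => // x; apply: (continuous_comp (g := fun s : R => s `^ a)); first exact: Cf.1.
  by apply/differentiable_continuous/derivable1_diffP/(@ex_derive _ _ _ _ _ _ _ (is_derive1_powR a (f0 x))).
apply: (@Cn_is_derive _ _ (fun k x => a * f x `^ (a - 1) * pderiv k f x)).
- move=> x; apply: (continuous_comp (g := fun s : R => s `^ a)); first exact: Cf.1.
  by apply/differentiable_continuous/derivable1_diffP/(@ex_derive _ _ _ _ _ _ _ (is_derive1_powR a (f0 x))).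
- move=> k x; apply: (is_derive_comp_dir (h := fun s => s `^ a)); last exact: is_derive1_powR.
  exact: (Cn_derive (n := n)).
- move=> k; apply: CnM; last exact: (Cf.2 k).2.
  by apply: CnM; [exact: Cn_cst|apply: IH; exact: CnS].
Qed.

Lemma Cn_affine n a b f : Cn n f -> Cn n (fun x => a * f x + b).
Proof. by move=> Cf; apply: CnD; [apply: CnM => //; exact: Cn_cst|exact: Cn_cst]. Qed.

Lemma Cn_step n f : Cn n f -> Cn n (step \o f).
Proof.
move=> Cf; apply: CnM; first exact: Cn_flat.
apply: Cn_powR; first by move=> x; exact: stepden_gt0.
apply: CnD; apply: Cn_flat => //.
have -> : (fun x => 1 - f x) = (fun x => (-1) * f x + 1) by apply/funext => x; ring.
exact: Cn_affine.
Qed.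
End R3Calc.

(** * Radial profiles, as functions of s = |z|^2 *)

Section Kernel.
Context {R : realType}.
Implicit Types (s t : R).

(* Positive everywhere and equal to [s] for [s >= 1/2], so that its negative powers are smooth. *)
Definition reg s : R := step (2 * s) * s + (1 - step (2 * s)).
Definition dreg s : R := 2 * dstep (2 * s) * (s - 1) + step (2 * s).
(** A cut-off of s^(-3/2): the field z kap(|z|^2) equals z |z|^-3 for |z| >= 1 and vanishes for
    |z|^2 <= 1/2. *)
Definition kap s : R := step (2 * s - 1) * reg s `^ (- (3 / 2)).
Definition dkap s : R := 2 * dstep (2 * s - 1) * reg s `^ (- (3 / 2))
  + step (2 * s - 1) * (- (3 / 2) * reg s `^ (- (3 / 2) - 1) * dreg s).
(** The divergence of z kap(|z|^2) at |z|^2 = s, by [div_kap]; it is supported in [1/2, 1]. *)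
Definition bump s : R := 4 * s * dstep (2 * s - 1) * reg s `^ (- (3 / 2)).

Lemma reg_gt0 s : 0 < reg s.
Proof.
rewrite /reg; have [s0|s0] := leP s 0; first by rewrite step_le0; lra.
have h1 := step_ge0 (2 * s); have h2 := step_le1 (2 * s).
have [|h] := eqVneq (step (2 * s)) 0; first by move=> ->; lra.
have h3 : 0 < step (2 * s) by rewrite lt_neqAle eq_sym h.
by have := mulr_gt0 h3 s0; lra.
Qed.

Lemma reg_id s : 1 / 2 <= s -> reg s = s.
Proof. by move=> hs; rewrite /reg step_ge1; lra. Qed.

Lemma is_derive_affine (a b t : R) : is_derive t 1 (fun s => a * s + b) a.
Proof. apply: is_derive_eq; rewrite ?addr0 ?scaler1//; rewrite /GRing.scale/=; ring. Qed.

Lemma is_derive_step_affine (a b t : R) :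
  is_derive t 1 (fun s => step (a * s + b)) (dstep (a * t + b) * a).
Proof.
apply: (is_derive1_comp (f := step) (g := fun s => a * s + b)).
  exact: is_derive_step.
exact: is_derive_affine.
Qed.

Lemma is_derive_reg t : is_derive t 1 reg (dreg t).
Proof.
have d2 : is_derive t 1 (fun s : R => 2 * s) 2.
  have -> : (fun s : R => 2 * s) = (fun s => 2 * s + 0) by apply/funext => s; rewrite addr0.
  exact: is_derive_affine.
have ds : is_derive t 1 (fun s => step (2 * s)) (dstep (2 * t) * 2).
  by apply: (is_derive1_comp (f := step) _ d2); exact: is_derive_step.
have dm := is_deriveM ds (is_derive_affine 1 (-1) t).
have dc : is_derive t 1 (cst 1 : R -> R) (0 : R) by exact: is_derive_cst.
have -> : reg = (fun s => step (2 * s)) * (fun s => 1 * s + (-1)) + cst 1.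
  apply/funext => s; change (reg s = step (2 * s) * (1 * s + (-1)) + 1); rewrite /reg; ring.
apply: is_derive_eq (is_deriveD dm dc) _.
rewrite /GRing.scale/= /dreg; ring.
Qed.

Lemma is_derive_kap t : is_derive t 1 kap (dkap t).
Proof.
have d1 := is_derive_step_affine 2 (-1) t.
have d2 := is_derive_powR_comp (- (3 / 2)) (reg_gt0 t) (is_derive_reg t).
by apply: is_derive_eq (is_deriveM d1 d2) _; rewrite /GRing.scale/= /dkap; ring.
Qed.

(* On the support of [step (2 * s - 1)] the profile is [s^(-3/2)], whose field [z |z|^-3] is divergence free. *)
Lemma div_kap s : 3 * kap s + 2 * s * dkap s = bump s.
Proof.
rewrite /kap /dkap /bump.
have [h|h] := leP (2 * s - 1) 0; first by rewrite (step_le0 h); ring.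
have -> : dreg s = 1 by rewrite /dreg dstep_ge1 ?step_ge1; lra.
have rs : reg s = s by apply: reg_id; lra.
have -> : reg s `^ (- (3 / 2) - 1) = s^-1 * reg s `^ (- (3 / 2)).
  have s0 : 0 < s by lra.
  rewrite rs -(powR_inv1 (ltW s0)) -powRD ?(gt_eqF s0) ?implybT//; congr (_ `^ _); ring.
field; lra.
Qed.

Lemma bump_ge0 s : 0 <= s -> 0 <= bump s.
Proof. by move=> s0; apply: mulr_ge0; rewrite ?powR_ge0//; apply: mulr_ge0; rewrite ?dstep_ge0//; lra. Qed.

Lemma bump_ge1 s : 1 <= s -> bump s = 0.
Proof. by move=> s1; rewrite /bump dstep_ge1 ?mulr0 ?mul0r//; lra. Qed.

Lemma kap_ge1 s : 1 <= s -> kap s = s `^ (- (3 / 2)).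
Proof. by move=> s1; rewrite /kap step_ge1 ?reg_id ?mul1r//; lra. Qed.

Lemma kap_half s : s <= 1 / 2 -> kap s = 0.
Proof. by move=> s1; rewrite /kap step_le0 ?mul0r//; lra. Qed.

Lemma continuous_reg : continuous reg.
Proof. exact: continuous_is_derive is_derive_reg. Qed.

Lemma continuous_dstep : continuous (@dstep R).
Proof.
move=> t; apply: cvgM.
  apply: cvgD; apply: cvgM; try exact: continuous_flat;
    apply: (continuous_comp (f := fun s : R => 1 - s)); try exact: continuous_flat;
    by apply: cvgB; [exact: cvg_cst|exact: cvg_id].
apply: (continuous_comp (f := @stepden R) (g := fun s => s `^ (-2))).
  apply: cvgD; first exact: continuous_flat.
  by apply: (continuous_comp (f := fun s : R => 1 - s)); [apply: cvgB; [exact: cvg_cst|exact: cvg_id]|exact: continuous_flat].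
by apply/differentiable_continuous/derivable1_diffP/(@ex_derive _ _ _ _ _ _ _ (is_derive1_powR _ (stepden_gt0 t))).
Qed.

Lemma continuous_bump : continuous bump.
Proof.
move=> t; apply: cvgM; first apply: cvgM.
- by apply: cvgM; [exact: cvg_cst|exact: cvg_id].
- apply: (continuous_comp (f := fun s : R => 2 * s - 1)); last exact: continuous_dstep.
  by apply: cvgB; [apply: cvgM; [exact: cvg_cst|exact: cvg_id]|exact: cvg_cst].
apply: (continuous_comp (f := reg) (g := fun s => s `^ _)); first exact: continuous_reg.
by apply/differentiable_continuous/derivable1_diffP/(@ex_derive _ _ _ _ _ _ _ (is_derive1_powR _ (reg_gt0 t))).
Qed.

(** Above 1/2 the product is at most s s^-3 = s^-2 <= 4, and below it vanishes. It is the squared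
    length of the field z kap(|z|^2). *)
Lemma kap_sq_bounded s : 0 <= s -> s * kap s ^+ 2 <= 4.
Proof.
move=> s0; have [h|h] := leP s (1 / 2); first by rewrite kap_half// expr0n/= mulr0; lra.
have -> : kap s = step (2 * s - 1) * s `^ (- (3 / 2)) by rewrite /kap reg_id// ltW.
have s1 : 0 < s by lra.
have -> : s * (step (2 * s - 1) * s `^ (- (3 / 2))) ^+ 2 = step (2 * s - 1) ^+ 2 * (s^-1 * s^-1).
  rewrite exprMn -(powR_mulrn 2 (powR_ge0 s _)) -powRrM.
  have -> : - (3 / 2) * 2%:R = -3 :> R by field.
  rewrite powRN (powR_mulrn 3%N (ltW s1)); field; lra.
have a := step_ge0 (2 * s - 1); have b := step_le1 (2 * s - 1).
have c : s^-1 <= 2 by rewrite -[leRHS]invrK lef_pV2 ?posrE ?invr_gt0//; lra.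
have d : 0 <= s^-1 by rewrite invr_ge0 ltW.
have e : s^-1 * s^-1 <= 4 by nra.
have f : 0 <= s^-1 * s^-1 by exact: mulr_ge0.
have g : step (2 * s - 1) ^+ 2 <= 1 by rewrite expr_le1.
have h' : 0 <= step (2 * s - 1) ^+ 2 by exact: exprn_ge0.
nra.
Qed.
End Kernel.

(** * Regularized Newton fields and the mollifiers that are their divergences *)

Section Fields.
Context {R : realType}.
Implicit Types (x y z : R3 R) (r : R).

Definition normsq z : R := z.1.1 ^+ 2 + z.1.2 ^+ 2 + z.2 ^+ 2.

(** Component k of a regularization at scale r of (y - x) |y - x|^-3, which up to sign is the
    gradient of the Newton potential 1 / |y - x|. *)
Definition newton r (k : 'I_3) x y : R :=
  r ^- 3 * coord3 k (y - x) * kap (r ^- 2 * normsq (y - x)).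

Definition delta r x y : R := r ^- 3 * bump (r ^- 2 * normsq (y - x)).

(** A ball of the maximum norm: being a product of intervals it is measurable with explicit volume,
    and it contains the Euclidean ball of the same radius. *)
Definition cube x r : set (R3 R) := [set y | `|y - x| <= r].

Lemma normsq_ge0 z : 0 <= normsq z.
Proof. by rewrite !addr_ge0 ?sqr_ge0. Qed.

Lemma coord3_sq_le k z : coord3 k z ^+ 2 <= normsq z.
Proof.
have a := sqr_ge0 z.1.1; have b := sqr_ge0 z.1.2; have c := sqr_ge0 z.2.
by rewrite /normsq coord3E; case: ifP => _; [|case: ifP => _]; lra.
Qed.

Lemma coord3B k x y : coord3 k (y - x) = coord3 k y - coord3 k x.
Proof. by rewrite !coord3E; case: ifP => _; [|case: ifP => _]. Qed.

Lemma norm3_le z r : (`|z| <= r) <-> [/\ `|z.1.1| <= r, `|z.1.2| <= r & `|z.2| <= r].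
Proof.
rewrite !prod_normE /= !ge_max; split.
  by move=> /andP[/andP[]].
by case=> -> -> ->.
Qed.

Lemma normsq_gt z r : 0 < r -> ~ (`|z| <= r) -> r ^+ 2 <= normsq z.
Proof.
move=> r0 /norm3_le h.
have [//|lt] := leP (r ^+ 2) (normsq z); exfalso; apply: h.
have H k : `|coord3 k z| <= r.
  rewrite -ler_sqr ?nnegrE ?(ltW r0)// real_normK ?num_real//.
  exact: le_trans (coord3_sq_le k z) (ltW lt).
by split; [exact: (H 0)|exact: (H 1)|exact: (H 2%:R)].
Qed.

Lemma cubeE x r : cube x r =
  `[x.1.1 - r, x.1.1 + r]%classic `*` `[x.1.2 - r, x.1.2 + r]%classic `*` `[x.2 - r, x.2 + r]%classic.
Proof.
apply/seteqP; split=> y; rewrite /cube /= !in_itv/=.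
  move=> /norm3_le[h1 h2 h3]; rewrite -!ler_distl.
  by split; first split; [exact: h1|exact: h2|exact: h3].
by move=> [[h1 h2] h3]; apply/norm3_le; rewrite /= !ler_distl.
Qed.

Lemma measurable_cube x r : measurable (cube x r : set (M3 R)).
Proof. by rewrite cubeE; do ! apply: measurableX. Qed.

Lemma compact_cube x r : compact (cube x r).
Proof. by rewrite cubeE; do ! apply: compact_setX; exact: segment_compact. Qed.

Lemma cube_sub x y r s : `|y - x| <= s -> cube y r `<=` cube x (r + s).
Proof.
move=> h z; rewrite /cube /= => hz.
have -> : z - x = (z - y) + (y - x) by rewrite addrA subrK.
rewrite (le_trans (ler_normD _ _))//.
exact: lerD.
Qed.

Lemma cube_sym x y r : cube x r y = cube y r x.
Proof. by rewrite /cube /= distrC. Qed.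

Lemma leb3_cube x r : 0 <= r -> leb3 R (cube x r : set (M3 R)) = ((2 * r) ^+ 3)%:E.
Proof.
move=> r0; rewrite cubeE.
have I a : lebesgue_measure `[a - r, a + r]%classic = (2 * r)%:E.
  rewrite lebesgue_measure_itv/= lte_fin; case: ifPn => [_|].
    by rewrite -EFinB; congr EFin; ring.
  by rewrite -leNgt => h; congr EFin; lra.
have E := (@product_measure1E _ _ _ _ R (@lebesgue2 R) (@lebesgue_measure R)
  (`[x.1.1 - r, x.1.1 + r]%classic `*` `[x.1.2 - r, x.1.2 + r]%classic) (`[x.2 - r, x.2 + r]%classic)).
rewrite [LHS]E//; last exact: measurableX.
rewrite [X in (X * _)%E]product_measure1E//= !I -!EFinM; congr EFin; ring.
Qed.

Lemma Cn_coord3_sub n k x : Cn n (fun y => coord3 k (y - x)).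
Proof.
have -> : (fun y => coord3 k (y - x)) = (fun y => coord3 k y + - coord3 k x).
  by apply/funext => y; rewrite coord3B.
by apply: CnD; [exact: Cn_coord3|exact: Cn_cst].
Qed.

Lemma Cn_normsq n x : Cn n (fun y => normsq (y - x)).
Proof.
have -> : (fun y => normsq (y - x)) = (fun y => coord3 0 (y - x) * coord3 0 (y - x)
   + coord3 1 (y - x) * coord3 1 (y - x) + coord3 2%:R (y - x) * coord3 2%:R (y - x)).
  by apply/funext => y; rewrite /normsq !expr2.
by apply: CnD; [apply: CnD|]; apply: CnM; exact: Cn_coord3_sub.
Qed.

Lemma Cn_newton n r k x : Cn n (newton r k x).
Proof.
apply: CnM; first by apply: CnM; [exact: Cn_cst|exact: Cn_coord3_sub].
have Cs : Cn n (fun y => r ^- 2 * normsq (y - x)) by apply: CnM; [exact: Cn_cst|exact: Cn_normsq].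
have C2 : Cn n (fun y => 2 * (r ^- 2 * normsq (y - x))) by apply: CnM => //; exact: Cn_cst.
apply: CnM.
  apply: (Cn_step (f := fun y => 2 * (r ^- 2 * normsq (y - x)) - 1)).
  by apply: CnD => //; exact: Cn_cst.
apply: Cn_powR; first by move=> y; exact: reg_gt0.
apply: CnD; first by apply: CnM => //; exact: (Cn_step C2).
apply: CnD; first exact: Cn_cst.
have -> : (fun y => - step (2 * (r ^- 2 * normsq (y - x)))) = (fun y => (-1) * step (2 * (r ^- 2 * normsq (y - x)))).
  by apply/funext => y; rewrite mulN1r.
by apply: CnM; [exact: Cn_cst|exact: (Cn_step C2)].
Qed.

Lemma is_derive_coord3_sub k j x y :
  is_derive y (basis3 R k) (fun y => coord3 j (y - x)) (j == k)%:R.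
Proof.
have -> : (fun y => coord3 j (y - x)) = @coord3 R j + cst (- coord3 j x).
  by apply/funext => z; rewrite coord3B.
apply: is_derive_eq (is_deriveD (is_derive_coord3 k j y) (is_derive_cst _ _ _)) _.
by rewrite addr0.
Qed.

Lemma is_derive_normsq k x y :
  is_derive y (basis3 R k) (fun y => normsq (y - x)) (2 * coord3 k (y - x)).
Proof.
have -> : (fun y => normsq (y - x)) =
   (fun y => coord3 0 (y - x)) * (fun y => coord3 0 (y - x))
   + (fun y => coord3 1 (y - x)) * (fun y => coord3 1 (y - x))
   + (fun y => coord3 2%:R (y - x)) * (fun y => coord3 2%:R (y - x)).
  by apply/funext => z; rewrite /normsq !expr2.
have d j := is_derive_coord3_sub k j x y.
apply: is_derive_eq (is_deriveD (is_deriveD (is_deriveM (d 0) (d 0)) (is_deriveM (d 1) (d 1))) (is_deriveM (d 2%:R) (d 2%:R))) _.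
rewrite /GRing.scale/=; case: k d => -[|[|[|//]]] i d.
- rewrite (_ : Ordinal i = 0); last exact/val_inj. rewrite /=; ring.
- rewrite (_ : Ordinal i = 1); last exact/val_inj. rewrite /=; ring.
- rewrite (_ : Ordinal i = 2%:R); last exact/val_inj. rewrite /=; ring.
Qed.

(** The Jacobian of the field. Its symmetry makes the field curl free, and its trace is [delta]. *)
Definition dnewton r (k j : 'I_3) x y : R :=
  r ^- 3 * (kap (r ^- 2 * normsq (y - x)) * (k == j)%:R
   + coord3 k (y - x) * (dkap (r ^- 2 * normsq (y - x)) * (r ^- 2 * (2 * coord3 j (y - x))))).

Lemma pderiv_newton r k j x : pderiv j (newton r k x) = dnewton r k j x.
Proof.
apply: pderivE => y.
have dn : is_derive y (basis3 R j) (fun y => r ^- 2 * normsq (y - x)) (r ^- 2 * (2 * coord3 j (y - x))).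
  have -> : (fun y => r ^- 2 * normsq (y - x)) = r ^- 2 \*: (fun y => normsq (y - x)) by [].
  exact: (is_deriveZ _ (is_derive_normsq j x y)).
have dk := is_derive_comp_dir dn (is_derive_kap (r ^- 2 * normsq (y - x))).
have dm := is_deriveM (is_derive_coord3_sub j k x y) dk.
have -> : newton r k x = r ^- 3 \*: ((fun y => coord3 k (y - x)) * (kap \o (fun y => r ^- 2 * normsq (y - x)))).
  by apply/funext => z; rewrite /newton /= -mulrA.
apply: is_derive_eq (is_deriveZ _ dm) _.
rewrite /dnewton /GRing.scale/=; ring.
Qed.

Lemma dnewton_sym r k j x y : dnewton r k j x y = dnewton r j k x y.
Proof. by rewrite /dnewton eq_sym; ring. Qed.

Lemma div_newton r x y : \sum_(k < 3) dnewton r k k x y = delta r x y.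
Proof.
rewrite /delta -div_kap -mulr_sumr; congr (_ * _).
rewrite !big_ord_recl big_ord0 /= /normsq; set K := kap _; set D := dkap _.
rewrite !coord3E /=; ring.
Qed.

(** The powers of r cancel by homogeneity. As r disappears from the right-hand side, fields at two
    scales differ only on a cube. *)
Lemma newton_far r x y : 0 < r -> ~ cube x r y -> forall k,
  newton r k x y = coord3 k (y - x) * normsq (y - x) `^ (- (3 / 2)).
Proof.
move=> r0 /(normsq_gt r0) h k; rewrite /newton kap_ge1; last first.
  by rewrite mulrC ler_pdivlMr ?exprn_gt0// mul1r.
have n0 : 0 <= normsq (y - x) := normsq_ge0 _.
rewrite powRM//; last by rewrite invr_ge0 exprn_ge0// ltW.
have -> : (r ^- 2) `^ (- (3 / 2)) = r ^+ 3.
  rewrite -(powR_mulrn 2 (ltW r0)) -powRN -powRrM.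
  have -> : - 2%:R * - (3 / 2) = 3%:R :> R by field.
  by rewrite powR_mulrn// ltW.
field; rewrite gt_eqF//.
Qed.

(** After squaring both sides, the 2 becomes the 4 of [kap_sq_bounded]. *)
Lemma newton_bound r k x y : 0 < r -> `|newton r k x y| <= 2 * r ^- 2.
Proof.
move=> r0; have q0 : 0 <= 2 * r ^- 2 by rewrite mulr_ge0// invr_ge0 exprn_ge0 ?ltW.
rewrite -ler_sqr ?nnegrE// real_normK ?num_real//.
set s := r ^- 2 * normsq (y - x).
have s0 : 0 <= s by rewrite mulr_ge0 ?normsq_ge0// invr_ge0 exprn_ge0 ?ltW.
have h := kap_sq_bounded s0.
have h2 := coord3_sq_le k (y - x).
rewrite /newton -/s.
have -> : (r ^- 3 * coord3 k (y - x) * kap s) ^+ 2 = r ^- 4 * (r ^- 2 * coord3 k (y - x) ^+ 2 * kap s ^+ 2).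
  field; rewrite gt_eqF//.
have -> : (2 * r ^- 2) ^+ 2 = r ^- 4 * 4 by field; rewrite gt_eqF//.
apply: ler_wpM2l; first by rewrite invr_ge0 exprn_ge0 ?ltW.
apply: le_trans h; apply: ler_wpM2r; first exact: sqr_ge0.
by apply: ler_wpM2l => //; rewrite invr_ge0 exprn_ge0 ?ltW.
Qed.

Lemma delta_ge0 r x y : 0 < r -> 0 <= delta r x y.
Proof.
move=> r0; apply: mulr_ge0; first by rewrite invr_ge0 exprn_ge0// ltW.
by apply/bump_ge0/mulr_ge0; rewrite ?normsq_ge0// invr_ge0 exprn_ge0// ltW.
Qed.

Lemma delta_far r x y : 0 < r -> ~ cube x r y -> delta r x y = 0.
Proof.
move=> r0 /(normsq_gt r0) h; rewrite /delta bump_ge1 ?mulr0//.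
by rewrite mulrC ler_pdivlMr ?exprn_gt0// mul1r.
Qed.

Lemma bump_bounded : exists2 M : R, 0 < M & forall s, 0 <= s -> bump s <= M.
Proof.
have [|c _ hc] := @EVT_max R bump 0 1 ler01.
  exact/continuous_subspaceT/continuous_bump.
exists (`|bump c| + 1) => [|s s0]; first by rewrite ltr_wpDl.
have [s1|s1] := leP s 1; last by rewrite bump_ge1 ?(ltW s1)// addr_ge0.
rewrite (le_trans (hc s _))//; first by rewrite in_itv/= s0.
by rewrite (le_trans (ler_norm _))// lerDl.
Qed.

Lemma delta_bounded : exists2 M : R, 0 < M & forall r x y, 0 < r -> delta r x y <= M * r ^- 3.
Proof.
have [M M0 h] := bump_bounded; exists M => // r x y r0.
rewrite /delta mulrC; apply: ler_wpM2r; first by rewrite invr_ge0 exprn_ge0 ?ltW.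
by apply: h; rewrite mulr_ge0 ?normsq_ge0// invr_ge0 exprn_ge0 ?ltW.
Qed.

Lemma delta_scale r x y : 0 < r -> delta r x y = r ^- 3 * bump (normsq (r^-1 *: (y - x))).
Proof.
move=> r0; rewrite /delta; congr (_ * bump _).
rewrite /normsq /= /GRing.scale /=; field; rewrite gt_eqF//.
Qed.

Lemma measurable_bump_normsq : measurable_fun setT (fun z : M3 R => bump (normsq z)).
Proof.
apply: (measurableT_comp (continuous_measurable_fun continuous_bump)).
apply: measurable_funD; first apply: measurable_funD.
- apply: (measurable_funX 2); exact: (measurableT_comp measurable_fst measurable_fst).
- apply: (measurable_funX 2); exact: (measurableT_comp measurable_snd measurable_fst).
- by apply: (measurable_funX 2); exact: measurable_snd.
Qed.

Lemma measurable_delta2 r : measurable_fun setT (fun p : M3 R * M3 R => delta r p.1 p.2).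
Proof.
apply: measurable_funM; first exact: measurable_cst.
apply: (measurableT_comp (continuous_measurable_fun continuous_bump)).
apply: measurable_funM; first exact: measurable_cst.
apply: measurable_funD; first apply: measurable_funD.
- apply: (measurable_funX 2); apply: measurable_funB.
    exact: (measurableT_comp (measurableT_comp measurable_fst measurable_fst) measurable_snd).
  exact: (measurableT_comp (measurableT_comp measurable_fst measurable_fst) measurable_fst).
- apply: (measurable_funX 2); apply: measurable_funB.
    exact: (measurableT_comp (measurableT_comp measurable_snd measurable_fst) measurable_snd).
  exact: (measurableT_comp (measurableT_comp measurable_snd measurable_fst) measurable_fst).
- apply: (measurable_funX 2); apply: measurable_funB.
    exact: (measurableT_comp measurable_snd measurable_snd).
  exact: (measurableT_comp measurable_snd measurable_fst).
Qed.

Lemma continuous_delta r x : continuous (delta r x).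
Proof.
have -> : delta r x = (fun y => \sum_(k < 3) pderiv k (newton r k x) y).
  by apply/funext => y; under eq_bigr do rewrite pderiv_newton; rewrite div_newton.
have H : Cn 0 (fun y => pderiv 0 (newton r 0 x) y + pderiv 1 (newton r 1 x) y + pderiv 2%:R (newton r 2%:R x) y).
  have C k : Cn 0 (pderiv k (newton r k x)) := ((Cn_newton 1 r k x).2 k).2.
  by apply: CnD => //; exact: CnD.
have -> : (fun y => \sum_(k < 3) pderiv k (newton r k x) y) = (fun y => pderiv 0 (newton r 0 x) y + pderiv 1 (newton r 1 x) y + pderiv 2%:R (newton r 2%:R x) y).
  apply/funext => y; rewrite !big_ord_recl big_ord0 addr0 addrA; congr (_ + _ + _).
exact: (Cn_continuous H).
Qed.
End Fields.
Arguments cube {R} (x r)%_ring_scope.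
Arguments delta {R} (r x y)%_ring_scope.
Arguments normsq {R} z%_ring_scope.

(** * Exchange of integrals over moving cubes, and the mass of the mollifier *)

Section Potential.
Context {R : realType}.
Local Notation mu := (@lebesgue3 R).

Lemma continuous_normsq : continuous (normsq : R3 R -> R).
Proof.
have := Cn_continuous (Cn_normsq 0 (0 : R3 R)).
have -> : (fun y : R3 R => normsq (y - 0)) = normsq by apply/funext => y; rewrite subr0.
by [].
Qed.

Local Open Scope ereal_scope.

Lemma measurable_near3 (r : R) : measurable [set p : M3 R * M3 R | cube p.1 r p.2].
Proof.
pose f (p : M3 R * M3 R) : M3 R := ((p.2 : R3 R) - p.1)%R.
have mf : measurable_fun setT f.
  apply/measurable_fun_pairP; split; first apply/measurable_fun_pairP; first split.
  - apply: measurable_funB.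
      exact: (measurableT_comp (measurableT_comp measurable_fst measurable_fst) measurable_snd).
    exact: (measurableT_comp (measurableT_comp measurable_fst measurable_fst) measurable_fst).
  - apply: measurable_funB.
      exact: (measurableT_comp (measurableT_comp measurable_snd measurable_fst) measurable_snd).
    exact: (measurableT_comp (measurableT_comp measurable_snd measurable_fst) measurable_fst).
  - apply: measurable_funB.
      exact: (measurableT_comp measurable_snd measurable_snd).
    exact: (measurableT_comp measurable_snd measurable_fst).
have -> : [set p : M3 R * M3 R | cube p.1 r p.2] = setT `&` f @^-1` (cube 0 r).
  by rewrite setTI; apply/seteqP; split=> p; rewrite /cube/= subr0.
exact: mf (measurable_cube _ _).
Qed.

Lemma measurable_indic_cube x r : measurable_fun setT (\1_(cube x r) : M3 R -> R).
Proof. by apply: measurable_indic; exact: measurable_cube. Qed.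

(** By Tonelli a given z is counted only for y in a cube of volume (2r)^3 about z, and z must lie in
    the cube of radius r + s about x. The r^3 gained here outweighs the r^-2 of the increments. *)
Lemma integral_cube_swap (W : M3 R -> R) x (r s : R) :
  measurable_fun setT W -> (forall y, 0 <= W y)%R -> (0 < r)%R ->
  \int[mu]_(y in cube x s) \int[mu]_(z in cube y r) (W z)%:E <=
  ((2 * r) ^+ 3)%:E * \int[mu]_(z in cube x (r + s)) (W z)%:E.
Proof.
move=> mW W0 r0.
pose N := [set p : M3 R * M3 R | cube p.1 r p.2].
pose F (p : M3 R * M3 R) := (\1_(cube x s) p.1 * \1_N p * W p.2)%:E.
have mF : measurable_fun setT F.
  apply/measurable_EFinP; apply: measurable_funM; first apply: measurable_funM.
  - exact: (measurableT_comp (measurable_indic_cube x s) measurable_fst).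
  - by apply: measurable_indic; exact: measurable_near3.
  - exact: (measurableT_comp mW measurable_snd).
have F0 p : 0 <= F p by rewrite lee_fin !mulr_ge0.
have -> : \int[mu]_(y in cube x s) \int[mu]_(z in cube y r) (W z)%:E = \int[mu]_y \int[mu]_z F (y, z).
  rewrite integral_mkcond; apply: eq_integral => y _; rewrite patchE.
  case: ifPn => ys; last first.
    by rewrite integral0_eq// => z _; rewrite /F /= indicE (negbTE ys) !mul0r.
  rewrite integral_mkcond; apply: eq_integral => z _; rewrite patchE /F /= !indicE ys mul1r.
  have -> : ((y, z) \in N) = (z \in cube y r) by apply/idP/idP; rewrite !inE.
  by case: ifP => _; rewrite ?mul1r ?mul0r.
rewrite (fubini_tonelli F mF F0).
pose H z := ((2 * r) ^+ 3 * (W z * \1_(cube x (r + s)) z))%:E.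
have mH : measurable_fun setT (fun z : M3 R => (W z * \1_(cube x (r + s)) z)%:E).
  by apply/measurable_EFinP/measurable_funM => //; exact: measurable_indic_cube.
have -> : ((2 * r) ^+ 3)%:E * \int[mu]_(z in cube x (r + s)) (W z)%:E = \int[mu]_z H z.
  rewrite integral_mkcond -ge0_integralZl_EFin//.
  - apply: eq_integral => z _; rewrite patchE /H indicE.
    by case: ifP => _; rewrite ?mulr1 ?mulr0 ?mule0 -?EFinM.
  - by move=> z _; rewrite patchE; case: ifP => _ //; rewrite lee_fin.
  - apply: eq_measurable_fun mH => z _ /=; rewrite patchE indicE.
    by case: ifP => _; rewrite ?mulr1 ?mulr0.
  - by rewrite exprn_ge0// mulr_ge0// ltW.
apply: ge0_le_integral => //.
- by move=> z _; exact: integral_ge0.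
- exact: (measurable_fun_fubini_tonelli_G F).
- by apply: eq_measurable_fun (emeasurable_funM (measurable_cst ((2 * r) ^+ 3)%:E) mH) => z _ /=; rewrite -EFinM.
move=> z _.
have [zs|zs] := pselect (cube x (r + s) z); last first.
  have Hz : 0 <= H z by rewrite lee_fin mulr_ge0 ?exprn_ge0 ?mulr_ge0// ltW.
  rewrite integral0_eq// => y _.
  rewrite /F /= !indicE.
  have [ys|_] := boolP (y \in cube x s); last by rewrite !mul0r.
  have [yz|_] := boolP ((y, z) \in N); last by rewrite mulr0 mul0r.
  by exfalso; apply: zs; move: ys yz; rewrite !inE => ys yz; exact: (cube_sub ys yz).
rewrite /H indicE mem_set// mulr1.
apply: le_trans (_ : \int[mu]_y (W z * \1_(cube z r) y)%:E <= _).
  apply: ge0_le_integral => //.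
  - exact: (measurableT_comp mF (measurable_pair2 z)).
  - by apply/measurable_EFinP/measurable_funM => //; exact: measurable_indic_cube.
  move=> y _; rewrite lee_fin /F /= !indicE mulrC; apply: ler_wpM2l => //.
  have -> : ((y, z) \in N) = (y \in cube z r) by apply/idP/idP; rewrite !inE /N /= cube_sym.
  by case: (y \in cube x s); rewrite ?mul1r// mul0r.
under eq_integral do rewrite EFinM.
rewrite ge0_integralZl_EFin//; last first.
  by apply/measurable_EFinP; exact: measurable_indic_cube.
rewrite integral_indic//; last exact: measurable_cube.
by rewrite setIT leb3_cube ?(ltW r0)// -EFinM mulrC.
Qed.

(** The affine change of variables reduces every scale to r = 1, where the integrand is bounded,
    vanishes off a cube, and is positive near one point. The value of the mass stays abstract. *)
Lemma delta_mass : exists2 c : R, (0 < c)%R &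
  forall r y, (0 < r)%R -> \int[mu]_x (delta r x y)%:E = c%:E.
Proof.
pose B (z : M3 R) : R := bump (normsq z).
have mB : measurable_fun setT (EFin \o B) by apply/measurable_EFinP; exact: measurable_bump_normsq.
have B0 z : 0 <= (EFin \o B) z by rewrite lee_fin bump_ge0// normsq_ge0.
pose c := \int[mu]_z (B z)%:E.
have Bfar (z : R3 R) : ~ cube 0 1 z -> B z = 0%R.
  rewrite /cube /= subr0 => /(normsq_gt ltr01); rewrite expr1n; exact: bump_ge1.
have cfin : c < +oo.
  have [M M0 hM] := @bump_bounded R.
  apply: le_lt_trans (_ : M%:E * \int[mu]_z (\1_(cube 0 1) z)%:E < +oo).
    rewrite -ge0_integralZl_EFin//; first last.
    - exact: ltW.
    - apply/measurable_EFinP; exact: measurable_indic_cube.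
    apply: ge0_le_integral => //.
    - by move=> z _; exact: B0.
    - by apply: emeasurable_funM => //; apply/measurable_EFinP; exact: measurable_indic_cube.
    - move=> z _; rewrite -EFinM lee_fin indicE; have [_|zN] := boolP (z \in cube 0 1).
        by rewrite mulr1; apply/hM/normsq_ge0.
      by rewrite mulr0 Bfar// => h; rewrite mem_set in zN.
  rewrite integral_indic//; last exact: measurable_cube.
  by rewrite setIT leb3_cube// -EFinM ltry.
have c0 : 0 < c.
  (* Its squared length 3/4 is the midpoint of the interval [1/2, 1] supporting [bump]. *)
  pose z0 : R3 R := ((Num.sqrt (3 / 4))%R, 0%R, 0%R).
  have Bz0 : (0 < B z0)%R.
    rewrite /B /normsq /= expr0n/= !addr0 sqr_sqrtr; last by lra.
    rewrite /bump; apply: mulr_gt0; last exact: powR_gt0 (reg_gt0 _).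
    by apply: mulr_gt0; first lra; apply: dstep_gt0; lra.
  have Bc : {for z0, continuous (B : R3 R -> R)}.
    by apply: (continuous_comp (f := normsq)); [exact: continuous_normsq|exact: continuous_bump].
  have : \forall z \near z0, (B z0 / 2 < B z)%R.
    have H2 : \forall t \near B z0, (B z0 / 2 < t)%R by apply: lt_nbhsr; lra.
    exact: (Bc _ H2).
  move=> /nbhs_ballP[e /= e0 he].
  have h z : cube z0 (e / 2) z -> (B z0 / 2 <= B z)%R.
    move=> hz; apply/ltW/he; rewrite -ball_normE /= distrC (le_lt_trans hz)//; lra.
  apply: lt_le_trans (_ : \int[mu]_(z in cube z0 (e / 2)) (B z0 / 2)%:E <= _).
    rewrite integral_cst//; last exact: measurable_cube.
    by rewrite leb3_cube -?EFinM ?lte_fin; [apply: mulr_gt0; [lra|apply: exprn_gt0; lra]|lra].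
  apply: le_trans (_ : \int[mu]_(z in cube z0 (e / 2)) (B z)%:E <= _).
    apply: ge0_le_integral => //.
    - exact: measurable_cube.
    - by move=> z _; rewrite lee_fin; lra.
    - exact: measurable_funTS.
  apply: ge0_subset_integral; [exact: measurable_cube|exact: measurableT|exact: mB| |exact: subsetT].
  by move=> z _; exact: B0.
have cE : c = (fine c)%:E by rewrite fineK// ge0_fin_numE// ltW.
exists (fine c) => [|r y r0]; first by rewrite fine_gt0// c0.
rewrite -cE.
have E := ge0_integral_affine3 y r0 mB B0.
have r3 : (r ^+ 3 != 0)%R by rewrite expf_neq0// gt_eqF.
have E2 : \int[mu]_x ((r ^+ 3)%:E * (delta r x y)%:E) = (r ^+ 3)%:E * c.
  apply: etrans E; apply: eq_integral => x _.
  by rewrite -EFinM delta_scale// mulrA mulfV// mul1r.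
have md : measurable_fun setT (fun x : M3 R => (delta r x y)%:E).
  by apply/measurable_EFinP; exact: (measurableT_comp (measurable_delta2 r) (measurable_pair2 y)).
have r30 : (0 <= r ^+ 3)%R by rewrite exprn_ge0// ltW.
rewrite ge0_integralZl_EFin// in E2; last by move=> x _; rewrite lee_fin delta_ge0.
have := congr1 (mule (r ^- 3)%:E) E2.
by rewrite !muleA -!EFinM mulVf// !mul1e.
Qed.
End Potential.

(** * Sets with negligible boundary determine integrable functions *)

Section JordanSets.
Context {R : realType}.
Local Notation mu := (@lebesgue3 R).
Local Notation lam := (@lebesgue_measure R).
Local Open Scope ereal_scope.

#[global] Instance ae_lebesgue3_filter : Filter (almost_everywhere mu).
Proof. exact: ae_filter_ringOfSetsType. Qed.

#[global] Instance ae_lebesgue3_nbhs_filter : Filter (nbhs (almost_everywhere mu)).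
Proof. exact: ae_lebesgue3_filter. Qed.

(** Almost every point is interior to B or to its complement. At such a point the mollified
    indicator is eventually exact, see [cvg_kmass]. *)
Definition jordan (B : set (M3 R)) : Prop := measurable B /\
  {ae mu, forall y, exists2 r : R, (0 < r)%R & cube y r `<=` B \/ cube y r `<=` ~` B}.

Lemma jordanI : setI_closed jordan.
Proof.
move=> A B [mA hA] [mB hB]; split; first exact: measurableI.
apply: filterS2 hA hB => y [r r0 hr] [s s0 hs].
exists (Num.min r s); first by rewrite lt_min r0.
have cr : cube y (Num.min r s) `<=` cube y r by move=> z; rewrite /cube/= le_min => /andP[].
have cs : cube y (Num.min r s) `<=` cube y s by move=> z; rewrite /cube/= le_min => /andP[].
case: hr => hr; last by right => z /cr/hr h [].
case: hs => hs; last by right => z /cs/hs h [].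
by left=> z hz; split; [exact/hr/cr|exact/hs/cs].
Qed.

Lemma negligible_plane (k : 'I_3) (a : R) :
  mu.-negligible [set y : M3 R | coord3 k y = a].
Proof.
have S1 : lam [set a] = 0 by exact: lebesgue_measure_set1.
have E := @product_measure1E _ _ _ _ R (@lebesgue2 R) lam.
have E2 A B : measurable A -> measurable B -> lebesgue2 (A `*` B) = lam A * lam B.
  exact: (@product_measure1E _ _ _ _ R lam lam).
case: k => -[|[|[|//]]] i.
- have -> : [set y : M3 R | coord3 (Ordinal i) y = a] = ([set a] `*` setT) `*` setT.
    by apply/seteqP; split=> [y|y [[]]] //=.
  apply/negligibleP; first by do 2 apply: measurableX => //.
  rewrite [LHS]E//; last exact: measurableX.
  by rewrite [X in X * _]E2// S1 !mul0e.
- have -> : [set y : M3 R | coord3 (Ordinal i) y = a] = (setT `*` [set a]) `*` setT.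
    by apply/seteqP; split=> [y|y [[]]] //=.
  apply/negligibleP; first by do 2 apply: measurableX => //.
  rewrite [LHS]E//; last exact: measurableX.
  by rewrite [X in X * _]E2// S1 mule0 mul0e.
- have -> : [set y : M3 R | coord3 (Ordinal i) y = a] = setT `*` [set a].
    by apply/seteqP; split=> [y|y []] //=.
  apply/negligibleP; first exact: measurableX.
  by rewrite [LHS]E// [X in _ * X]S1 mule0.
Qed.

Lemma measurable_coord3 k : measurable_fun setT (@coord3 R k : M3 R -> R).
Proof.
have -> : (@coord3 R k : M3 R -> R) = fun x => if k == 0%R then x.1.1 else if k == 1%R then x.1.2 else x.2.
  by apply/funext => x; rewrite coord3E.
case: (k == 0%R); [|case: (k == 1%R)].
- exact: (measurableT_comp measurable_fst measurable_fst).
- exact: (measurableT_comp measurable_snd measurable_fst).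
- exact: measurable_snd.
Qed.

Lemma norm_coord3 k (z : R3 R) : (`|coord3 k z| <= `|z|)%R.
Proof.
have [h1 h2 h3] := (norm3_le z `|z|%R).1 (lexx _).
by rewrite coord3E; case: ifP => _; [|case: ifP => _].
Qed.

Lemma jordanC B : jordan B -> jordan (~` B).
Proof.
move=> [mB hB]; split; first exact: measurableC.
by apply: filterS hB => y [r r0 h]; exists r => //; rewrite setCK; case: h; [right|left].
Qed.

(** The flag b treats the closed and the open half-space together. Off the bounding plane, half the
    distance to it is an admissible radius. *)
Lemma jordan_halfspace k (a : R) (b : bool) : jordan [set y : M3 R | (a < coord3 k y ?<= if b)%R].
Proof.
have mp (A : set R) : measurable A -> measurable (@coord3 R k @^-1` A : set (M3 R)).
  by move=> mA; rewrite -[X in measurable X]setTI; exact: measurable_coord3.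
split.
  have -> : [set y : M3 R | (a < coord3 k y ?<= if b)%R] =
      @coord3 R k @^-1` (if b then `[a, +oo[%classic else `]a, +oo[%classic).
    by apply/seteqP; split=> y /=; case: b; rewrite /= in_itv/= andbT.
  by apply: mp; case: b.
have mN : measurable [set y : M3 R | coord3 k y = a] by apply: (mp [set a]).
exists [set y : M3 R | coord3 k y = a]; split => //.
  by apply/negligibleP => //; exact: negligible_plane.
move=> y /=; apply: contra_notP => yk.
pose d := (`|coord3 k y - a| / 2)%R.
have d0 : (0 < d)%R by rewrite divr_gt0// normr_gt0 subr_eq0; apply/eqP.
exists d => //.
have H z : cube y d z -> (`|coord3 k z - coord3 k y| <= d)%R.
  by move=> hz; rewrite -coord3B; apply: le_trans (norm_coord3 _ _) hz.
have [lt|gt|/esym//] := ltgtP a (coord3 k y); [left|right] => z /H /=; rewrite ler_distl /d.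
  by rewrite gtr0_norm ?subr_gt0// => /andP[h _]; case: b => /=; lra.
rewrite ltr0_norm ?subr_lt0// => /andP[_ h].
by apply/negP; case: b => /=; rewrite -?ltNge -?leNgt; lra.
Qed.

(** Open half-spaces make the coordinates measurable for the generated sigma-algebra, hence also the
    identity from it to the Borel one. *)
Lemma jordan_generates : (measurable : set (set (M3 R))) = <<s jordan >>.
Proof.
apply/seteqP; split; last first.
  by apply: smallest_sub => [|B []//]; exact: sigma_algebra_measurable.
have mid : measurable_fun setT ((fun x => x) : g_sigma_algebraType jordan -> M3 R).
  have mk k : measurable_fun setT (@coord3 R k : g_sigma_algebraType jordan -> R).
    apply: (measurability _ (RGenOInfty.measurableE R)) => _ [_ [a ->] <-].
    rewrite setTI; apply: sub_sigma_algebra.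
    have -> : coord3 k @^-1` `]a, +oo[ = [set y : M3 R | (a < coord3 k y ?<= if false)%R].
      by apply/seteqP; split=> y /=; rewrite in_itv/= andbT.
    exact: jordan_halfspace.
  apply/measurable_fun_pairP; split; first apply/measurable_fun_pairP; first split.
  - exact: (mk 0%R).
  - exact: (mk 1%R).
  - exact: (mk 2%:R%R).
move=> A mA; have := mid measurableT A mA; by rewrite setTI.
Qed.

Lemma jordanT : jordan setT.
Proof. by split => //; apply: filterE => y; exists 1%R => //; left. Qed.

Lemma jordan_cube x (r : R) : jordan (cube x r : set (M3 R)).
Proof.
pose S k : set (M3 R) := [set y | (coord3 k x - r < coord3 k y ?<= if true)%R] `&`
  ~` [set y | (coord3 k x + r < coord3 k y ?<= if false)%R].
have jS k : jordan (S k).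
  by apply: jordanI; [|apply: jordanC]; exact: jordan_halfspace.
have -> : cube x r = S 0%R `&` S 1%R `&` S 2%:R%R.
  rewrite cubeE; apply/seteqP; split=> y /=; rewrite !in_itv/= /S /=.
    move=> [[/andP[a1 a2] /andP[b1 b2]] /andP[c1 c2]].
    by do ! split => //; apply/negP; rewrite -leNgt.
  move=> [[[a1 /negP a2] [b1 /negP b2]] [c1 /negP c2]].
  rewrite -leNgt in a2; rewrite -leNgt in b2; rewrite -leNgt in c2.
  by split; [split|]; apply/andP; split.
by do 2 apply: jordanI => //.
Qed.

(** The sets over which the integral vanishes form a Dynkin class; it contains the pi-system
    [jordan], hence every Borel set. *)
Lemma ae_eq_jordan (Q : set (M3 R)) (h : M3 R -> R) : measurable Q ->
  mu.-integrable Q (EFin \o h) ->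
  (forall B, jordan B -> \int[mu]_(x in B `&` Q) (h x)%:E = 0) ->
  {ae mu, forall x, Q x -> h x = 0%R}.
Proof.
move=> mQ ih hB.
have ihS A : measurable A -> mu.-integrable (A `&` Q) (EFin \o h).
  by move=> mA; apply: integrableS ih => //; exact: measurableI.
have H A : measurable A -> \int[mu]_(x in A `&` Q) (h x)%:E = 0.
  rewrite jordan_generates.
  apply: (dynkin_induction (P := fun A => \int[mu]_(x in A `&` Q) (h x)%:E = 0)).
  - exact: jordan_generates.
  - exact: jordanI.
  - exact/hB/jordanT.
  - exact: hB.
  (* Complements: subtract from the integral over the whole of Q, which vanishes because [setT] is
     Jordan. *)
  - move=> A0 mA hA.
    have := hB _ jordanT; rewrite setTI.
    have {1}-> : Q = (A0 `&` Q) `|` (~` A0 `&` Q) by rewrite -setIUl setUv setTI.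
    rewrite integral_setU//; last 4 first.
    + exact: measurableI.
    + by apply: measurableI => //; exact: measurableC.
    + rewrite -setIUl setUv setTI; exact: measurable_int ih.
    + by apply/disj_setPS => x [[a _] [b _]].
    by rewrite hA add0e.
  - move=> F mF tF hF; rewrite setI_bigcupl integral_bigcup//.
    + by rewrite eseries0.
    + exact: trivIset_setIr.
    + by move=> k; exact: measurableI.
    + by rewrite -setI_bigcupl; apply: ihS; exact: bigcup_measurable.
have : ae_eq mu Q (EFin \o h) (cst 0).
  apply: integral_ae_eq => // E EQ mE.
  by rewrite integral0 -(H E mE); congr (integral _ _ _); apply/esym/setIidl.
by apply: filterS => x hx Qx; have [] := hx Qx.
Qed.
End JordanSets.

(** * Mollification and its weak convergence *)

Section Mollify.
Context {R : realType}.
Local Notation mu := (@lebesgue3 R).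
Local Open Scope ereal_scope.

Implicit Types (r : R) (x y : R3 R).

Lemma integral_indicM (B : set (M3 R)) (f : M3 R -> R) :
  \int[mu]_(x in B) (f x)%:E = \int[mu]_x (\1_B x * f x)%:E.
Proof.
rewrite integral_mkcond; apply: eq_integral => x _; rewrite patchE indicE.
by case: ifP => _; rewrite ?mul1r ?mul0r.
Qed.

Definition moll (U : M3 R -> R) r x : R := fine (\int[mu]_y (U y * delta r x y)%:E).

(** The mollified indicator of B: what Fubini leaves next to U when [moll U r] is integrated over
    B. *)
Definition kmass r (B : set (M3 R)) y : R := fine (\int[mu]_(x in B) (delta r x y)%:E).

Lemma measurable_delta_l r y : measurable_fun setT (fun x : M3 R => delta r x y).
Proof. exact: (measurableT_comp (measurable_delta2 r) (measurable_pair2 y)). Qed.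

Lemma measurable_delta_r r x : measurable_fun setT (fun y : M3 R => delta r x y).
Proof. exact: (measurableT_comp (measurable_delta2 r) (measurable_pair1 x)). Qed.

Lemma delta_ge0E r x y : (0 < r)%R -> (0 : \bar R) <= (delta r x y)%:E.
Proof. by move=> r0; rewrite lee_fin delta_ge0. Qed.

Lemma kmass_ge0 r B y : (0 < r)%R -> (0 <= kmass r B y)%R.
Proof. by move=> r0; apply/fine_ge0/integral_ge0 => x _; exact: delta_ge0E. Qed.

Context (c : R) (c0 : (0 < c)%R)
  (cE : forall r y, (0 < r)%R -> \int[mu]_x (delta r x y)%:E = c%:E).

Lemma kmassE r B y : measurable B -> (0 < r)%R ->
  (kmass r B y)%:E = \int[mu]_(x in B) (delta r x y)%:E.
Proof.
move=> mB r0; rewrite fineK// ge0_fin_numE; last first.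
  by apply: integral_ge0 => x _; exact: delta_ge0E.
apply: (@le_lt_trans _ _ c%:E); last exact: ltry.
rewrite -(cE y r0); apply: ge0_subset_integral => //.
- by apply/measurable_EFinP; exact: measurable_delta_l.
- by move=> x _; exact: delta_ge0E.
Qed.

Lemma kmass_le r B y : measurable B -> (0 < r)%R -> (kmass r B y <= c)%R.
Proof.
move=> mB r0; rewrite -lee_fin kmassE// -(cE y r0); apply: ge0_subset_integral => //.
- by apply/measurable_EFinP; exact: measurable_delta_l.
- by move=> x _; exact: delta_ge0E.
Qed.

Lemma kmass_out r B y : (0 < r)%R -> cube y r `<=` ~` B -> kmass r B y = 0%R.
Proof.
move=> r0 h; rewrite /kmass integral0_eq// => x Bx; rewrite delta_far//.
by rewrite cube_sym => /h.
Qed.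

Lemma kmass_in r B y : measurable B -> (0 < r)%R -> cube y r `<=` B -> kmass r B y = c.
Proof.
move=> mB r0 h; apply: EFin_inj; rewrite kmassE// -(cE y r0).
rewrite integral_mkcond; apply: eq_integral => x _; rewrite patchE.
case: ifPn => // xB; rewrite delta_far// cube_sym => /h Bx.
by rewrite mem_set in xB.
Qed.

Lemma cvg_kmass (r_ : R^nat) B y : (forall k, 0 < r_ k)%R -> r_ k @[k --> \oo] --> 0%R ->
  measurable B ->
  (exists2 s : R, (0 < s)%R & cube y s `<=` B \/ cube y s `<=` ~` B) ->
  kmass (r_ k) B y @[k --> \oo] --> (c * \1_B y)%R.
Proof.
move=> r0 rl mB [s s0 hs].
have cs k : (r_ k < s)%R -> cube y (r_ k) `<=` cube y s.
  by move=> lt z; rewrite /cube /= => /le_trans; apply; exact: ltW.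
have yy : cube y s y by rewrite /cube /= subrr normr0 ltW.
have rs : \forall k \near \oo, (r_ k < s)%R by exact: (rl _ (lt_nbhsl s0)).
apply: cvg_near_cst; near=> k.
have lt : (r_ k < s)%R by near: k.
rewrite indicE; case: hs => hs.
  by rewrite (mem_set (hs _ yy)) mulr1 kmass_in//; exact: subset_trans (cs _ lt) hs.
by rewrite memNset ?mulr0 ?kmass_out//; [exact: subset_trans (cs _ lt) hs|exact: hs].
Unshelve. all: by end_near. Qed.

Context (U : M3 R -> R) (mU : measurable_fun setT U)
  (iU : mu.-integrable setT (EFin \o U)).

Lemma integrable_moll r x : (0 < r)%R ->
  mu.-integrable setT (fun y => (U y * delta r x y)%:E).
Proof.
move=> r0; have [M M0 hM] := @delta_bounded R.
have : mu.-integrable setT ((EFin \o U) \* (EFin \o (delta r x : M3 R -> R))).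
  apply: integrableMl => //; first exact: measurable_delta_r.
  exists (M * r ^- 3)%R; split; first exact: num_real.
  move=> A hA y _ /=; rewrite ger0_norm ?delta_ge0//.
  exact: le_trans (hM _ _ _ r0) (ltW hA).
by apply: eq_integrable.
Qed.

Lemma EFin_moll r x : (0 < r)%R -> (moll U r x)%:E = \int[mu]_y (U y * delta r x y)%:E.
Proof. by move=> r0; rewrite fineK//; apply: integrable_fin_num => //; exact: integrable_moll. Qed.

Lemma measurable_moll_kernel r :
  measurable_fun setT (fun p : M3 R * M3 R => (U p.2 * delta r p.1 p.2)%:E).
Proof.
apply/measurable_EFinP/measurable_funM; last exact: measurable_delta2.
exact: (measurableT_comp mU measurable_snd).
Qed.

Lemma integrable_moll_kernel r : (0 < r)%R ->
  (mu \x mu).-integrable setT (fun p : M3 R * M3 R => (U p.2 * delta r p.1 p.2)%:E).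
Proof.
move=> r0; apply/integrable21ltyP; first exact: measurable_moll_kernel.
have -> : (fun y => \int[mu]_x `|(U y * delta r x y)%:E|) = (fun y => `|(U y)%:E| * c%:E).
  apply/funext => y; under eq_integral do rewrite abse_EFin normrM EFinM (ger0_norm (delta_ge0 _ _ r0)).
  rewrite ge0_integralZl_EFin//; first by rewrite cE.
  - by move=> x _; exact: delta_ge0E.
  - by apply/measurable_EFinP; exact: measurable_delta_l.
have /integrableP[_ h] := iU.
rewrite ge0_integralZr//.
- by rewrite lte_mul_pinfty// ?integral_ge0 ?ltry// ge0_fin_numE// integral_ge0.
- by apply: measurableT_comp => //; exact/measurable_EFinP.
- by rewrite lee_fin ltW.
Qed.

Lemma measurable_moll r : (0 < r)%R -> measurable_fun setT (moll U r : M3 R -> R).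
Proof.
move=> r0; apply/measurable_EFinP.
apply: (eq_measurable_fun (fubini_F mu (fun p : M3 R * M3 R => (U p.2 * delta r p.1 p.2)%:E))).
  by move=> x _; rewrite /= EFin_moll.
exact: measurable_fubini_F (integrable_moll_kernel r0).
Qed.

Lemma integrable_delta_l r y : (0 < r)%R -> mu.-integrable setT (fun x => (delta r x y)%:E).
Proof.
move=> r0; apply/integrableP; split.
  by apply/measurable_EFinP; exact: measurable_delta_l.
under eq_integral do rewrite abse_EFin (ger0_norm (delta_ge0 _ _ r0)).
by rewrite cE// ltry.
Qed.

Lemma integrable_moll_kernelI r B : (0 < r)%R -> measurable B ->
  (mu \x mu).-integrable setT (fun p : M3 R * M3 R => (\1_B p.1 * (U p.2 * delta r p.1 p.2))%:E).
Proof.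
move=> r0 mB.
apply: le_integrable (integrable_moll_kernel r0) => //.
  apply/measurable_EFinP/measurable_funM.
    exact: (measurableT_comp (measurable_indic (D := setT) (R := R) mB) measurable_fst).
  by apply/measurable_EFinP; exact: measurable_moll_kernel.
move=> p _; rewrite !abse_EFin lee_fin normrM indicE.
by case: (_ \in _); rewrite ?normr1 ?mul1r// normr0 mul0r.
Qed.

Lemma integral_moll_kernel r B y : (0 < r)%R -> measurable B ->
  \int[mu]_x (\1_B x * (U y * delta r x y))%:E = (U y * kmass r B y)%:E.
Proof.
move=> r0 mB; rewrite EFinM kmassE//.
transitivity (\int[mu]_x ((U y)%:E * (\1_B x * delta r x y)%:E)).
  by apply: eq_integral => x _; rewrite -EFinM mulrCA.
rewrite integralZl//; last first.
  apply: le_integrable (integrable_delta_l y r0) => //.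
    apply/measurable_EFinP/measurable_funM; last exact: measurable_delta_l.
    exact: measurable_indic.
  move=> x _; rewrite !abse_EFin lee_fin normrM indicE.
  by case: (_ \in _); rewrite ?normr1 ?mul1r// normr0 mul0r.
congr (_ * _); rewrite [RHS]integral_mkcond; apply: eq_integral => x _; rewrite patchE indicE.
by case: ifP => _; rewrite ?mul1r ?mul0r.
Qed.

Lemma integral_moll r B : (0 < r)%R -> measurable B ->
  \int[mu]_(x in B) (moll U r x)%:E = \int[mu]_y (U y * kmass r B y)%:E.
Proof.
move=> r0 mB; have F := Fubini (integrable_moll_kernelI r0 mB).
transitivity (\int[mu]_x \int[mu]_y (\1_B x * (U y * delta r x y))%:E).
  rewrite integral_indicM; apply: eq_integral => x _; rewrite EFinM (EFin_moll x r0).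
  rewrite -(integralZl measurableT (integrable_moll x r0)).
  by apply: eq_integral => y _; rewrite EFinM.
by rewrite [LHS]F; apply: eq_integral => y _; exact: integral_moll_kernel.
Qed.

(** Fubini moves the mollification onto the indicator of B. Almost everywhere [kmass] tends to c on
    B and to 0 off B, and c |U| dominates. *)
Lemma cvg_moll_jordan (r_ : R^nat) B : (forall k, 0 < r_ k)%R ->
  r_ k @[k --> \oo] --> 0%R -> jordan B ->
  \int[mu]_(x in B) (moll U (r_ k) x)%:E @[k --> \oo] --> \int[mu]_(x in B) (c * U x)%:E.
Proof.
move=> r0 rl [mB jB].
have -> : \int[mu]_(x in B) (c * U x)%:E = \int[mu]_y (U y * (c * \1_B y))%:E.
  rewrite integral_mkcond; apply: eq_integral => y _; rewrite patchE indicE.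
  by case: ifP => _; rewrite ?mulr1 ?mulr0// mulrC.
have -> : (fun k => \int[mu]_(x in B) (moll U (r_ k) x)%:E) =
    (fun k => \int[mu]_y (U y * kmass (r_ k) B y)%:E).
  by apply/funext => k; exact: integral_moll.
have [//|||||_ _] := @dominated_convergence _ _ R mu setT measurableT
  (fun k y => (U y * kmass (r_ k) B y)%:E) (fun y => (U y * (c * \1_B y))%:E)
  (fun y => c%:E * `|(U y)%:E|).
- move=> k; have mG := measurable_fubini_G (integrable_moll_kernelI (r0 k) mB).
  by apply: eq_measurable_fun mG => y _; rewrite /fubini_G/= integral_moll_kernel.
- apply/measurable_EFinP/measurable_funM => //; apply: measurable_funM => //.
- apply: filterS jB => y hy _.
  apply: cvg_EFin; first exact: nearW.
  by apply: cvgM; [exact: cvg_cst|exact: cvg_kmass].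
- by apply: integrableZl => //; exact: integrable_abse.
- apply: filterE => y k _; rewrite abse_EFin normrM EFinM muleC.
  by rewrite lee_wpmul2r// lee_fin ger0_norm ?kmass_ge0 ?kmass_le.
by [].
Qed.

Lemma moll_bound (M : R) r x : (forall r x y, 0 < r -> delta r x y <= M * r ^- 3)%R ->
  (0 < M)%R -> (0 < r)%R ->
  `|moll U r x|%:E <= (M * r ^- 3)%:E * \int[mu]_(y in cube x r) `|U y|%:E.
Proof.
move=> hM M0 r0; rewrite -abse_EFin EFin_moll//.
have Mr0 : (0 <= M * r ^- 3)%R by rewrite mulr_ge0 ?(ltW M0)// invr_ge0 exprn_ge0// ltW.
have mn : measurable_fun setT (fun y => `|U y|%:E).
  by apply/measurable_EFinP; exact: measurableT_comp.
apply: le_trans (le_abse_integral _ _ _) _ => //.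
  exact: (measurable_int mu (integrable_moll x r0)).
rewrite -ge0_integralZl_EFin//; last 2 first.
- exact: measurable_cube.
- exact: measurable_funTS.
rewrite [leRHS]integral_mkcond; apply: ge0_le_integral => //.
- apply: measurableT_comp => //; exact: (measurable_int mu (integrable_moll x r0)).
- apply/(measurable_restrictT _ _).1; first exact: measurable_cube.
  by apply: measurable_funTS; exact: emeasurable_funM.
move=> y _; rewrite patchE abse_EFin normrM (ger0_norm (delta_ge0 _ _ r0)).
case: ifPn => yx; first by rewrite -EFinM lee_fin mulrC ler_wpM2r// hM.
by rewrite delta_far ?mulr0// => h; rewrite mem_set in yx.
Qed.
End Mollify.

(** * Almost everywhere convergence from increments summable in L^1 *)

Section Iteration.
Context {R : realType}.
Local Notation mu := (@lebesgue3 R).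
Local Open Scope ereal_scope.
Implicit Types (r : R) (x y : R3 R).

Lemma nneseries_le (f : (\bar R)^nat) (B : \bar R) : (forall j, 0 <= f j) ->
  (forall n, \sum_(0 <= j < n) f j <= B) -> \sum_(0 <= j <oo) f j <= B.
Proof.
move=> f0 h; apply: lime_le; first by apply: is_cvg_nneseries => n _ _; exact: f0.
by apply: nearW => n; exact: h.
Qed.

Lemma geometric_sum_le (r0 : R) n : (0 <= r0)%R ->
  (\sum_(0 <= j < n) r0 * 2^-1 ^+ j <= 2 * r0)%R.
Proof.
move=> r00; suff -> : (\sum_(0 <= j < n) r0 * 2^-1 ^+ j = 2 * r0 - 2 * r0 * 2^-1 ^+ n)%R.
  by rewrite gerBl mulr_ge0// ?mulr_ge0// exprn_ge0// invr_ge0.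
elim: n => [|n IH]; first by rewrite big_geq// expr0; lra.
by rewrite big_nat_recr//= IH exprS; field.
Qed.

(* A series of functions whose increments are summable in L^1 converges a.e.,
   and its limit is identified by the integrals over Jordan sets. *)
Lemma ae_telescope (Q : set (M3 R)) (f : nat -> M3 R -> R) (g : nat -> M3 R -> R) (V : M3 R -> R) :
  jordan Q -> mu Q < +oo ->
  (forall k, mu.-integrable Q (EFin \o f k)) -> mu.-integrable Q (EFin \o V) ->
  (forall k, measurable_fun Q (g k)) -> (forall k x, (0 <= g k x)%R) ->
  (forall k x, Q x -> `|f k.+1 x - f k x| <= g k x)%R ->
  \sum_(0 <= k <oo) \int[mu]_(x in Q) (g k x)%:E < +oo ->
  (forall B, jordan B -> \int[mu]_(x in B `&` Q) (f k x)%:E @[k --> \oo] --> \int[mu]_(x in B `&` Q) (V x)%:E) ->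
  {ae mu, forall x, Q x -> forall k, `|V x - f k x|%:E <= \sum_(0 <= j <oo) (g (k + j)%N x)%:E}.
Proof.
move=> [mQ jQ] Qfin If IV mg g0 fg sg fV.
pose G x := \sum_(0 <= k <oo) (g k x)%:E.
have mG : measurable_fun Q G.
  by apply: ge0_emeasurable_sum => // k; [move=> x _ _; rewrite lee_fin|move=> _; exact/measurable_EFinP].
have G0 x : 0 <= G x by apply: nneseries_ge0 => k _ _; rewrite lee_fin.
have IG : mu.-integrable Q G.
  apply/integrableP; split => //.
  under eq_integral do rewrite gee0_abs//.
  by rewrite integral_nneseries// => [k|k x _]; [exact/measurable_EFinP|rewrite lee_fin].
have tele x k n : Q x -> (`|f (k + n)%N x - f k x|%:E <= \sum_(0 <= j < n) (g (k + j)%N x)%:E).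
  move=> Qx; rewrite sumEFin lee_fin; elim: n => [|n IH]; first by rewrite addn0 subrr normr0 big_geq.
  rewrite big_nat_recr//= addnS.
  have -> : (f (k + n).+1 x - f k x = (f (k + n).+1 x - f (k + n)%N x) + (f (k + n)%N x - f k x))%R by ring.
  by rewrite (le_trans (ler_normD _ _))// addrC lerD// fg.
have tail x k : \sum_(0 <= j <oo) (g (k + j)%N x)%:E <= G x.
  apply: nneseries_le => [j|n]; first by rewrite lee_fin.
  apply: le_trans (_ : \sum_(0 <= j < k + n) (g j x)%:E <= _); last first.
    by apply: nneseries_lim_ge => j _ _; rewrite lee_fin.
  have -> : \sum_(0 <= j < n) (g (k + j)%N x)%:E = \sum_(k <= j < k + n) (g j x)%:E.
    by rewrite -{2}[k]add0n big_addn addKn; apply: eq_bigr => j _; rewrite addnC.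
  rewrite (@big_cat_nat _ _ _ k 0 (k + n))//= ?leq_addr//.
  by rewrite leeDr// sume_ge0// => j _; rewrite lee_fin.
have tail0 x k : 0 <= \sum_(0 <= j <oo) (g (k + j)%N x)%:E.
  by apply: nneseries_ge0 => j _ _; rewrite lee_fin.
have aeG : {ae mu, forall x, Q x -> G x \is a fin_num} := integrable_ae mQ IG.
have cf x : Q x -> G x \is a fin_num -> cvgn (fun k => f k x).
  move=> Qx Gx.
  have cg : cvgn (series (fun k => g k x)).
    apply: nondecreasing_is_cvgn.
      by apply: nondecreasing_series => k _ _; exact: g0.
    exists (fine (G x)) => _ [n _ <-]; rewrite -lee_fin fineK// /series/= -sumEFin.
    by apply: nneseries_lim_ge => j _ _; rewrite lee_fin.
  have cs : cvgn [normed series (telescope (fun k => f k x))].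
    by apply: series_le_cvg cg => k //=; exact: fg.
  have -> : (fun k => f k x) = (fun k => (f 0%N x + series (telescope (fun k => f k x)) k)%R).
    by apply/funext => k; exact: (eq_sum_telescope (fun k => f k x)).
  apply: is_cvgD; first exact: is_cvg_cst.
  exact: (@normed_cvg R R).
(* Cutting off by A makes the sequence converge at every point of Q, so that its limit is
   measurable. *)
pose A : set (M3 R) := Q `&` [set x | G x \is a fin_num].
have mA : measurable A by exact: emeasurable_fin_num.
pose L (x : M3 R) : R := limn (fun k => (\1_A x * f k x)%R).
have fL x : Q x -> G x \is a fin_num -> f k x @[k --> \oo] --> L x.
  move=> Qx Gx; rewrite /L.
  have -> : (fun k => (\1_A x * f k x)%R) = f^~ x.
    by apply/funext => k; rewrite indicE mem_set// mul1r.
  exact: cf.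
have mL : measurable_fun Q L.
  apply: (@measurable_fun_cvg _ _ _ _ (fun k x => (\1_A x * f k x)%R)).
  - move=> k; apply: measurable_funM; first exact: measurable_indic.
    by apply/measurable_EFinP; exact: measurable_int (If k).
  - move=> x Qx; rewrite /L; have [xA|xA] := boolP (x \in A).
      have [_ Gx] : A x by rewrite inE in xA.
      have -> : (fun k => (\1_A x * f k x)%R) = f^~ x.
        by apply/funext => k; rewrite indicE xA mul1r.
      exact: cf.
    have -> : (fun k => (\1_A x * f k x)%R) = cst 0%R.
      by apply/funext => k; rewrite indicE (negbTE xA) mul0r.
    exact: is_cvg_cst.
have bnd : {ae mu, forall x, Q x -> forall k, `|L x - f k x|%:E <= \sum_(0 <= j <oo) (g (k + j)%N x)%:E}.
  apply: filterS aeG => x Gx Qx k; have Lx := fL x Qx (Gx Qx).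
  have tfin : \sum_(0 <= j <oo) (g (k + j)%N x)%:E \is a fin_num.
    by rewrite ge0_fin_numE// (le_lt_trans (tail x k))// -ge0_fin_numE// Gx.
  rewrite -(fineK tfin) lee_fin.
  have c2 : `|f (k + n)%N x - f k x|%R @[n --> \oo] --> `|L x - f k x|%R.
    apply: cvg_norm; apply: cvgB; last exact: cvg_cst.
    have -> : (fun n => f (k + n)%N x) = (fun n => f^~ x (n + k)%N).
      by apply/funext => n; rewrite addnC.
    by rewrite (cvg_shiftn k (f^~ x)).
  rewrite -(cvg_lim _ c2)//; apply: limr_le; first by apply/cvg_ex; exists `|L x - f k x|%R.
  apply: nearW => n; rewrite -lee_fin (fineK tfin); apply: le_trans (tele x k n Qx) _.
  by apply: nneseries_lim_ge => j _ _; rewrite lee_fin.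
(* Since G bounds all telescoping sums, |f 0| + G dominates every f k. *)
have Ifg : mu.-integrable Q (fun x => `|(f 0%N x)%:E| + G x).
  have Ia : mu.-integrable Q (abse \o (EFin \o f 0%N)) by apply: integrable_abse; exact: If.
  exact: (integrableD mQ Ia IG).
have dom k x : Q x -> `|(f k x)%:E| <= `|(f 0%N x)%:E| + G x.
  move=> Qx; have := tele x 0%N k Qx; rewrite add0n => h.
  apply: le_trans (_ : `|(f 0%N x)%:E| + `|f k x - f 0%N x|%:E <= _).
    rewrite !abse_EFin -EFinD lee_fin.
    by have := ler_normD (f 0%N x) (f k x - f 0%N x)%R; rewrite addrC subrK.
  rewrite leeD2l//; apply: le_trans h _.
  by apply: nneseries_lim_ge => j _ _; rewrite lee_fin.
have IL : mu.-integrable Q (EFin \o L).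
  have [] := @dominated_convergence _ _ R mu Q mQ (fun k => EFin \o f k) (EFin \o L) _ _ _ _ Ifg => //.
  - by move=> k; exact: measurable_int (If k).
  - exact/measurable_EFinP.
  - apply: filterS aeG => x Gx Qx; apply: cvg_EFin; first exact: nearW.
    exact: fL (Gx Qx).
  - by apply: filterE => x k; exact: dom.
(* V and L have the same integral over B intersected with Q: the one is the limit by hypothesis, the
   other by domination. *)
have VL : {ae mu, forall x, Q x -> (V x - L x)%R = 0%R}.
  apply: ae_eq_jordan => //.
    by have := integrableB mQ IV IL; apply: eq_integrable.
  move=> B jB; have mBQ : measurable (B `&` Q) by apply: measurableI => //; exact: jB.1.
  have IS h : mu.-integrable Q h -> mu.-integrable (B `&` Q) h.
    by apply: integrableS => //; exact: subIsetr.
  rewrite (integralB_EFin mBQ (IS _ IV) (IS _ IL)).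
  have [|||||_ _ cL] := @dominated_convergence _ _ R mu (B `&` Q) mBQ
      (fun k => EFin \o f k) (EFin \o L) (fun x => `|(f 0%N x)%:E| + G x).
  - by move=> k; exact: (measurable_int mu (IS _ (If k))).
  - exact: (measurable_int mu (IS _ IL)).
  - apply: filterS aeG => x Gx [_ Qx]; apply: cvg_EFin; first exact: nearW.
    exact: (fL x Qx (Gx Qx)).
  - exact: IS.
  - by apply: filterE => x k [_ Qx]; exact: dom.
  have E := cvg_unique _ cL (fV B jB); rewrite -E// subee//.
  by apply: integrable_fin_num => //; exact: IS.
apply: filterS2 VL bnd => x h1 h2 Qx k.
by have := h2 Qx k; rewrite -(subr0_eq (h1 Qx)).
Qed.
End Iteration.

(** * Discrete Gronwall argument for the masses of dyadic cubes *)

Section Gronwall.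
Context {R : realType}.
Local Notation mu := (@lebesgue3 R).
Local Open Scope ereal_scope.
Implicit Types (r : R) (x y : R3 R).

Lemma measurable_cube_integral (W : M3 R -> R) r :
  measurable_fun setT W -> (forall y, 0 <= W y)%R ->
  measurable_fun setT (fun x => \int[mu]_(z in cube x r) (W z)%:E).
Proof.
move=> mW W0; pose N := [set p : M3 R * M3 R | cube p.1 r p.2].
pose F (p : M3 R * M3 R) := (\1_N p * W p.2)%:E.
have mF : measurable_fun setT F.
  apply/measurable_EFinP; apply: measurable_funM.
  - by apply: measurable_indic; exact: measurable_near3.
  - exact: (measurableT_comp mW measurable_snd).
have F0 p : 0 <= F p by rewrite lee_fin mulr_ge0.
apply: eq_measurable_fun (@measurable_fun_fubini_tonelli_F _ _ _ _ R mu F mF F0) => x _.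
rewrite /fubini_F integral_indicM; apply: eq_integral => z _.
by rewrite /F !indicE; congr ((_%:R * _)%R%:E); apply/idP/idP; rewrite !inE.
Qed.

Lemma subset_cube_integral (W : M3 R -> R) (A B : set (M3 R)) :
  measurable_fun setT W -> (forall y, 0 <= W y)%R -> measurable A -> measurable B -> A `<=` B ->
  \int[mu]_(z in A) (W z)%:E <= \int[mu]_(z in B) (W z)%:E.
Proof.
move=> mW W0 mA mB AB; apply: ge0_subset_integral => //.
  by apply/measurable_EFinP; exact: measurable_funTS.
by move=> y _; rewrite lee_fin.
Qed.

Context (c : R) (c0 : (0 < c)%R)
  (cE : forall r y, (0 < r)%R -> \int[mu]_x (delta r x y)%:E = c%:E).
Context (M : R) (M0 : (0 < M)%R)
  (hM : forall r x y, (0 < r)%R -> (delta r x y <= M * r ^- 3)%R).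
Context (I : finType) (U : I -> M3 R -> R)
  (mU : forall i, measurable_fun setT (U i))
  (iU : forall i, mu.-integrable setT (EFin \o U i)).
Context (x0 : R3 R) (r0 : R) (r00 : (0 < r0)%R) (C : R) (C0 : (0 <= C)%R).

Definition radius k : R := (r0 * 2^-1 ^+ k)%R.
(** Each increment is controlled by all components together, so the recursion has to run for their
    sum. *)
Definition total (y : M3 R) : R := (\sum_(i : I) `|U i y|)%R.
Definition cubemass k x : R := fine (\int[mu]_(y in cube x (radius k)) (total y)%:E).
Definition mass : R := fine (\int[mu]_y (total y)%:E).

Lemma radius_gt0 k : (0 < radius k)%R.
Proof. by rewrite mulr_gt0// exprn_gt0// invr_gt0. Qed.

Lemma radiusS k : radius k.+1 = (radius k / 2)%R.
Proof. by rewrite /radius exprS; field. Qed.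

Lemma radius_le m n : (m <= n)%N -> (radius n <= radius m)%R.
Proof.
move=> mn; rewrite /radius ler_pM2l//; apply: ler_wiXn2l => //; lra.
Qed.

Lemma radius0 : radius 0 = r0. Proof. by rewrite /radius expr0 mulr1. Qed.

Lemma radius_le0 k : (radius k <= r0)%R.
Proof. by rewrite -[leRHS]radius0 radius_le. Qed.

Lemma radiusD k j : radius (k + j) = (radius k * 2^-1 ^+ j)%R.
Proof. by rewrite /radius exprD mulrA. Qed.

Lemma sum_radius k n : (\sum_(0 <= j < n) radius (k + j) <= 2 * radius k)%R.
Proof. by under eq_bigr do rewrite radiusD; apply: geometric_sum_le; exact/ltW/radius_gt0. Qed.

Lemma cvg_radius : radius k @[k --> \oo] --> 0%R.
Proof.
rewrite -(mulr0 r0); apply: cvgM; first exact: cvg_cst.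
by apply: cvg_expr; rewrite ger0_norm; lra.
Qed.

Lemma total_ge0 y : (0 <= total y)%R.
Proof. by apply: sumr_ge0 => i _. Qed.

Lemma measurable_total : measurable_fun setT total.
Proof. by apply: measurable_sum => i; apply: measurableT_comp => //. Qed.

Lemma integrable_total : mu.-integrable setT (EFin \o total).
Proof.
have -> : EFin \o total = (fun y => \sum_(i : I) (EFin \o (fun y => `|U i y|%R)) y).
  by apply/funext => y; rewrite /= /total sumEFin.
by apply: integrable_sum => // i _; exact: integrable_norm.
Qed.

Lemma massE : mass%:E = \int[mu]_y (total y)%:E.
Proof. by rewrite fineK//; apply: integrable_fin_num => //; exact: integrable_total. Qed.

Lemma cube_int_le r x : \int[mu]_(y in cube x r) (total y)%:E <= mass%:E.
Proof.
rewrite massE; apply: subset_cube_integral => //; [exact: measurable_total|exact: total_ge0|exact: measurable_cube].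
Qed.

Lemma cube_int_ge0 r x : 0 <= \int[mu]_(y in cube x r) (total y)%:E.
Proof. by apply: integral_ge0 => y _; rewrite lee_fin total_ge0. Qed.

Lemma mass_ge0 : (0 <= mass)%R.
Proof. by apply/fine_ge0/integral_ge0 => y _; rewrite lee_fin total_ge0. Qed.

Lemma cubemassE k x : (cubemass k x)%:E = \int[mu]_(y in cube x (radius k)) (total y)%:E.
Proof.
rewrite fineK// ge0_fin_numE ?cube_int_ge0//; exact: le_lt_trans (cube_int_le _ _) (ltry _).
Qed.

Lemma cubemass_ge0 k x : (0 <= cubemass k x)%R.
Proof. exact/fine_ge0/cube_int_ge0. Qed.

Lemma cubemass_le k x : (cubemass k x <= mass)%R.
Proof. by rewrite -lee_fin cubemassE cube_int_le. Qed.

Lemma measurable_cubemass k : measurable_fun setT (cubemass k : M3 R -> R).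
Proof.
apply/measurable_EFinP.
have := measurable_cube_integral (radius k) measurable_total total_ge0.
by apply: eq_measurable_fun => x _; rewrite /= cubemassE.
Qed.

(** The bound on the increment from scale k to scale k + 1 that the weak equation supplies, with C =
    30 K in [incr_localize]. *)
Definition incr k x : R := (C * radius k ^- 2 * cubemass k x)%R.

Lemma incr_ge0 k x : (0 <= incr k x)%R.
Proof.
apply: mulr_ge0; last exact: cubemass_ge0.
by rewrite mulr_ge0// invr_ge0 exprn_ge0// ltW// radius_gt0.
Qed.

Lemma measurable_incr k : measurable_fun setT (incr k : M3 R -> R).
Proof. by apply: measurable_funM => //; exact: measurable_cubemass. Qed.

(** [integral_cube_swap] trades the r^-2 of the increment for (2r)^3 r^-2 = 8 r; these factors are
    summable over dyadic r. *)
Lemma integral_incr k x s : (0 <= s)%R -> \int[mu]_(y in cube x s) (incr k y)%:E <=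
  (8 * C * radius k)%:E * \int[mu]_(z in cube x (radius k + s)) (total z)%:E.
Proof.
move=> s0; have rk := radius_gt0 k.
have E : \int[mu]_(y in cube x s) (incr k y)%:E = (C * radius k ^- 2)%:E *
    \int[mu]_(y in cube x s) \int[mu]_(z in cube y (radius k)) (total z)%:E.
  rewrite -ge0_integralZl_EFin//.
  - by apply: eq_integral => y _; rewrite /incr EFinM cubemassE.
  - exact: measurable_cube.
  - by move=> y _; exact: cube_int_ge0.
  - by apply: measurable_funTS; exact: measurable_cube_integral measurable_total total_ge0.
  - by rewrite mulr_ge0// invr_ge0 exprn_ge0// ltW.
rewrite E; have := integral_cube_swap x s measurable_total total_ge0 rk.
move=> /(lee_wpmul2l (x := (C * radius k ^- 2)%:E)) h.
apply: le_trans (h _) _; first by rewrite lee_fin mulr_ge0// invr_ge0 exprn_ge0// ltW.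
rewrite muleA -EFinM le_eqVlt; apply/orP; left; apply/eqP; congr (_%:E * _).
field; rewrite gt_eqF//.
Qed.

(** The radius 3 r0 allows for points in the cube of radius 2 r0, each with a cube of its own of
    radius at most r0. *)
Context (hincr : forall i k x, cube x (radius k) `<=` cube x0 (3 * r0) ->
  (`|moll (U i) (radius k.+1) x - moll (U i) (radius k) x| <= incr k x)%R).

Lemma cube_radius k x : cube x0 (2 * r0) x -> cube x (radius k) `<=` cube x0 (3 * r0).
Proof.
move=> hx y hy; have := cube_sub hx hy; rewrite /cube /= => /le_trans; apply.
have := radius_le0 k; lra.
Qed.

Lemma moll_mass_bound i k x : (`|moll (U i) (radius k) x| <= M * radius k ^- 3 * mass)%R.
Proof.
rewrite -lee_fin; apply: le_trans (moll_bound (mU i) (iU i) x hM M0 (radius_gt0 k)) _.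
rewrite [leRHS]EFinM; apply: lee_wpmul2l.
  by rewrite lee_fin mulr_ge0 ?(ltW M0)// invr_ge0 exprn_ge0// ltW// radius_gt0.
apply: le_trans (cube_int_le (radius k) x); apply: ge0_le_integral.
- exact: measurable_cube.
- by move=> y _; rewrite lee_fin.
- by apply/measurable_EFinP; apply: measurable_funTS; exact: measurableT_comp.
- by apply/measurable_EFinP; apply: measurable_funTS; exact: measurable_total.
- by move=> y _; rewrite lee_fin /total (bigD1 i)//= lerDl sumr_ge0.
Qed.

Lemma ae_moll i : {ae mu, forall x, cube x0 (2 * r0) x -> forall k,
  `|c * U i x - moll (U i) (radius k) x|%:E <= \sum_(0 <= j <oo) (incr (k + j)%N x)%:E}.
Proof.
have mQ := measurable_cube x0 (2 * r0)%R.
have Qfin : mu (cube x0 (2 * r0)) < +oo.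
  have h : (0 <= 2 * r0)%R by rewrite mulr_ge0// ltW.
  by apply: le_lt_trans (ltry ((2 * (2 * r0)) ^+ 3)%R); rewrite (leb3_cube x0 h).
apply: (@ae_telescope R (cube x0 (2 * r0)) (fun k => moll (U i) (radius k)) incr (fun x => c * U i x)%R) => //.
- exact: jordan_cube.
- move=> k; apply: measurable_bounded_integrable => //.
    have mm : measurable_fun setT (moll (U i) (radius k) : M3 R -> R).
      by apply: (measurable_moll c0 cE); [exact: mU|exact: iU|exact: radius_gt0].
    exact: measurable_funTS mm.
  exists (M * radius k ^- 3 * mass)%R; split; first exact: num_real.
  move=> B hB x _; exact: le_trans (moll_mass_bound i k x) (ltW hB).
- have := integrableZl measurableT c (iU i).
  by apply: integrableS.
- by move=> k; apply: measurable_funTS; exact: measurable_incr.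
- exact: incr_ge0.
- by move=> k x hx; apply: hincr; exact: cube_radius.
(* The bounds 8 C [radius k] form a geometric series with sum at most 8 C (2 r0). *)
- apply: (@le_lt_trans _ _ (8 * C * (2 * r0) * mass)%:E); last exact: ltry.
  apply: nneseries_le => [k|n].
    by apply: integral_ge0 => x _; rewrite lee_fin incr_ge0.
  apply: le_trans (_ : \sum_(0 <= k < n) (8 * C * radius (0 + k) * mass)%:E <= _).
    have h2 : (0 <= 2 * r0)%R by rewrite mulr_ge0// ltW.
    apply: lee_sum => k _; apply: le_trans (integral_incr k x0 h2) _.
    rewrite [in leRHS]EFinM; apply: lee_wpmul2l; last exact: cube_int_le.
    by rewrite lee_fin !mulr_ge0// ltW// radius_gt0.
  rewrite sumEFin lee_fin -mulr_suml -mulr_sumr; apply: ler_wpM2r; first exact: mass_ge0.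
  by apply: ler_wpM2l; [exact: mulr_ge0|rewrite -[in leRHS]radius0; exact: sum_radius].
- move=> B jB.
  have := cvg_moll_jordan c0 cE (mU i) (iU i) radius_gt0 cvg_radius (jordanI jB (jordan_cube x0 (2 * r0))).
  exact.
Qed.

(* The majorant of the scaled masses solves a linear recursion whose growth factors
   have a convergent product. *)
Definition growth : R := (72 * #|I|%:R * C / c)%R.
Definition seed : R := (r0 ^- 3 * mass * (1 + 8 * #|I|%:R * M / c))%R.
Fixpoint majorant k : R :=
  if k is k'.+1 then ((1 + growth * radius k') * majorant k')%R else seed.

Lemma growth_ge0 : (0 <= growth)%R.
Proof. by rewrite /growth divr_ge0 ?(ltW c0)// !mulr_ge0// ler0n. Qed.

Lemma seed_ge0 : (0 <= seed)%R.
Proof.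
rewrite /seed; apply: mulr_ge0.
  by rewrite mulr_ge0 ?mass_ge0// invr_ge0 exprn_ge0// ltW.
by rewrite addr_ge0// divr_ge0 ?(ltW c0)// !mulr_ge0 ?ler0n// ltW.
Qed.

(** The recursion in summed form, which is the shape that the inductive step of [cubemass_majorant]
    produces. *)
Lemma majorant_sum k : majorant k = (seed + growth * \sum_(0 <= j < k) radius j * majorant j)%R.
Proof.
elim: k => [|k IH]; first by rewrite big_geq// mulr0 addr0.
by rewrite big_nat_recr//= mulrDr addrA -IH; ring.
Qed.

(** By 1 + t <= exp t the product of the growth factors is at most the exponential of [growth] times
    the sum of the radii, and that sum is at most 2 r0. *)
Lemma majorant_bound k : (0 <= majorant k <= seed * expR (growth * (2 * r0)))%R.
Proof.
have H n : (0 <= majorant n <= seed * expR (growth * \sum_(0 <= j < n) radius j))%R.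
  elim: n => [|n /andP[IH0 IH]].
    by rewrite big_geq// mulr0 expR0 mulr1 /= seed_ge0 lexx.
  have f0 : (0 <= 1 + growth * radius n)%R.
    by rewrite addr_ge0// mulr_ge0 ?growth_ge0// ltW// radius_gt0.
  apply/andP; split; first exact: mulr_ge0.
  rewrite big_nat_recr//= mulrDr expRD [leRHS]mulrA [leRHS]mulrC.
  by apply: ler_pM => //; exact: expR_ge1Dx.
have /andP[h0 h] := H k; rewrite h0 (le_trans h)//.
apply: ler_wpM2l; first exact: seed_ge0.
rewrite ler_expR; apply: ler_wpM2l; first exact: growth_ge0.
by have := sum_radius 0 k; rewrite radius0.
Qed.

(** Telescoping from scale 0, where the bound by the total mass costs r0^-3. The bounds K are left
    free: they come first from the majorant and later from its uniform bound. *)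
Lemma moll_bound_sum i k y (K : nat -> R) :
  (forall j, (j < k)%N -> cube y (radius j) `<=` cube x0 (3 * r0) /\ (incr j y <= K j)%R) ->
  (`|moll (U i) (radius k) y| <= M * r0 ^- 3 * mass + \sum_(0 <= j < k) K j)%R.
Proof.
elim: k => [|k IH] h.
  by rewrite big_geq// addr0; have := moll_mass_bound i 0 y; rewrite radius0.
rewrite big_nat_recr//= addrA.
have -> : moll (U i) (radius k.+1) y = (moll (U i) (radius k) y +
  (moll (U i) (radius k.+1) y - moll (U i) (radius k) y))%R by rewrite addrC subrK.
rewrite (le_trans (ler_normD _ _))// lerD//.
  by apply: IH => j jk; apply: h; exact: ltnW.
have [h1 h2] := h k (ltnSn k).
exact: le_trans (hincr i h1) h2.
Qed.

Lemma incr_majorant k y : (cubemass k y <= radius k ^+ 3 * majorant k)%R ->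
  (incr k y <= C * (radius k * majorant k))%R.
Proof.
move=> h; have rk := radius_gt0 k.
have -> : (C * (radius k * majorant k) = C * radius k ^- 2 * (radius k ^+ 3 * majorant k))%R.
  by field; rewrite gt_eqF.
apply: ler_wpM2l h; by rewrite mulr_ge0// invr_ge0 exprn_ge0// ltW.
Qed.

Lemma integral_total (B : set (M3 R)) : measurable B ->
  \int[mu]_(y in B) (total y)%:E = \sum_(i : I) \int[mu]_(y in B) `|U i y|%:E.
Proof.
move=> mB; rewrite -ge0_integral_sum//.
- by apply: eq_integral => y _; rewrite /total sumEFin.
- by move=> i; apply/measurable_EFinP; apply: measurable_funTS; exact: measurableT_comp.
Qed.

(** Strong induction on the scale. On a cube of radius p = [radius k.+1] about x, almost everywhere
    c |U| is at most the mollification at scale p plus the tail of finer increments. The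
    mollification is bounded pointwise through the scales j <= k, using the induction hypothesis at
    each point of the cube. The tail is bounded only in the mean, where every cube involved stays
    inside the one of radius 2 p = [radius k] about x, so the hypothesis at k suffices. *)
Lemma cubemass_majorant k x : cube x0 (r0 + radius k) x ->
  (cubemass k x <= radius k ^+ 3 * majorant k)%R.
Proof.
elim/ltn_ind: k x => -[|k] IH x hx.
  apply: le_trans (cubemass_le 0 x) _; rewrite radius0 /= /seed.
  rewrite !mulrA mulfV ?mul1r; last by rewrite expf_neq0// gt_eqF.
  by rewrite ler_peMr ?mass_ge0// lerDl divr_ge0 ?(ltW c0)// !mulr_ge0 ?ler0n// ltW.
have rk := radius_gt0 k; pose p := radius k.+1.
have p0 : (0 < p)%R := radius_gt0 k.+1.
have pk : (radius k = p + p)%R by rewrite /p radiusS; field.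
pose P := (M * r0 ^- 3 * mass + \sum_(0 <= j < k.+1) C * (radius j * majorant j))%R.
(* Recentring at y costs p, exactly the gap between [radius k.+1] and [radius k]; this is why the
   domain of the lemma shrinks with k. *)
have near y : cube x p y -> cube x0 (r0 + radius k) y.
  by move=> hy; have := cube_sub hx hy; rewrite pk /cube /= -/p; move=> /le_trans; apply; lra.
have near2 y : cube x p y -> cube x0 (2 * r0) y.
  by move=> /near; rewrite /cube /= => /le_trans; apply; have := radius_le0 k; lra.
have hP i y : cube x p y -> (`|moll (U i) p y| <= P)%R.
  move=> hy; apply: moll_bound_sum => j; rewrite ltnS => jk; split.
    by apply: cube_radius; exact: near2.
  apply: incr_majorant; apply: IH; first by rewrite ltnS.
  move: (near y hy); rewrite /cube /= => /le_trans; apply.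
  by rewrite lerD2l radius_le.
have P0 : (0 <= P)%R.
  rewrite addr_ge0//.
    by rewrite !mulr_ge0 ?mass_ge0 ?(ltW M0)// invr_ge0 exprn_ge0// ltW.
  apply: sumr_ge0 => j _; rewrite mulr_ge0// mulr_ge0 ?(ltW (radius_gt0 _))//.
  by have /andP[] := majorant_bound j.
have mp := measurable_cube x p.
have vol : mu (cube x p) = ((2 * p) ^+ 3)%:E := leb3_cube x (ltW p0).
pose G (y : M3 R) := \sum_(0 <= j <oo) (incr (k.+1 + j)%N y)%:E.
have mG : measurable_fun (cube x p : set (M3 R)) G.
  apply: ge0_emeasurable_sum => [j y _ _|j _]; first by rewrite lee_fin incr_ge0.
  by apply/measurable_EFinP; apply: measurable_funTS; exact: measurable_incr.
have G0 y : 0 <= G y by apply: nneseries_ge0 => j _ _; rewrite lee_fin incr_ge0.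
have cmk : (cubemass k x <= radius k ^+ 3 * majorant k)%R.
  apply: IH => //; apply: near; rewrite /cube /= subrr normr0; exact: ltW.
(* The finer scales satisfy [radius (k.+1 + j)] + p <= 2 p = [radius k], so every mass is at most
   [cubemass k x]; their radii add up to at most 2 p. *)
have hG : \int[mu]_(y in cube x p) G y <= (16 * C * p * (radius k ^+ 3 * majorant k))%:E.
  rewrite integral_nneseries//; last 2 first.
  - by move=> j; apply/measurable_EFinP; apply: measurable_funTS; exact: measurable_incr.
  - by move=> j y _; rewrite lee_fin incr_ge0.
  apply: nneseries_le => [j|n]; first by apply: integral_ge0 => y _; rewrite lee_fin incr_ge0.
  apply: le_trans (_ : \sum_(0 <= j < n) (8 * C * radius (k.+1 + j) * (radius k ^+ 3 * majorant k))%:E <= _).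
    apply: lee_sum => j _; apply: le_trans (integral_incr _ _ (ltW p0)) _.
    rewrite [leRHS]EFinM; apply: lee_wpmul2l.
      by rewrite lee_fin !mulr_ge0// ltW// radius_gt0.
    apply: le_trans (_ : (cubemass k x)%:E <= _); last by rewrite lee_fin.
    rewrite cubemassE; apply: subset_cube_integral => //.
    + exact: measurable_total.
    + exact: total_ge0.
    + exact: measurable_cube.
    + exact: measurable_cube.
    + move=> y; rewrite /cube /= => /le_trans; apply; rewrite pk lerD2r.
      by apply: radius_le; rewrite leq_addr.
  rewrite sumEFin lee_fin -mulr_suml -mulr_sumr; apply: ler_wpM2r.
    by rewrite (le_trans (cubemass_ge0 k x)).
  rewrite (_ : 16 * C * p = 8 * C * (2 * p))%R; last by ring.
  by apply: ler_wpM2l; [rewrite mulr_ge0|exact: sum_radius].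
(* Integrate the almost everywhere bound of [ae_moll] at scale k + 1: P for the mollification, G for
   the tail. *)
have hU i : c%:E * \int[mu]_(y in cube x p) `|U i y|%:E <=
    (P * (2 * p) ^+ 3 + 16 * C * p * (radius k ^+ 3 * majorant k))%:E.
  have mUi : measurable_fun (cube x p : set (M3 R)) (fun y : M3 R => `|U i y|%:E).
    by apply/measurable_EFinP; apply: measurable_funTS; exact: measurableT_comp.
  rewrite -ge0_integralZl_EFin//; last exact: ltW.
  apply: le_trans (_ : \int[mu]_(y in cube x p) (P%:E + G y) <= _).
    apply: ae_ge0_le_integral => //.
    - by move=> y _; rewrite mule_ge0// lee_fin ltW.
    - exact: emeasurable_funM.
    - by move=> y _; rewrite adde_ge0.
    - exact: emeasurable_funD.
    apply: filterS (ae_moll i) => y hy yx.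
    have := hy (near2 y yx) k.+1; rewrite -/(G y) -/p => h.
    apply: le_trans (_ : `|moll (U i) p y|%:E + `|c * U i y - moll (U i) p y|%:E <= _).
      rewrite -EFinM -EFinD lee_fin -{1}(gtr0_norm c0) -normrM.
      by have := ler_normD (moll (U i) p y) (c * U i y - moll (U i) p y)%R; rewrite addrC subrK.
    by apply: leeD => //; rewrite lee_fin hP.
  rewrite ge0_integralD//.
  have -> : \int[mu]_(_ in cube x p) P%:E = (P * (2 * p) ^+ 3)%:E.
    by rewrite integral_cst// EFinM; congr (_ * _).
  by rewrite [leRHS]EFinD; apply: leeD.
have : (c * cubemass k.+1 x <= #|I|%:R * (P * (2 * p) ^+ 3 + 16 * C * p * (radius k ^+ 3 * majorant k)))%R.
  rewrite -lee_fin EFinM cubemassE integral_total// ge0_sume_distrr; last first.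
    by move=> i _; apply: integral_ge0.
  apply: le_trans (lee_sum _ (fun i _ => hU i)) _.
  by rewrite sumEFin lee_fin sumr_const -[leLHS]mulr_natl.
rewrite mulrC -ler_pdivlMr// => /le_trans; apply.
rewrite [in leRHS]majorant_sum -/p.
have -> : (\sum_(0 <= j < k.+1) radius j * majorant j =
   \sum_(0 <= j < k) radius j * majorant j + radius k * majorant k)%R by rewrite big_nat_recr.
rewrite /P; have -> : (\sum_(0 <= j < k.+1) C * (radius j * majorant j) =
   C * (\sum_(0 <= j < k) radius j * majorant j + radius k * majorant k))%R.
  by rewrite -mulr_sumr big_nat_recr.
set S := (\sum_(0 <= j < k) _)%R.
have S0 : (0 <= S)%R.
  apply: sumr_ge0 => j _; rewrite mulr_ge0 ?(ltW (radius_gt0 _))//.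
  by have /andP[] := majorant_bound j.
have ci : (0 <= c^-1)%R by rewrite invr_ge0 ltW.
have N0 : (0 <= #|I|%:R :> R)%R by rewrite ler0n.
rewrite pk /seed /growth.
rewrite -subr_ge0.
(* Origin of the 72 in [growth]: the pointwise part carries the volume 8 p^3, and the mean part 16 p
   (2p)^3 equals 64 p^3 [radius k]. What remains is visibly non-negative. *)
have -> : (p ^+ 3 * (r0 ^- 3 * mass * (1 + 8 * #|I|%:R * M / c) +
    72 * #|I|%:R * C / c * (S + (p + p) * majorant k)) -
   #|I|%:R * ((M * r0 ^- 3 * mass + C * (S + (p + p) * majorant k)) * (2 * p) ^+ 3 +
    16 * C * p * ((p + p) ^+ 3 * majorant k)) / c)%R =
   (p ^+ 3 * (r0 ^- 3 * mass + 64 * (#|I|%:R * C * c^-1 * S)))%R.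
  by field; rewrite !gt_eqF.
rewrite mulr_ge0 ?exprn_ge0 ?(ltW p0)// addr_ge0//.
  by rewrite mulr_ge0 ?mass_ge0// invr_ge0 exprn_ge0// ltW.
by rewrite !mulr_ge0.
Qed.

Definition peak : R := (seed * expR (growth * (2 * r0)))%R.

Lemma peak_ge0 : (0 <= peak)%R.
Proof. by rewrite mulr_ge0 ?seed_ge0// expR_ge0. Qed.

(** Now that the masses are O(r^3), the increments are O(r) uniformly on the cube of radius r0. *)
Lemma incr_le k x : cube x0 r0 x -> (incr k x <= C * peak * radius k)%R.
Proof.
move=> hx; have rk := radius_gt0 k.
have hx' : cube x0 (r0 + radius k) x by move: hx; rewrite /cube /= => /le_trans; apply; lra.
apply: le_trans (incr_majorant (cubemass_majorant hx')) _.
rewrite -mulrA; apply: ler_wpM2l => //; rewrite mulrC; apply: ler_wpM2r; first exact: ltW.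
by have /andP[_] := majorant_bound k.
Qed.

Lemma cube_radius1 k x : cube x0 r0 x -> cube x (radius k) `<=` cube x0 (3 * r0).
Proof.
by move=> hx; apply: cube_radius; move: hx; rewrite /cube /= => /le_trans; apply; have := r00; lra.
Qed.

Lemma moll_step i k x : cube x0 r0 x ->
  (`|moll (U i) (radius k.+1) x - moll (U i) (radius k) x| <= C * peak * radius k)%R.
Proof.
move=> hx; apply: le_trans (incr_le k hx); exact/hincr/cube_radius1.
Qed.

Lemma moll_le i k x : cube x0 r0 x ->
  (`|moll (U i) (radius k) x| <= M * r0 ^- 3 * mass + C * peak * (2 * r0))%R.
Proof.
move=> hx; have := @moll_bound_sum i k x (fun j => C * peak * radius j)%R.
move=> /(_ _)/le_trans; apply.
  by move=> j _; split; [exact: cube_radius1|exact: incr_le].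
rewrite lerD2l -mulr_sumr; apply: ler_wpM2l; first by rewrite mulr_ge0// peak_ge0.
by have := sum_radius 0 k; rewrite radius0.
Qed.

Lemma ae_moll_cvg i : {ae mu, forall x, cube x0 r0 x ->
  moll (U i) (radius k) x @[k --> \oo] --> (c * U i x)%R}.
Proof.
apply: filterS (ae_moll i) => x hx h1.
have h2 : cube x0 (2 * r0) x by move: h1; rewrite /cube /= => /le_trans; apply; have := r00; lra.
have b k : (`|c * U i x - moll (U i) (radius k) x| <= C * peak * (2 * radius k))%R.
  rewrite -lee_fin; apply: le_trans (hx h2 k) _.
  apply: nneseries_le => [j|n]; first by rewrite lee_fin incr_ge0.
  rewrite sumEFin lee_fin; apply: le_trans (ler_sum _ (fun j _ => incr_le (k + j) h1)) _.
  rewrite -mulr_sumr; apply: ler_wpM2l (sum_radius k n); by rewrite mulr_ge0// peak_ge0.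
apply/cvgrPdist_le => e e0.
have : (C * peak * (2 * radius k))%R @[k --> \oo] --> (C * peak * (2 * 0))%R.
  apply: cvgM; first exact: cvg_cst.
  by apply: cvgM; [exact: cvg_cst|exact: cvg_radius].
rewrite !mulr0 => /cvgrPdist_le/(_ _ e0); apply: filterS => k.
rewrite sub0r normrN => hk; exact: le_trans (b k) (le_trans (ler_norm _) hk).
Qed.
End Gronwall.

(** * Norm inequalities for biquaternions, and the test fields *)

Section BiquaternionKernel.
Context {R : realType}.
Local Open Scope complex_scope.
Implicit Types (z : R[i]) (p q : biquat R) (x y : R3 R).

(** Inside the proof l_1 norms replace the Euclidean ones: they are sums over real components and
    avoid square roots. The exchange with [bq_norm] costs a factor 8 in each direction. *)
Definition abs1 z : R := `|complex.Re z| + `|complex.Im z|.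
Definition bq_abs1 p : R := abs1 (bq_scal p) + \sum_(k < 3) abs1 (bq_vec p 0 k).

Lemma abs1_ge0 z : 0 <= abs1 z.
Proof. exact: addr_ge0. Qed.

Lemma abs1D z1 z2 : abs1 (z1 + z2) <= abs1 z1 + abs1 z2.
Proof.
case: z1 z2 => [a b] [c d]; rewrite /abs1 /=.
by rewrite addrACA lerD// ler_normD.
Qed.

Lemma abs1N z : abs1 (- z) = abs1 z.
Proof. by case: z => a b; rewrite /abs1 /= !normrN. Qed.

Lemma abs1M z1 z2 : abs1 (z1 * z2) <= abs1 z1 * abs1 z2.
Proof.
case: z1 z2 => [a b] [c d]; rewrite /abs1 /=.
apply: le_trans (_ : (`|a * c| + `|b * d|) + (`|a * d| + `|b * c|) <= _).
  by rewrite lerD// ?ler_normD// (le_trans (ler_normB _ _)).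
by rewrite !normrM le_eqVlt; apply/orP; left; apply/eqP; ring.
Qed.

Lemma abs1_real (a : R) : abs1 a%:C = `|a|.
Proof. by rewrite /abs1 /= normr0 addr0. Qed.

Lemma abs1_normc z : abs1 z <= 2 * Normc.normc z.
Proof.
case: z => a b; rewrite /abs1 /=.
have h (u v : R) : `|u| <= Num.sqrt (u ^+ 2 + v ^+ 2).
  by rewrite -sqrtr_sqr ler_wsqrtr// lerDl sqr_ge0.
have h1 := h a b; have h2 := h b a; rewrite addrC in h2; lra.
Qed.

Lemma Re_abs1 z : `|complex.Re z| <= abs1 z. Proof. by rewrite /abs1 lerDl. Qed.
Lemma Im_abs1 z : `|complex.Im z| <= abs1 z. Proof. by rewrite /abs1 lerDr. Qed.

Lemma bq_scalE s v : bq_scal (bq s v : biquat R) = s.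
Proof. by rewrite /bq_scal /bq row_mxKl mxE mulr1n. Qed.

Lemma bq_vecE s v : bq_vec (bq s v : biquat R) = v.
Proof. by rewrite /bq_vec /bq row_mxKr. Qed.

Lemma bq_entry p (j : 'I_(1 + 3)) : p 0 j = match fintype.split j with inl _ => bq_scal p | inr k => bq_vec p 0 k end.
Proof.
case: splitP => k jk; rewrite /bq_scal /bq_vec !mxE; congr (p 0 _); apply/val_inj => //=.
by rewrite jk; case: k {jk} => -[].
Qed.

Lemma bq_abs1_ge0 p : 0 <= bq_abs1 p.
Proof. by rewrite addr_ge0 ?abs1_ge0// sumr_ge0// => k _; exact: abs1_ge0. Qed.

Lemma bq_abs1E p : bq_abs1 p = \sum_(j < 1 + 3) abs1 (p 0 j).
Proof.
rewrite big_split_ord big_ord1 /bq_abs1; congr (_ + _).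
  by rewrite /bq_scal mxE.
by apply: eq_bigr => k _; rewrite /bq_vec mxE.
Qed.

Lemma bq_abs1_conj p : bq_abs1 (bq_conj p) = bq_abs1 p.
Proof.
rewrite /bq_abs1 /bq_conj bq_scalE bq_vecE; congr (_ + _).
by apply: eq_bigr => k _; rewrite mxE abs1N.
Qed.

Lemma bq_abs1D p q : bq_abs1 (p + q) <= bq_abs1 p + bq_abs1 q.
Proof.
rewrite !bq_abs1E -big_split/=; apply: ler_sum => j _.
by rewrite mxE abs1D.
Qed.

Lemma ccrossE (u v : 'rV[R[i]]_3) k : ccross u v 0 k = u 0 (k + 1) * v 0 (k + 2%:R) - u 0 (k + 2%:R) * v 0 (k + 1).
Proof. by rewrite mxE. Qed.

(** Each left-hand side selects four different terms of the sixteen in the expanded product. The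
    trailing zeros match the unfolded finite sums. *)
Lemma diagonal_products_le (a0 a1 a2 a3 b0 b1 b2 b3 : R) :
  0 <= a0 -> 0 <= a1 -> 0 <= a2 -> 0 <= a3 -> 0 <= b0 -> 0 <= b1 -> 0 <= b2 -> 0 <= b3 ->
  let S := (a0 + (a1 + (a2 + (a3 + 0)))) * (b0 + (b1 + (b2 + (b3 + 0)))) in
  [/\ a0 * b0 + (a1 * b1 + (a2 * b2 + a3 * b3)) <= S,
      a0 * b1 + b0 * a1 + (a2 * b3 + a3 * b2) <= S,
      a0 * b2 + b0 * a2 + (a3 * b1 + a1 * b3) <= S &
      a0 * b3 + b0 * a3 + (a1 * b2 + a2 * b1) <= S].
Proof.
move=> h0 h1 h2 h3 k0 k1 k2 k3 /=.
have p00 := mulr_ge0 h0 k0; have p01 := mulr_ge0 h0 k1; have p02 := mulr_ge0 h0 k2; have p03 := mulr_ge0 h0 k3.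
have p10 := mulr_ge0 h1 k0; have p11 := mulr_ge0 h1 k1; have p12 := mulr_ge0 h1 k2; have p13 := mulr_ge0 h1 k3.
have p20 := mulr_ge0 h2 k0; have p21 := mulr_ge0 h2 k1; have p22 := mulr_ge0 h2 k2; have p23 := mulr_ge0 h2 k3.
have p30 := mulr_ge0 h3 k0; have p31 := mulr_ge0 h3 k1; have p32 := mulr_ge0 h3 k2; have p33 := mulr_ge0 h3 k3.
by split; lra.
Qed.

Lemma bq_mul_entry p q (j : 'I_(1 + 3)) : abs1 (bq_mul p q 0 j) <= bq_abs1 p * bq_abs1 q.
Proof.
rewrite bq_entry /bq_mul bq_scalE bq_vecE /bq_abs1 /cdot.
rewrite !big_ord_recl !big_ord0.
set p0 := bq_scal p; set q0 := bq_scal q.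
set u := bq_vec p; set v := bq_vec q.
have E1 : lift ord0 ord0 = 1 :> 'I_3 by exact/val_inj.
have E2 : lift ord0 (lift ord0 ord0) = 2%:R :> 'I_3 by exact/val_inj.
rewrite !E1 !E2 (_ : ord0 = 0 :> 'I_3)//.
have M a b := abs1M a b.
have sub a b : abs1 (a - b) <= abs1 a + abs1 b by rewrite (le_trans (abs1D _ _))// abs1N.
have [d0 d1 d2 d3] := diagonal_products_le (abs1_ge0 p0) (abs1_ge0 (u 0 0)) (abs1_ge0 (u 0 1))
  (abs1_ge0 (u 0 2%:R)) (abs1_ge0 q0) (abs1_ge0 (v 0 0)) (abs1_ge0 (v 0 1)) (abs1_ge0 (v 0 2%:R)).
case: (fintype.split j) => [_|k].
  apply: le_trans d0; apply: le_trans (sub _ _) (lerD (M _ _) _).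
  apply: le_trans (abs1D _ _) (lerD (M _ _) _).
  by rewrite addr0; apply: le_trans (abs1D _ _) (lerD (M _ _) (M _ _)).
have H k' : abs1 ((p0 *: v + q0 *: u + ccross u v) 0 k') <=
    abs1 p0 * abs1 (v 0 k') + abs1 q0 * abs1 (u 0 k') +
    (abs1 (u 0 (k' + 1)) * abs1 (v 0 (k' + 2%:R)) + abs1 (u 0 (k' + 2%:R)) * abs1 (v 0 (k' + 1))).
  rewrite mxE [X in _ + X]ccrossE mxE [(p0 *: v) 0 _]mxE [(q0 *: u) 0 _]mxE.
  apply: le_trans (abs1D _ _) (lerD _ _).
    exact: le_trans (abs1D _ _) (lerD (M _ _) (M _ _)).
  exact: le_trans (sub _ _) (lerD (M _ _) (M _ _)).
apply: le_trans (H k) _; case: k => -[|[|[|//]]] i.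
- rewrite (_ : Ordinal i = 0); last exact/val_inj.
  rewrite (_ : 0 + 1 = 1 :> 'I_3); last exact/val_inj.
  rewrite (_ : 0 + 2%:R = 2%:R :> 'I_3); last exact/val_inj.
  exact: d1.
- rewrite (_ : Ordinal i = 1); last exact/val_inj.
  rewrite (_ : 1 + 1 = 2%:R :> 'I_3); last exact/val_inj.
  rewrite (_ : 1 + 2%:R = 0 :> 'I_3); last exact/val_inj.
  exact: d2.
- rewrite (_ : Ordinal i = 2%:R); last exact/val_inj.
  rewrite (_ : 2%:R + 1 = 0 :> 'I_3); last exact/val_inj.
  rewrite (_ : 2%:R + 2%:R = 1 :> 'I_3); last exact/val_inj.
  exact: d3.
Qed.

Lemma bq_abs1M p q : bq_abs1 (bq_mul p q) <= 4 * (bq_abs1 p * bq_abs1 q).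
Proof.
rewrite bq_abs1E; apply: le_trans (ler_sum _ (fun j _ => bq_mul_entry p q j)) _.
by rewrite sumr_const card_ord mulr_natl.
Qed.

Definition vector_field (N : 'I_3 -> R3 R -> R) y : biquat R := bq 0 (\row_k (N k y)%:C).

Lemma pderiv_cst k (a : R) : pderiv k (cst a : R3 R -> R) = cst 0.
Proof. by apply: pderivE => y; exact: is_derive_cst. Qed.

Lemma vector_fieldE N y (j : 'I_(1 + 3)) :
  vector_field N y 0 j = match fintype.split j with inl _ => 0 | inr k => (N k y)%:C end.
Proof. by rewrite bq_entry /vector_field bq_scalE bq_vecE; case: fintype.split => // k; rewrite mxE. Qed.

Lemma cpderiv_real k (f : R3 R -> R) y : cpderiv k (fun y => (f y)%:C) y = (pderiv k f y)%:C.
Proof. by rewrite /cpderiv /= -/(cst 0) pderiv_cst. Qed.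

Lemma bq_pderiv_vector_field k N y :
  bq_pderiv k (vector_field N) y = vector_field (fun l => pderiv k (N l)) y.
Proof.
apply/rowP => j; rewrite mxE vector_fieldE.
have -> : (fun y0 => vector_field N y0 0 j) =
    match fintype.split j with inl _ => fun=> (0 : R)%:C | inr l => fun y0 => (N l y0)%:C end.
  by apply/funext => y0; rewrite vector_fieldE; case: fintype.split.
case: fintype.split => [_|l]; rewrite cpderiv_real//.
by rewrite -/(cst (0 : R)) pderiv_cst.
Qed.

Lemma delta_mxE (k m : 'I_3) : (delta_mx 0 k : 'rV[R[i]]_3) 0 m = (m == k)%:R.
Proof. by rewrite mxE eqxx. Qed.

Lemma cdot_delta (k : 'I_3) (v : 'rV[R[i]]_3) : cdot (delta_mx 0 k) v = v 0 k.
Proof.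
rewrite /cdot (bigD1 k)//= delta_mxE eqxx mul1r big1 ?addr0// => m mk.
by rewrite delta_mxE (negbTE mk) mul0r.
Qed.

(* The vector part of the Dirac operator is the curl, which vanishes on a gradient field. *)
Lemma dirac_sum_symmetric (d : 'I_3 -> 'I_3 -> R) : (forall k l, d k l = d l k) ->
  \sum_(k < 3) bq_mul (bq_unit R k) (bq 0 (\row_l (d k l)%:C)) = bq (- (\sum_(k < 3) d k k))%:C 0.
Proof.
move=> sym.
rewrite /bq_mul /bq_unit; under eq_bigr do rewrite !bq_scalE !bq_vecE.
apply/rowP => j; rewrite summxE bq_entry bq_scalE bq_vecE.
under eq_bigr do rewrite bq_entry bq_scalE bq_vecE.
rewrite !big_ord_recl !big_ord0 !cdot_delta.
have E1 : lift ord0 ord0 = 1 :> 'I_3 by exact/val_inj.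
have E2 : lift ord0 (lift ord0 ord0) = 2%:R :> 'I_3 by exact/val_inj.
rewrite !E1 !E2 (_ : ord0 = 0 :> 'I_3)//.
have rE k m : (\row_l (d k l)%:C : 'rV[R[i]]_3) 0 m = (d k m)%:C by rewrite mxE.
case: (fintype.split j) => [_|m].
  rewrite !rE.
  apply/eqP; rewrite eq_complex /=; apply/andP; split; apply/eqP; ring.
rewrite !scale0r !add0r !ccrossE !delta_mxE !rE mxE.
case: m => -[|[|[|//]]] i.
- rewrite (_ : Ordinal i = 0); last exact/val_inj.
  rewrite (_ : 0 + 1 = 1 :> 'I_3); last exact/val_inj.
  rewrite (_ : 0 + 2%:R = 2%:R :> 'I_3); last exact/val_inj.
  rewrite /= (sym 2%:R 1).
  apply/eqP; rewrite eq_complex /=; apply/andP; split; apply/eqP; ring.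
- rewrite (_ : Ordinal i = 1); last exact/val_inj.
  rewrite (_ : 1 + 1 = 2%:R :> 'I_3); last exact/val_inj.
  rewrite (_ : 1 + 2%:R = 0 :> 'I_3); last exact/val_inj.
  rewrite /= (sym 2%:R 0).
  apply/eqP; rewrite eq_complex /=; apply/andP; split; apply/eqP; ring.
- rewrite (_ : Ordinal i = 2%:R); last exact/val_inj.
  rewrite (_ : 2%:R + 1 = 0 :> 'I_3); last exact/val_inj.
  rewrite (_ : 2%:R + 2%:R = 1 :> 'I_3); last exact/val_inj.
  rewrite /= (sym 1 0).
  apply/eqP; rewrite eq_complex /=; apply/andP; split; apply/eqP; ring.
Qed.

Lemma bq_D_vector_field (N : 'I_3 -> R3 R -> R) y :
  (forall k l, pderiv k (N l) y = pderiv l (N k) y) ->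
  bq_D (vector_field N) y = bq (- (\sum_(k < 3) pderiv k (N k) y))%:C 0.
Proof.
move=> sym; rewrite -(dirac_sum_symmetric (d := fun k l => pderiv k (N l) y))//.
by apply: eq_bigr => k _; rewrite bq_pderiv_vector_field.
Qed.

Definition test_field r x k y : R := newton (r / 2) k x y - newton r k x y.

Lemma Cn_test_field n r x k : Cn n (test_field r x k).
Proof.
have -> : test_field r x k = (fun y => newton (r / 2) k x y + (-1) * newton r k x y).
  by apply/funext => y; rewrite mulN1r.
by apply: CnD; [exact: Cn_newton|apply: CnM; [exact: Cn_cst|exact: Cn_newton]].
Qed.

Lemma pderiv_test_field r x k l y :
  pderiv k (test_field r x l) y = dnewton (r / 2) l k x y - dnewton r l k x y.
Proof.
have D s : is_derive y (basis3 R k) (newton s l x) (dnewton s l k x y).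
  by rewrite -pderiv_newton; exact: (Cn_derive (n := 0) _ _ (Cn_newton 1 s l x)).
by rewrite /pderiv (@derive_val _ _ _ _ _ _ _ (is_deriveB (D (r / 2)) (D r))).
Qed.

Lemma bq_D_test_field r x y :
  bq_D (vector_field (test_field r x)) y = bq (- (delta (r / 2) x y - delta r x y))%:C 0.
Proof.
rewrite bq_D_vector_field => [|k l].
  by under eq_bigr do rewrite pderiv_test_field; rewrite sumrB !div_newton.
by rewrite !pderiv_test_field (dnewton_sym _ l k) (dnewton_sym r l k).
Qed.

Lemma test_field_far r x k y : 0 < r -> ~ cube x r y -> test_field r x k y = 0.
Proof.
move=> r0 h; have r20 : 0 < r / 2 by lra.
rewrite /test_field (newton_far r0 h) newton_far ?subrr// => h2; apply: h.
by move: h2; rewrite /cube /= => /le_trans; apply; lra.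
Qed.

(** The scale r/2 contributes 2 (r/2)^-2 = 8 r^-2 and the scale r another 2 r^-2. *)
Lemma test_field_bound r x k y : 0 < r -> `|test_field r x k y| <= 10 * r ^- 2.
Proof.
move=> r0; have r20 : 0 < r / 2 by lra.
apply: le_trans (ler_normB _ _) _.
apply: le_trans (lerD (newton_bound k x y r20) (newton_bound k x y r0)) _.
by rewrite le_eqVlt; apply/orP; left; apply/eqP; field; rewrite gt_eqF.
Qed.

Lemma test_field_Cc (G : set (R3 R)) r x : 0 < r -> cube x r `<=` G ->
  bq_in (in_Cc_infty G) (vector_field (test_field r x)).
Proof.
move=> r0 xG j.
have E : (fun y => vector_field (test_field r x) y 0 j) =
    match fintype.split j with inl _ => fun=> (0 : R)%:C | inr l => fun y => (test_field r x l y)%:C end.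
  by apply/funext => y0; rewrite vector_fieldE; case: fintype.split.
have S0 : smooth (cst (0 : R) : R3 R -> R) by apply: smooth_Cn => n; exact: Cn_cst.
rewrite E; case: fintype.split => [_|l]; split => //=.
- exists (cube x r); split => //; exact: compact_cube.
- by apply: smooth_Cn => n; exact: Cn_test_field.
- exists (cube x r); split => //; first exact: compact_cube.
  by move=> y h; rewrite test_field_far.
Qed.

Lemma bq_abs1_vector_field (N : 'I_3 -> R3 R -> R) y :
  bq_abs1 (vector_field N y) = \sum_(k < 3) `|N k y|.
Proof.
rewrite /bq_abs1 /vector_field bq_scalE bq_vecE abs1_real normr0 add0r.
by apply: eq_bigr => k _; rewrite mxE abs1_real.
Qed.
End BiquaternionKernel.

(** * Measurability of biquaternion expressions, and the estimate drawn from the weak equation *)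

Section WeakEstimate.
Context {R : realType}.
Local Open Scope complex_scope.
Local Notation mu := (@lebesgue3 R).
Implicit Types (p q : biquat R) (x y : R3 R) (D : set (M3 R)).

(** The eight real coordinates, as one finite family of real functions to which the Gronwall section
    applies. *)
Definition component (c : 'I_(1 + 3) * bool) p : R :=
  if c.2 then complex.Re (p 0 c.1) else complex.Im (p 0 c.1).

Lemma bq_abs1_component p : bq_abs1 p = \sum_c `|component c p|.
Proof.
rewrite bq_abs1E -(pair_bigA _ (fun j b => `|component (j, b) p|)) /=.
by apply: eq_bigr => j _; rewrite big_bool.
Qed.

(** [cmeasurable] with the carrier presented as [M3 R], the form in which its sigma-algebra is
    found. *)
Definition cmeas D (f : M3 R -> R[i]) : Prop :=
  measurable_fun D (fun y : M3 R => complex.Re (f y)) /\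
  measurable_fun D (fun y : M3 R => complex.Im (f y)).

Lemma cmeasurable_cmeas D (f : R3 R -> R[i]) : cmeasurable D f -> cmeas D f.
Proof. by []. Qed.

Lemma cmeasD D f g : cmeas D f -> cmeas D g -> cmeas D (fun y => f y + g y).
Proof.
move=> [f1 f2] [g1 g2]; split.
  apply: (eq_measurable_fun (fun y => complex.Re (f y) + complex.Re (g y))); last exact: measurable_funD.
  by move=> y _; case: (f y) (g y) => [? ?] [].
apply: (eq_measurable_fun (fun y => complex.Im (f y) + complex.Im (g y))); last exact: measurable_funD.
by move=> y _; case: (f y) (g y) => [? ?] [].
Qed.

Lemma cmeasM D f g : cmeas D f -> cmeas D g -> cmeas D (fun y => f y * g y).
Proof.
move=> [f1 f2] [g1 g2]; split.
  apply: (eq_measurable_fun (fun y => complex.Re (f y) * complex.Re (g y) - complex.Im (f y) * complex.Im (g y))).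
    by move=> y _; case: (f y) (g y) => [? ?] [].
  by apply: measurable_funB; exact: measurable_funM.
apply: (eq_measurable_fun (fun y => complex.Re (f y) * complex.Im (g y) + complex.Im (f y) * complex.Re (g y))).
  by move=> y _; case: (f y) (g y) => [? ?] [].
by apply: measurable_funD; exact: measurable_funM.
Qed.

Lemma cmeasN D f : cmeas D f -> cmeas D (fun y => - f y).
Proof.
move=> [f1 f2]; split.
  apply: (eq_measurable_fun (fun y => - complex.Re (f y))); last exact: measurable_funN.
  by move=> y _; case: (f y).
apply: (eq_measurable_fun (fun y => - complex.Im (f y))); last exact: measurable_funN.
by move=> y _; case: (f y).
Qed.

Definition bq_meas D (w : M3 R -> biquat R) : Prop := forall j, cmeas D (fun y => w y 0 j).

Lemma bq_meas_scal D w : bq_meas D w -> cmeas D (fun y => bq_scal (w y)).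
Proof.
move=> mw; have -> : (fun y => bq_scal (w y)) = (fun y => w y 0 (lshift 3 0)).
  by apply/funext => y; rewrite /bq_scal mxE.
exact: mw.
Qed.

Lemma bq_meas_vec D w k : bq_meas D w -> cmeas D (fun y => bq_vec (w y) 0 k).
Proof.
move=> mw; have -> : (fun y => bq_vec (w y) 0 k) = (fun y => w y 0 (rshift 1 k)).
  by apply/funext => y; rewrite /bq_vec mxE.
exact: mw.
Qed.

Lemma bq_meas_bq D (s : M3 R -> R[i]) (v : M3 R -> 'rV[R[i]]_3) :
  cmeas D s -> (forall k, cmeas D (fun y => v y 0 k)) -> bq_meas D (fun y => bq (s y) (v y)).
Proof.
move=> ms mv j.
have -> : (fun y => bq (s y) (v y) 0 j) = match fintype.split j with inl _ => s | inr k => fun y => v y 0 k end.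
  by apply/funext => y; rewrite bq_entry bq_scalE bq_vecE; case: fintype.split.
by case: fintype.split.
Qed.

Lemma bq_meas_conj D w : bq_meas D w -> bq_meas D (fun y => bq_conj (w y)).
Proof.
move=> mw; apply: bq_meas_bq; first exact: bq_meas_scal.
move=> k; have -> : (fun y => (- bq_vec (w y)) 0 k) = (fun y => - (bq_vec (w y) 0 k)).
  by apply/funext => y; rewrite mxE.
by apply: cmeasN; exact: bq_meas_vec.
Qed.

Lemma vec_mul_entry (a b : R[i]) (u v w z : 'rV[R[i]]_3) k :
  (a *: u + b *: v + ccross w z) 0 k = a * u 0 k + b * v 0 k + (w 0 (k + 1) * z 0 (k + 2%:R) + - (w 0 (k + 2%:R) * z 0 (k + 1))).
Proof. by rewrite !mxE. Qed.

Lemma bq_meas_mul D w1 w2 : bq_meas D w1 -> bq_meas D w2 ->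
  bq_meas D (fun y => bq_mul (w1 y) (w2 y)).
Proof.
move=> m1 m2; apply: bq_meas_bq.
  apply: cmeasD; first by apply: cmeasM; exact: bq_meas_scal.
  apply: cmeasN; rewrite /cdot.
  have -> : (fun y => \sum_(k < 3) bq_vec (w1 y) 0 k * bq_vec (w2 y) 0 k) =
     (fun y => bq_vec (w1 y) 0 0 * bq_vec (w2 y) 0 0 + (bq_vec (w1 y) 0 1 * bq_vec (w2 y) 0 1 + bq_vec (w1 y) 0 2%:R * bq_vec (w2 y) 0 2%:R)).
    apply/funext => y; rewrite !big_ord_recl big_ord0 addr0.
    have E1 : lift ord0 ord0 = 1 :> 'I_3 by exact/val_inj.
    have E2 : lift ord0 (lift ord0 ord0) = 2%:R :> 'I_3 by exact/val_inj.
    by rewrite !E1 !E2 (_ : ord0 = 0 :> 'I_3).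
  by apply: cmeasD; [|apply: cmeasD]; apply: cmeasM; exact: bq_meas_vec.
move=> k.
have -> : (fun y => (bq_scal (w1 y) *: bq_vec (w2 y) + bq_scal (w2 y) *: bq_vec (w1 y) + ccross (bq_vec (w1 y)) (bq_vec (w2 y))) 0 k) =
  (fun y => bq_scal (w1 y) * bq_vec (w2 y) 0 k + bq_scal (w2 y) * bq_vec (w1 y) 0 k +
     (bq_vec (w1 y) 0 (k + 1) * bq_vec (w2 y) 0 (k + 2%:R) + - (bq_vec (w1 y) 0 (k + 2%:R) * bq_vec (w2 y) 0 (k + 1)))).
  by apply/funext => y; exact: vec_mul_entry.
apply: cmeasD; first by apply: cmeasD; apply: cmeasM; [exact: bq_meas_scal|exact: bq_meas_vec|exact: bq_meas_scal|exact: bq_meas_vec].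
by apply: cmeasD; [|apply: cmeasN]; apply: cmeasM; exact: bq_meas_vec.
Qed.

Lemma measurable_component D w c : bq_meas D w -> measurable_fun D (fun y => component c (w y)).
Proof. by case: c => j [] /(_ j)[]. Qed.

Lemma measurable_newton r k x : measurable_fun setT (newton r k x : M3 R -> R).
Proof.
have mc j : measurable_fun setT (fun y : M3 R => coord3 j ((y : R3 R) - x)).
  apply: (eq_measurable_fun (fun y : M3 R => coord3 j y - coord3 j x)).
    by move=> y _; rewrite coord3B.
  by apply: measurable_funB => //; exact: measurable_coord3.
apply: measurable_funM; first by apply: measurable_funM => //; exact: mc.
have ck : continuous (@kap R) by exact: continuous_is_derive is_derive_kap.
apply: (measurableT_comp (continuous_measurable_fun ck)).
apply: measurable_funM => //.
apply: (eq_measurable_fun (fun y : M3 R => coord3 0 ((y : R3 R) - x) ^+ 2 + coord3 1 ((y : R3 R) - x) ^+ 2 + coord3 2%:R ((y : R3 R) - x) ^+ 2)).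
  by move=> y _.
by do ! apply: measurable_funD; apply: measurable_funX; exact: mc.
Qed.

Lemma bq_meas_test_field D r x : bq_meas D (fun y => vector_field (test_field r x) y).
Proof.
apply: bq_meas_bq; first by split; exact: measurable_cst.
move=> k; have -> : (fun y : M3 R => (\row_k0 (test_field r x k0 y)%:C : 'rV[R[i]]_3) 0 k) = (fun y => (test_field r x k y)%:C).
  by apply/funext => y; rewrite mxE.
split; last exact: measurable_cst.
by apply: measurable_funTS; apply: measurable_funB; exact: measurable_newton.
Qed.

Lemma bq_mul_real p (a : R) (j : 'I_(1 + 3)) : bq_mul p (bq a%:C 0) 0 j = a%:C * p 0 j.
Proof.
have c0 (u : 'rV[R[i]]_3) : cdot u 0 = 0 by rewrite /cdot big1// => k _; rewrite mxE mulr0.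
have x0 (u : 'rV[R[i]]_3) : ccross u 0 = 0 by apply/rowP => k; rewrite ccrossE !mxE !mulr0 subr0.
rewrite bq_entry [in RHS]bq_entry /bq_mul !bq_scalE !bq_vecE c0 x0 subr0 scaler0 add0r addr0.
by case: fintype.split => [_|k]; [rewrite mulrC|rewrite mxE].
Qed.

Lemma bq_mulr0 p : bq_mul p 0 = 0.
Proof.
have e0 : bq (0 : R)%:C 0 = 0 :> biquat R.
  apply/rowP => i; rewrite bq_entry bq_scalE bq_vecE [RHS]mxE.
  by case: fintype.split => // k; rewrite mxE.
by apply/rowP => j; rewrite -e0 bq_mul_real mul0r e0 mxE.
Qed.

Lemma bq_integral_component (G : set (R3 R)) (f g : R3 R -> biquat R) c :
  bq_integral G f = bq_integral G g ->
  Rintegral (leb3 R) G (fun y => component c (f y)) =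
  Rintegral (leb3 R) G (fun y => component c (g y)).
Proof.
move=> /rowP/(_ c.1); rewrite !mxE /component => -[eRe eIm].
by case: c.2.
Qed.

Definition csign (j : 'I_(1 + 3)) : R := match fintype.split j with inl _ => 1 | inr _ => -1 end.

Lemma bq_conj_entry p j : bq_conj p 0 j = (csign j)%:C * p 0 j.
Proof.
rewrite bq_entry [in RHS]bq_entry /csign /bq_conj bq_scalE bq_vecE.
case: fintype.split => [_|k]; first by rewrite mul1r.
by rewrite mxE; case: (bq_vec p 0 k) => a b; apply/eqP; rewrite eq_complex /=; apply/andP; split; apply/eqP; ring.
Qed.

Lemma component_real (a : R) p q c : (forall j, q 0 j = a%:C * p 0 j) -> component c q = a * component c p.
Proof.
by move=> h; case: c => j b; rewrite /component /= h; case: (p 0 j) => u v; case: b; rewrite /=; ring.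
Qed.

Lemma Rintegral_support (G : set (R3 R)) D (f : R3 R -> R) :
  D `<=` G -> (forall y, ~ D y -> f y = 0) -> Rintegral (leb3 R) G f = Rintegral mu D f.
Proof.
move=> DG f0; rewrite /Rintegral; congr fine.
rewrite [LHS]integral_mkcond [RHS]integral_mkcond; apply: eq_integral => y _.
rewrite !patchE; have [yD|yD] := boolP (y \in D).
  by rewrite mem_set//; apply: DG; rewrite inE in yD.
case: ifP => // _; rewrite f0// => Dy; by rewrite mem_set in yD.
Qed.

Lemma in_L1_integrable D (f : R3 R -> R[i]) : measurable D -> in_Lp 1 D f ->
  mu.-integrable D (fun y : M3 R => (complex.Re (f y))%:E) /\
  mu.-integrable D (fun y : M3 R => (complex.Im (f y))%:E).
Proof.
move=> mD [/cmeasurable_cmeas[m1 m2] fin].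
have h (g : M3 R -> R) : measurable_fun D g -> (forall y, `|g y| <= Normc.normc (f y)) ->
    mu.-integrable D (fun y => (g y)%:E).
  move=> mg hg; apply/integrableP; split; first exact/measurable_EFinP.
  apply: le_lt_trans fin.
  have mn : measurable_fun D (fun y : M3 R => Normc.normc (f y) `^ 1).
    apply: (eq_measurable_fun (fun y : M3 R => Num.sqrt (complex.Re (f y) ^+ 2 + complex.Im (f y) ^+ 2))).
      by move=> y _; case: (f y) => a b; rewrite powRr1//= sqrtr_ge0.
    have ms : measurable_fun setT (Num.sqrt : R -> R) := continuous_measurable_fun (@sqrt_continuous R).
    have mf : measurable_fun D (fun y : M3 R => complex.Re (f y) ^+ 2 + complex.Im (f y) ^+ 2).
      by apply: measurable_funD; exact: measurable_funX.
    exact: (measurableT_comp ms mf).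
  apply: ge0_le_integral => //.
  - by apply: measurableT_comp => //; exact/measurable_EFinP.
  - exact/measurable_EFinP.
  - move=> y _; rewrite abse_EFin lee_fin powRr1//; exact: le_trans (hg y).
split; apply: h => // y; case: (f y) => a b /=.
  by rewrite -sqrtr_sqr ler_wsqrtr// lerDl sqr_ge0.
by rewrite -sqrtr_sqr ler_wsqrtr// lerDr sqr_ge0.
Qed.

Lemma measurable_bq_abs1 D w : bq_meas D w -> measurable_fun D (fun y => bq_abs1 (w y)).
Proof.
move=> mw; have -> : (fun y => bq_abs1 (w y)) = (fun y => \sum_c `|component c (w y)|).
  by apply/funext => y; exact: bq_abs1_component.
by apply: measurable_sum => c; apply: measurableT_comp => //; exact: measurable_component.
Qed.

Lemma integrable_component D (u : R3 R -> biquat R) c : measurable D -> bq_in (in_Lp 1 D) u ->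
  mu.-integrable D (fun y : M3 R => (component c (u y))%:E).
Proof. by move=> mD; case: c => j b /(_ j)/(in_L1_integrable mD)[h1 h2]; case: b. Qed.

Lemma bq_in_meas (p : R) D (u : R3 R -> biquat R) : bq_in (in_Lp p D) u -> bq_meas D u.
Proof. by move=> hu j; apply: cmeasurable_cmeas; exact: (hu j).1. Qed.

Definition delta_diff r x y : R := delta (r / 2) x y - delta r x y.

Lemma measurable_delta_diff r x : measurable_fun setT (delta_diff r x : M3 R -> R).
Proof. by apply: measurable_funB; exact: measurable_delta_r. Qed.

Lemma delta_diff_far r x y : 0 < r -> ~ cube x r y -> delta_diff r x y = 0.
Proof.
move=> r0 h; have r20 : 0 < r / 2 by lra.
rewrite /delta_diff (delta_far r0 h) delta_far ?subrr// => h2; apply: h.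
by move: h2; rewrite /cube /= => /le_trans; apply; lra.
Qed.

Lemma integrable_component_delta D (u : R3 R -> biquat R) c r x : 0 < r -> measurable D ->
  bq_in (in_Lp 1 D) u ->
  mu.-integrable D (fun y : M3 R => (component c (u y) * delta_diff r x y)%:E).
Proof.
move=> r0 mD hu; have [M M0 hM] := @delta_bounded R; have r20 : 0 < r / 2 by lra.
have : mu.-integrable D ((fun y : M3 R => (component c (u y))%:E) \* (EFin \o (delta_diff r x : M3 R -> R)))%E.
  apply: integrableMl => //; first exact: integrable_component.
    by apply: measurable_funTS; exact: measurable_delta_diff.
  exists (M * (r / 2) ^- 3 + M * r ^- 3); split; first exact: num_real.
  move=> A hA y _ /=; apply: le_trans (ltW hA); rewrite /delta_diff.
  apply: le_trans (ler_normB _ _) _.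
  by apply: lerD; rewrite ger0_norm ?delta_ge0//; exact: hM.
by apply: eq_integrable.
Qed.

Lemma bq_abs1_test_field r x y : 0 < r ->
  bq_abs1 (vector_field (test_field r x) y) <= 30 * r ^- 2.
Proof.
move=> r0; rewrite bq_abs1_vector_field.
apply: le_trans (ler_sum _ (fun k _ => test_field_bound x k y r0)) _.
rewrite !big_ord_recl big_ord0; lra.
Qed.

Lemma Rintegral_ae_bound D (g W : M3 R -> R) A : measurable D ->
  measurable_fun D g -> measurable_fun D W -> 0 <= A -> (forall y, 0 <= W y) ->
  {ae mu, forall y, D y -> `|g y| <= A * W y} ->
  (`|Rintegral mu D g|%:E <= A%:E * \int[mu]_(y in D) (W y)%:E)%E.
Proof.
move=> mD mg mW A0 W0 gb.
have int : (\int[mu]_(y in D) `|(g y)%:E| <= A%:E * \int[mu]_(y in D) (W y)%:E)%E.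
  rewrite -ge0_integralZl_EFin//; last 2 first.
  - by move=> y _; rewrite lee_fin W0.
  - exact/measurable_EFinP.
  apply: ae_ge0_le_integral => //.
  - by apply: measurableT_comp => //; exact/measurable_EFinP.
  - by move=> y _; rewrite -EFinM lee_fin mulr_ge0 ?W0.
  - by apply: emeasurable_funM => //; exact/measurable_EFinP.
apply: le_trans int; rewrite /Rintegral.
have [ff|nf] := boolP ((\int[mu]_(y in D) (g y)%:E)%E \is a fin_num).
  rewrite -abse_EFin (fineK ff); apply: le_abse_integral => //; exact/measurable_EFinP.
(* An integral that is not finite is sent to 0 by [fine], and the bound is then trivial. *)
rewrite (_ : fine _ = 0).
  by rewrite normr0 integral_ge0.
by case: (\int[mu]_(y in D) (g y)%:E)%E nf.
Qed.

(* Testing the equation with the difference of two regularized Newton fields gives the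
   difference of the two mollifications on the left, and an integrable kernel on the right. *)
Lemma weak_estimate (G : set (R3 R)) (u v : R3 R -> biquat R) (K : R) r x c :
  weak_D G u v -> 0 <= K ->
  {ae leb3 R, forall y, G y -> bq_abs1 (v y) <= K * bq_abs1 (u y)} ->
  0 < r -> cube x r `<=` G ->
  (`|Rintegral mu (cube x r) (fun y => component c (u y) * delta_diff r x y)|%:E <=
   (30 * K * r ^- 2)%:E * \int[mu]_(y in cube x r) (bq_abs1 (u y))%:E)%E.
Proof.
move=> [uL vL E] K0 vu r0 xG; set Q := cube x r.
have mQ : measurable (Q : set (M3 R)) := measurable_cube x r.
have uQ : bq_in (in_Lp 1 Q) u by move=> j; apply: uL => //; exact: compact_cube.
have vQ : bq_in (in_Lp 1 Q) v by move=> j; apply: vL => //; exact: compact_cube.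
have mv := bq_in_meas vQ; have mu' := bq_in_meas uQ.
pose phi := vector_field (test_field r x).
have mphi : bq_meas Q phi by exact: bq_meas_test_field.
pose g y := component c (bq_mul (bq_conj (v y)) (phi y)).
have mg : measurable_fun Q (g : M3 R -> R).
  by apply: measurable_component; apply: bq_meas_mul => //; exact: bq_meas_conj.
have phi0 y : ~ Q y -> phi y = 0.
  move=> Qy; apply/rowP => j; rewrite vector_fieldE mxE.
  by case: fintype.split => // k; rewrite test_field_far.
have E1 : Rintegral (leb3 R) G (fun y => component c (bq_mul (bq_conj (u y)) (bq_D phi y))) =
          Rintegral (leb3 R) G g.
  exact: bq_integral_component (E phi (test_field_Cc r0 xG)).
(* D phi is a real scalar, so component c of the product is a real multiple of that of the conjugate
   of u, hence of component c of u up to sign. *)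
have E2 y : component c (bq_mul (bq_conj (u y)) (bq_D phi y)) =
    - csign c.1 * (component c (u y) * delta_diff r x y).
  rewrite bq_D_test_field -/(delta_diff r x y).
  rewrite (@component_real (- delta_diff r x y) (bq_conj (u y))); last by move=> j; exact: bq_mul_real.
  rewrite /component bq_conj_entry; case: (u y 0 c.1) => a b.
  by case: c.2; rewrite /=; ring.
have E3 : Rintegral mu Q (fun y => - csign c.1 * (component c (u y) * delta_diff r x y)) = Rintegral mu Q g.
  have s1 y : ~ Q y -> - csign c.1 * (component c (u y) * delta_diff r x y) = 0.
    by move=> Qy; rewrite (delta_diff_far r0 Qy) !mulr0.
  have s2 y : ~ Q y -> g y = 0.
    by move=> Qy; rewrite /g (phi0 _ Qy) /component bq_mulr0 mxE; case: c.2.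
  rewrite -(Rintegral_support xG s1) -(Rintegral_support xG s2) -E1.
  by apply: eq_Rintegral => y _; rewrite E2.
rewrite (RintegralZl _ mQ (integrable_component_delta c x r0 mQ uQ)) in E3.
have E4 : `|Rintegral mu Q (fun y => component c (u y) * delta_diff r x y)| = `|Rintegral mu Q g|.
  rewrite -E3 normrM normrN.
  have -> : `|csign c.1| = 1 by rewrite /csign; case: fintype.split => _; rewrite ?normrN normr1.
  by rewrite mul1r.
rewrite E4.
have mW : measurable_fun Q (fun y : M3 R => bq_abs1 (u y)) := measurable_bq_abs1 mu'.
have K1 : 0 <= 30 * K * r ^- 2.
  by apply: mulr_ge0; [exact: mulr_ge0|rewrite invr_ge0; exact/exprn_ge0/ltW].
refine (Rintegral_ae_bound mQ mg mW K1 (fun y => bq_abs1_ge0 (u y)) _).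
(* The bound on v holds off a negligible set only; the same exceptional set serves for g. *)
case: vu => N [mN N0 sub]; exists N; split => // y /= ny; apply: sub => /= hy; apply: ny => Qy.
apply: le_trans (_ : bq_abs1 (v y) * bq_abs1 (phi y) <= _).
  rewrite -(bq_abs1_conj (v y)) /g; apply: le_trans (bq_mul_entry _ _ c.1).
  by rewrite /component; case: c.2; [exact: Re_abs1|exact: Im_abs1].
have h1 : bq_abs1 (phi y) <= 30 * r ^- 2 := bq_abs1_test_field x y r0.
apply: le_trans (ler_pM (bq_abs1_ge0 _) (bq_abs1_ge0 _) (hy (xG _ Qy)) h1) _.
by rewrite le_eqVlt; apply/orP; left; apply/eqP; ring.
Qed.
End WeakEstimate.

(** * Continuity of mollifications *)

Section ContinuousMollification.
Context {R : realType}.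
Local Notation mu := (@lebesgue3 R).
Implicit Types (x y : R3 R) (r e : R).

Lemma delta_translate r x y : delta r x y = delta r 0 (y - x).
Proof. by rewrite /delta subr0. Qed.

Lemma cvg_subrr_le (T : Type) (F : set_system T) (FF : Filter F) (f : T -> R) (a e : R) :
  f @ F --> a - a -> 0 < e -> \forall t \near F, `|f t| <= e.
Proof.
rewrite subrr => /cvgrPdist_le h e0; have := h e e0.
by apply: filterS => t; rewrite sub0r normrN.
Qed.

(** Uniformity in y comes from compactness of the cube of radius r + 1 about x; off it, for z within
    1 of x, both kernels vanish. *)
Lemma near_delta r x e : 0 < r -> 0 < e ->
  \forall z \near x, forall y, `|delta r x y - delta r z y| <= e.
Proof.
move=> r0 e0.
have K : \forall z \near x, cube x (r + 1) `<=` [set y | `|delta r x y - delta r z y| <= e].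
  have /compact_near_coveringP cK := @compact_cube R x (r + 1).
  apply: (cK _ (nbhs x) (fun z y => `|delta r x y - delta r z y| <= e)) => y _.
  have c2 : (delta r x p.1 - delta r p.2 p.1) @[p --> (y, x)] --> (delta r x y - delta r x y : R).
    apply: cvgB.
      by apply: (@cvg_comp _ _ _ (fst : R3 R * R3 R -> R3 R) (delta r x) _ (nbhs y)); [exact: cvg_fst|exact: continuous_delta].
    have -> : (fun p : R3 R * R3 R => delta r p.2 p.1) = (fun p => delta r 0 (p.1 - p.2)).
      by apply/funext => p; exact: delta_translate.
    rewrite delta_translate.
    apply: (@cvg_comp _ _ _ (fun p : R3 R * R3 R => p.1 - p.2) (delta r 0) _ (nbhs (y - x))); last exact: continuous_delta.
    by apply: cvgB; [exact: cvg_fst|exact: cvg_snd].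
  exact: (cvg_subrr_le _ c2 e0).
have N : \forall z \near x, `|z - x| <= 1.
  have : (z - x) @[z --> x] --> (x - x) by apply: cvgB; [exact: cvg_id|exact: cvg_cst].
  rewrite subrr => /cvgrPdist_le/(_ _ ltr01); apply: filterS => z.
  by rewrite sub0r normrN.
near=> z => y.
have zx : `|z - x| <= 1 by near: z.
have [h|h] := pselect (cube x (r + 1) y).
  have : cube x (r + 1) `<=` [set y | `|delta r x y - delta r z y| <= e] by near: z.
  exact.
have h1 : ~ cube x r y by move=> hx; apply: h; move: hx; rewrite /cube /= => /le_trans; apply; lra.
have h2 : ~ cube z r y by move=> hz; apply: h; exact: cube_sub zx _ hz.
by rewrite !delta_far// subrr normr0 ltW.
Unshelve. all: by end_near. Qed.

Lemma continuous_moll (U : M3 R -> R) r : measurable_fun setT U ->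
  mu.-integrable setT (EFin \o U) -> 0 < r -> continuous (moll U r : R3 R -> R).
Proof.
move=> mU iU r0 x; apply/cvgrPdist_le => e e0.
have iN : mu.-integrable setT (fun y => (`|U y|)%:E) by exact: integrable_norm.
have fN := integrable_fin_num measurableT iN.
pose A := fine (\int[mu]_y (`|U y|)%:E).
have A0 : 0 <= A by apply/fine_ge0/integral_ge0 => y _; rewrite lee_fin.
have d0 : 0 < e / (A + 1) by rewrite divr_gt0//; lra.
have := near_delta x r0 d0; apply: filterS => z hz.
rewrite /moll -(RintegralB measurableT (integrable_moll iU x r0) (integrable_moll iU z r0)).
rewrite -lee_fin.
apply: le_trans (Rintegral_ae_bound (A := e / (A + 1)) (W := fun y => `|U y|) measurableT _ _ (ltW d0) _ _) _.
- apply: measurable_funB; apply: measurable_funM => //; exact: measurable_delta_r.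
- exact: measurableT_comp.
- by [].
- apply: aeW => y _; rewrite -mulrBr normrM mulrC; apply: ler_wpM2r => //; exact: hz.
- rewrite -(fineK fN) -/A -EFinM lee_fin -mulrA ler_piMr ?(ltW e0)//.
  by rewrite mulrC ler_pdivrMr; lra.
Qed.
End ContinuousMollification.

(** * The weak solution restricted to a cube, as data for the Gronwall argument *)

Section LocalEstimate.
Context {R : realType}.
Local Notation mu := (@lebesgue3 R).
Local Notation index := ('I_(1 + 3) * bool)%type.
Implicit Types (x y : R3 R) (r : R) (Q D : set (M3 R)).

(** Extension by zero makes the components integrable on the whole space; at points whose cube of
    radius r lies in Q, mollification at scale r does not see the cut ([moll_localize]). *)
Definition localize Q (w : R3 R -> biquat R) (i : index) : M3 R -> R :=
  fun y => component i (w y) * \1_Q y.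

Lemma integrable_localize Q w i : measurable Q -> bq_in (in_Lp 1 Q) w ->
  mu.-integrable setT (EFin \o localize Q w i).
Proof.
move=> mQ wQ; have := integrable_component i mQ wQ.
move=> /(integrable_mkcond _ mQ).1; apply: eq_integrable => // y _.
by rewrite patchE /= /localize indicE; case: ifP => _; rewrite ?mulr1 ?mulr0.
Qed.

Lemma measurable_localize Q w i : measurable Q -> bq_in (in_Lp 1 Q) w ->
  measurable_fun setT (localize Q w i).
Proof. by move=> mQ wQ; apply/measurable_EFinP; exact: measurable_int (integrable_localize i mQ wQ). Qed.

Lemma total_localize Q w y : total (localize Q w) y = \1_Q y * bq_abs1 (w y).
Proof.
rewrite /total bq_abs1_component mulr_sumr; apply: eq_bigr => i _.
by rewrite /localize normrM mulrC (ger0_norm (x := \1_Q y)).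
Qed.

Lemma integral_total_localize Q w D : D `<=` Q ->
  (\int[mu]_(y in D) (total (localize Q w) y)%:E = \int[mu]_(y in D) (bq_abs1 (w y))%:E)%E.
Proof.
move=> DQ; apply: eq_integral => y; rewrite inE => /DQ Qy.
by rewrite total_localize indicE mem_set// mul1r.
Qed.

Lemma mass_localize Q w : measurable Q -> bq_in (in_Lp 1 Q) w ->
  ((mass (localize Q w))%:E = \int[mu]_(y in Q) (bq_abs1 (w y))%:E)%E.
Proof.
move=> mQ wQ; rewrite massE => [|i]; last exact: integrable_localize.
rewrite [RHS]integral_indicM; apply: eq_integral => y _.
by rewrite total_localize.
Qed.

Lemma moll_localize Q w i D r x : 0 < r -> cube x r `<=` D -> D `<=` Q ->
  moll (localize Q w i) r x = Rintegral mu D (fun y => component i (w y) * delta r x y).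
Proof.
move=> r0 xD DQ; rewrite /moll /Rintegral; congr fine.
rewrite [RHS]integral_indicM; apply: eq_integral => y _; congr (_%:E).
rewrite /localize indicE [in RHS]indicE.
have [Dy|Dy] := pselect (D y); first by rewrite !mem_set ?mulr1 ?mul1r//; exact: DQ.
by rewrite delta_far ?mulr0// => /xD.
Qed.

Lemma integrable_component_delta1 D w i r x : 0 < r -> measurable D ->
  bq_in (in_Lp 1 D) w ->
  mu.-integrable D (EFin \o (fun y : M3 R => component i (w y) * delta r x y)).
Proof.
move=> r0 mD wD; have := integrable_moll (integrable_localize i mD wD) x r0.
move=> /(integrableS measurableT mD (@subsetT _ _)).
apply: eq_integrable => // y; rewrite inE => Dy.
by rewrite /localize indicE mem_set// mulr1.
Qed.

(** As [radius k.+1] is half of [radius k], the difference of the two mollifications is exactly the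
    integral bounded in [weak_estimate]. *)
Lemma incr_localize (G : set (R3 R)) (w v : R3 R -> biquat R) (K : R) x0 r0 :
  weak_D G w v -> 0 <= K ->
  {ae leb3 R, forall y, G y -> bq_abs1 (v y) <= K * bq_abs1 (w y)} ->
  0 < r0 -> cube x0 (3 * r0) `<=` G ->
  forall i k x, cube x (radius r0 k) `<=` cube x0 (3 * r0) ->
  `|moll (localize (cube x0 (3 * r0)) w i) (radius r0 k.+1) x -
    moll (localize (cube x0 (3 * r0)) w i) (radius r0 k) x| <=
  incr (localize (cube x0 (3 * r0)) w) r0 (30 * K) k x.
Proof.
move=> wD K0 vw r00 QG i k x xQ; set Q := cube x0 (3 * r0).
have mQ : measurable (Q : set (M3 R)) := measurable_cube _ _.
have wQ : bq_in (in_Lp 1 Q) w by case: wD => wL _ _ j; apply: wL => //; exact: compact_cube.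
set D := cube x (radius r0 k).
have mD : measurable (D : set (M3 R)) := measurable_cube _ _.
have w1 : bq_in (in_Lp 1 D) w.
  by case: wD => wL _ _ j; apply: wL; [exact: compact_cube|exact: subset_trans xQ QG].
have rk := radius_gt0 r00 k; have rk1 := radius_gt0 r00 k.+1.
have D1 : cube x (radius r0 k.+1) `<=` D.
  by move=> y; rewrite /D /cube /= radiusS => /le_trans; apply; lra.
rewrite (moll_localize w i rk1 D1 xQ) (moll_localize w i rk (@subset_refl _ D) xQ).
rewrite -(RintegralB mD (integrable_component_delta1 i x rk1 mD w1) (integrable_component_delta1 i x rk mD w1)).
have -> : Rintegral mu D (fun y => component i (w y) * delta (radius r0 k.+1) x y -
    component i (w y) * delta (radius r0 k) x y) =
  Rintegral mu D (fun y => component i (w y) * delta_diff (radius r0 k) x y).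
  by apply: eq_Rintegral => y _; rewrite -mulrBr radiusS.
rewrite -lee_fin.
apply: le_trans (weak_estimate i wD K0 vw rk (subset_trans xQ QG)) _.
rewrite /incr [leRHS]EFinM cubemassE.
- by rewrite (integral_total_localize w xQ).
- by move=> j; exact: measurable_localize.
- by move=> j; exact: integrable_localize.
Qed.
End LocalEstimate.

(** The intervals of radius b k = 2 L 2^-k about g k are nested, since b k - b (k + 1) = L 2^-k;
    their left ends increase to the limit. *)
Lemma geometric_limit {R : realType} (g : nat -> R) (L : R) :
  (forall k, `|g k.+1 - g k| <= L * 2^-1 ^+ k) ->
  exists2 l, g @ \oo --> l & forall k, `|l - g k| <= 2 * L * 2^-1 ^+ k.
Proof.
move=> h; have L0 : 0 <= L by have := h 0%N; rewrite expr0 mulr1; exact: le_trans.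
pose b k : R := 2 * L * 2^-1 ^+ k.
have bS k : b k.+1 = b k - L * 2^-1 ^+ k by rewrite /b exprS; field.
have b0 k : 0 <= b k by rewrite !mulr_ge0// exprn_ge0.
have up k : g k - b k <= g k.+1 - b k.+1 by have := h k; rewrite bS ler_norml => /andP[]; lra.
have dn k : g k.+1 + b k.+1 <= g k + b k by have := h k; rewrite bS ler_norml => /andP[]; lra.
have nd : nondecreasing_seq (fun k => g k - b k) by apply/nondecreasing_seqP.
have ni : nonincreasing_seq (fun k => g k + b k) by apply/nonincreasing_seqP.
have ub j k : g j - b j <= g k + b k.
  have [jk|/ltnW kj] := leqP j k.
    by apply: le_trans (nd _ _ jk) _; have := b0 k; lra.
  by apply: le_trans (ni _ _ kj); have := b0 j; lra.
have cv : cvgn (fun k => g k - b k).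
  by apply: nondecreasing_is_cvgn => //; exists (g 0%N + b 0%N) => _ [k _ <-].
set l := limn (fun k => g k - b k).
have d k : `|l - g k| <= b k.
  rewrite ler_norml; apply/andP; split.
    by have := nondecreasing_cvgn_le nd cv k; rewrite -/l; lra.
  have : l <= g k + b k by apply: limr_le => //; apply: nearW => j; exact: ub.
  lra.
exists l => //; apply/cvgrPdist_le => e e0.
have : b k @[k --> \oo] --> (2 * L * 0).
  by apply: cvgM; [exact: cvg_cst|apply: cvg_expr; rewrite ger0_norm; lra].
rewrite mulr0 => /cvgrPdist_le/(_ _ e0); apply: filterS => k.
by rewrite sub0r normrN (ger0_norm (b0 k)); exact: le_trans.
Qed.

Lemma cvg_addn_seq {R : realType} (g : nat -> R) (m : nat) (l : R) :
  g (m + k)%N @[k --> \oo] --> l -> g @ \oo --> l.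
Proof.
move=> h; rewrite -(cvg_shiftn m) (_ : [sequence g (n + m)%N]_n = (fun k => g (m + k)%N))//.
by apply/funext => k; rewrite addnC.
Qed.

Lemma cvg_mulIf {R : realType} (g : nat -> R) (c a b : R) : 0 < c ->
  g @ \oo --> c * a -> g @ \oo --> c * b -> a = b.
Proof.
move=> c0 ga gb; apply: (@mulfI _ c); first by rewrite gt_eqF.
by rewrite -(cvg_lim (@norm_hausdorff _ _) ga); exact: cvg_lim.
Qed.

Lemma continuous_uniform_limit {R : realType} {T : topologicalType} (f : T -> R) (x0 : T) :
  (forall e, 0 < e -> exists2 g : T -> R, {for x0, continuous g} &
     \forall x \near x0, `|f x - g x| <= e) -> {for x0, continuous f}.
Proof.
move=> h; apply/cvgrPdist_le => e e0; have e3 : 0 < e / 3 by rewrite divr_gt0.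
have [g /cvgrPdist_le/(_ _ e3) cg fg] := h _ e3.
have f0 := nbhs_singleton fg.
apply: filterS2 cg fg => x h1 h2.
have -> : f x0 - f x = (f x0 - g x0) + (g x0 - g x) - (f x - g x) by ring.
apply: le_trans (ler_normB _ _) _.
have := ler_normD (f x0 - g x0) (g x0 - g x); lra.
Qed.

(** * The continuous representative as a limit of mollifications *)

Section Representative.
Context {R : realType}.
Local Notation mu := (@lebesgue3 R).
Local Notation index := ('I_(1 + 3) * bool)%type.
Implicit Types (x y : R3 R) (r : R).

Context (c : R) (c0 : 0 < c)
  (cE : forall r y, 0 < r -> (\int[mu]_x (delta r x y)%:E = c%:E)%E).
Context (M : R) (M0 : 0 < M)
  (hM : forall r x y, 0 < r -> delta r x y <= M * r ^- 3).
Context (G : set (R3 R)) (w v : R3 R -> biquat R) (K : R)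
  (wD : weak_D G w v) (K0 : 0 <= K)
  (vw : {ae leb3 R, forall y, G y -> bq_abs1 (v y) <= K * bq_abs1 (w y)}).

(** Integrating over all of G at the absolute scales 2^-n involves no auxiliary cube, so the limits
    found near different points agree by construction. *)
Definition approx (i : index) n x : R :=
  Rintegral (leb3 R) G (fun y => component i (w y) * delta (2^-1 ^+ n) x y).

Definition value i x : R := limn (approx i ^~ x) / c.

(** The bound of [moll_le] for r0 = 2^-m and C = 30 K, divided by the mass. It depends neither on
    the point nor on w. *)
Definition bound_factor m : R :=
  M * (2^-1 ^+ m) ^- 3 + 60 * K * 2^-1 ^+ m *
  ((2^-1 ^+ m) ^- 3 * (1 + 8 * #|{: index}|%:R * M / c) *
   expR (72 * #|{: index}|%:R * (30 * K) / c * (2 * 2^-1 ^+ m))).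

Lemma bound_factor_ge0 m : 0 <= bound_factor m.
Proof.
have p : 0 < 2^-1 ^+ m :> R by rewrite exprn_gt0.
have q : 0 <= (2^-1 ^+ m) ^- 3 :> R by rewrite invr_ge0 exprn_ge0// ltW.
rewrite addr_ge0//; first by rewrite mulr_ge0// ltW.
apply: mulr_ge0; first by rewrite !mulr_ge0// ltW.
rewrite mulr_ge0 ?expR_ge0// mulr_ge0// addr_ge0// divr_ge0 ?(ltW c0)// !mulr_ge0 ?ler0n//.
exact: ltW.
Qed.

Section Cube.
Context (x0 : R3 R) (m : nat).
Local Notation r0 := (2^-1 ^+ m : R).
Local Notation Q := (cube x0 (3 * r0) : set (M3 R)).
Context (QG : Q `<=` G).

Let r00 : 0 < r0. Proof. by rewrite exprn_gt0. Qed.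
Let mQ : measurable Q := measurable_cube x0 (3 * r0).
Let wQ : bq_in (in_Lp 1 Q) w.
Proof. by case: wD => wL _ _ j; apply: wL => //; exact: compact_cube. Qed.
Let mU i : measurable_fun setT (localize Q w i) := measurable_localize i mQ wQ.
Let iU i : mu.-integrable setT (EFin \o localize Q w i) := integrable_localize i mQ wQ.
Let C0 : 0 <= 30 * K. Proof. exact: mulr_ge0. Qed.
Let hincr := incr_localize wD K0 vw r00 QG.

Lemma approx_moll i k x : cube x0 r0 x ->
  approx i (m + k) x = moll (localize Q w i) (radius r0 k) x.
Proof.
move=> hx; have sub := cube_radius1 r00 (k := k) hx.
have rk := radius_gt0 r00 k.
rewrite (moll_localize w i rk sub (@subset_refl _ Q)) /approx exprD -/(radius r0 k).
by apply: Rintegral_support QG _ => y Qy; rewrite delta_far ?mulr0// => /sub.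
Qed.

Lemma approx_step : exists2 L, 0 <= L & forall i k x, cube x0 r0 x ->
  `|approx i (m + k.+1) x - approx i (m + k) x| <= L * 2^-1 ^+ k.
Proof.
(* This is [moll_step], with [radius r0 k] split into r0 and 2^-k. *)
exists (30 * K * peak c M (localize Q w) r0 (30 * K) * r0).
  by apply: mulr_ge0; [apply: mulr_ge0 => //; exact: peak_ge0|exact: ltW].
move=> i k x hx; rewrite !approx_moll//.
by have := moll_step c0 cE M0 hM mU iU r00 C0 hincr i k hx; rewrite {2}/radius mulrA.
Qed.

Lemma approx_le i k x : cube x0 r0 x ->
  `|approx i (m + k) x| <= bound_factor m * mass (localize Q w).
Proof.
move=> hx; rewrite approx_moll//.
apply: le_trans (moll_le c0 cE M0 hM mU iU r00 C0 hincr i k hx) _.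
rewrite /bound_factor /peak /seed /growth le_eqVlt; apply/orP; left; apply/eqP; ring.
Qed.

Lemma near_cube : \forall x \near x0, cube x0 r0 x.
Proof.
have : (y - x0) @[y --> x0] --> (x0 - x0) by apply: cvgB; [exact: cvg_id|exact: cvg_cst].
rewrite subrr => /cvgrPdist_le/(_ _ r00); apply: filterS => y.
by rewrite sub0r normrN.
Qed.

Lemma approx_continuous i k : {for x0, continuous (approx i (m + k))}.
Proof.
have rk := radius_gt0 r00 k.
have near : {near x0, moll (localize Q w i) (radius r0 k) =1 approx i (m + k)}.
  by apply: filterS near_cube => y hy; rewrite approx_moll.
have x00 : cube x0 r0 x0 by rewrite /cube /= subrr normr0 ltW.
rewrite /prop_for /continuous_at approx_moll//.
apply: cvg_trans (continuous_moll (mU i) (iU i) rk (x := x0)).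
exact: near_eq_cvg.
Qed.

Lemma ae_approx i : {ae mu, forall x, cube x0 r0 x ->
  approx i n x @[n --> \oo] --> c * component i (w x)}.
Proof.
have := ae_moll_cvg c0 cE M0 hM mU iU r00 C0 hincr i.
apply: filterS => x h hx; have := h hx.
have Qx : Q x by move: hx; rewrite /cube /= => /le_trans; apply; have := r00; lra.
rewrite /localize indicE mem_set// mulr1 => l.
apply: (@cvg_addn_seq _ (approx i ^~ x) m).
have -> : (fun k => approx i (m + k) x) = (fun k => moll (localize Q w i) (radius r0 k) x).
  by apply/funext => k; exact: approx_moll.
exact: l.
Qed.
Lemma value_limit : exists2 L, 0 <= L & forall i x, cube x0 r0 x ->
  approx i n x @[n --> \oo] --> c * value i x /\
  forall k, `|c * value i x - approx i (m + k) x| <= 2 * L * 2^-1 ^+ k.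
Proof.
have [L L0 hL] := approx_step; exists L => // i x hx.
have [l gl hl] := geometric_limit (fun k => hL i k x hx).
have al : approx i n x @[n --> \oo] --> l.
  exact: (@cvg_addn_seq _ (approx i ^~ x) m).
have -> : c * value i x = l by rewrite /value (cvg_lim _ al)//; field; rewrite gt_eqF.
by split.
Qed.

Lemma value_le i : `|c * value i x0| <= bound_factor m * mass (localize Q w).
Proof.
have [L _ hL] := value_limit.
have x00 : cube x0 r0 x0 by rewrite /cube /= subrr normr0 ltW.
have [_ h] := hL i x0 x00.
apply/ler_addgt0Pr => e e0.
have : 2 * L * 2^-1 ^+ k @[k --> \oo] --> (2 * L * 0).
  by apply: cvgM; [exact: cvg_cst|apply: cvg_expr; rewrite ger0_norm; lra].
rewrite mulr0 => /cvgrPdist_le/(_ _ e0) [k _ /(_ k (leqnn k))] /=.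
rewrite sub0r normrN => hk.
have -> : c * value i x0 = approx i (m + k) x0 + (c * value i x0 - approx i (m + k) x0) by ring.
apply: le_trans (ler_normD _ _) (lerD (approx_le i k x00) _).
exact: le_trans (h k) (le_trans (ler_norm _) hk).
Qed.

Lemma value_continuous i : {for x0, continuous (value i)}.
Proof.
have [L _ hL] := value_limit.
have x00 : cube x0 r0 x0 by rewrite /cube /= subrr normr0 ltW.
have cont : {for x0, continuous (fun x => c * value i x)}.
  apply: continuous_uniform_limit => e e0.
  have : 2 * L * 2^-1 ^+ k @[k --> \oo] --> (2 * L * 0).
    by apply: cvgM; [exact: cvg_cst|apply: cvg_expr; rewrite ger0_norm; lra].
  rewrite mulr0 => /cvgrPdist_le/(_ _ e0) [k _ /(_ k (leqnn k))] /=.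
  rewrite sub0r normrN => /(le_trans (ler_norm _)) hk.
  exists (approx i (m + k)); first exact: approx_continuous.
  apply: filterS near_cube => x hx; exact: le_trans ((hL i x hx).2 k) hk.
have -> : value i = (fun x => c^-1 * (c * value i x)).
  by apply/funext => x; field; rewrite gt_eqF.
by apply: cvgM; [exact: cvg_cst|exact: cont].
Qed.

Lemma ae_value i : {ae mu, forall x, cube x0 r0 x -> component i (w x) = value i x}.
Proof.
have [L _ hL] := value_limit.
have := ae_approx i; apply: filterS => x h hx.
exact: cvg_mulIf c0 (h hx) (hL i x hx).1.
Qed.
End Cube.
End Representative.

(** * Countable covers of open sets by cubes, and uniform cubes on compact sets *)

Section CubeCover.
Context {R : realType}.
Implicit Types (x y : R3 R) (G : set (R3 R)).

Lemma near_cube_sub G x : open G -> G x ->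
  \forall m \near \oo, \forall y \near x, cube y (3 * 2^-1 ^+ m) `<=` G.
Proof.
move=> oG Gx; have /nbhs_ballP[e /= e0 eG] : nbhs x G by exact: open_nbhs_nbhs.
have : (3 * 2^-1 ^+ m : R) @[m --> \oo] --> (3 * 0 : R).
  by apply: cvgM; [exact: cvg_cst|apply: cvg_expr; rewrite ger0_norm; lra].
have e4 : 0 < e / 4 by rewrite divr_gt0.
rewrite mulr0 => /cvgrPdist_le/(_ _ e4); apply: filterS => m.
rewrite sub0r normrN => /(le_trans (ler_norm _)) hm.
have : nbhs x (ball x (e / 4)) by exact: nbhsx_ballx.
apply: filterS => y xy z yz; apply: eG.
move: xy; rewrite -!ball_normE /ball_ /= => xy.
apply: le_lt_trans (ler_distD y x z) _; rewrite (distrC y z); rewrite /cube /= in yz; lra.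
Qed.

(** Rational centres and dyadic radii keep the cover countable: exceptional sets can be united, and
    open sets are countable unions of cubes. *)
Definition grid := (rat * rat * rat * nat)%type.
Definition grid_point (g : grid) : R3 R := (ratr g.1.1.1, ratr g.1.1.2, ratr g.1.2).
Definition grid_cube G (g : grid) : set (R3 R) :=
  [set x | cube (grid_point g) (3 * 2^-1 ^+ g.2) `<=` G /\ cube (grid_point g) (2^-1 ^+ g.2) x].

Lemma grid_cover G x : open G -> G x -> exists g, grid_cube G g x.
Proof.
move=> oG Gx; have [m _ /(_ m (leqnn m)) /=] := near_cube_sub oG Gx.
(* One more halving leaves room to recentre at a rational point: 3/2 + 1/2 <= 3 in units of 2^-m. *)
move=> /nbhs_singleton hm; have p : 0 < 2^-1 ^+ m.+1 :> R by rewrite exprn_gt0.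
have near (a : R) : exists q : rat, `|a - ratr q| <= 2^-1 ^+ m.+1.
  have lt : a - 2^-1 ^+ m.+1 < a + 2^-1 ^+ m.+1 by lra.
  have [q] := rat_in_itvoo lt; rewrite in_itv /= => /andP[h1 h2]; exists q.
  by rewrite ler_norml; apply/andP; split; lra.
have [q1 h1] := near x.1.1; have [q2 h2] := near x.1.2; have [q3 h3] := near x.2.
exists (q1, q2, q3, m.+1); have xq : cube (grid_point (q1, q2, q3, m.+1)) (2^-1 ^+ m.+1) x.
  by rewrite /cube /=; apply/norm3_le.
split=> //; apply: subset_trans hm => z hz.
rewrite /cube /= in xq hz *.
apply: le_trans (ler_distD (grid_point (q1, q2, q3, m.+1)) z x) _.
rewrite (distrC _ x); move: xq hz p; rewrite exprS; lra.
Qed.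

Lemma grid_coverE G : open G -> G = \bigcup_n [set x | exists2 g, unpickle n = Some g & grid_cube G g x].
Proof.
move=> oG; apply/seteqP; split=> [x /(grid_cover oG)[g hg]|x [n _ [g _ [gG xg]]]].
  by exists (pickle g) => //; exists g => //; rewrite pickleK.
apply: gG; move: xg; rewrite /cube /= => /le_trans; apply.
have : 0 < 2^-1 ^+ g.2 :> R by rewrite exprn_gt0.
lra.
Qed.

Lemma measurable_open3 G : open G -> measurable (G : set (M3 R)).
Proof.
move=> oG; rewrite (grid_coverE oG); apply: bigcup_measurable => n _.
case: (unpickle n : option grid) => [g|]; last first.
  by rewrite (_ : [set _ | _] = set0) //; apply/seteqP; split=> x //= [].
have [gG|gG] := pselect (cube (grid_point g) (3 * 2^-1 ^+ g.2) `<=` G).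
  rewrite (_ : [set _ | _] = cube (grid_point g) (2^-1 ^+ g.2)); first exact: measurable_cube.
  by apply/seteqP; split=> [x /= [_ [<-] []]|x hx] //=; exists g.
by rewrite (_ : [set _ | _] = set0) //; apply/seteqP; split=> x //= [_ [<-] []].
Qed.

(** Near each point of K one m works and larger ones do too, so compactness in near-covering form
    yields a common m. *)
Lemma compact_cube_sub G (K : set (R3 R)) : open G -> compact K -> K `<=` G ->
  exists m, forall x, K x -> cube x (3 * 2^-1 ^+ m) `<=` G.
Proof.
move=> oG /compact_near_coveringP cK KG.
have : \forall m \near \oo, K `<=` [set x | cube x (3 * 2^-1 ^+ m) `<=` G].
  apply: (cK _ \oo (fun m x => cube x (3 * 2^-1 ^+ m) `<=` G)) => x /KG Gx.
  have e2 : \forall y \near x, \forall m \near \oo, cube y (3 * 2^-1 ^+ m) `<=` G.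
    have [m0 _ h] := near_cube_sub oG Gx.
    have := h m0 (leqnn m0); apply: filterS => y hy; exists m0 => // m /= m0m.
    apply: subset_trans hy => z; rewrite /cube /= => /le_trans; apply.
    by rewrite ler_pM2l//; apply: ler_wiXn2l => //; lra.
  have [m0 _ h] := near_cube_sub oG Gx.
  exists ([set y | cube y (3 * 2^-1 ^+ m0) `<=` G], [set m | (m0 <= m)%N]).
    by split; [exact: h m0 (leqnn m0)|exists m0].
  move=> [y m] [/= hy m0m]; apply: subset_trans hy => z; rewrite /cube /= => /le_trans; apply.
  by rewrite ler_pM2l//; apply: ler_wiXn2l => //; lra.
by move=> [m _ /(_ m (leqnn m)) h]; exists m.
Qed.
End CubeCover.

(** * Comparison of norms, and of L_1 with L_p on cubes *)

Section NormEstimates.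
Context {R : realType}.
Local Notation mu := (@lebesgue3 R).
Implicit Types (p q : biquat R) (x y : R3 R).

Lemma bq_normE q : bq_norm q = Num.sqrt (\sum_c component c q ^+ 2).
Proof.
rewrite /bq_norm -(pair_bigA _ (fun j b => component (j, b) q ^+ 2)) /=; congr Num.sqrt.
apply: eq_bigr => j _; rewrite big_bool /component /=.
by case: (q 0 j) => a b /=; rewrite sqr_sqrtr// addr_ge0 ?sqr_ge0.
Qed.

Lemma bq_norm_ge0 q : 0 <= bq_norm q.
Proof. exact: sqrtr_ge0. Qed.

Lemma card_index : #|{: 'I_(1 + 3) * bool}| = 8%N.
Proof. by rewrite card_prod card_ord card_bool. Qed.

Lemma bq_abs1_norm q : bq_abs1 q <= 8 * bq_norm q.
Proof.
rewrite bq_abs1_component bq_normE.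
have h c : `|component c q| <= Num.sqrt (\sum_c component c q ^+ 2).
  rewrite -sqrtr_sqr ler_wsqrtr// (bigD1 c)//= lerDl.
  by apply: sumr_ge0 => i _; exact: sqr_ge0.
apply: le_trans (ler_sum _ (fun c _ => h c)) _.
by rewrite sumr_const card_index mulr_natl.
Qed.

Lemma bq_norm_le q (B : R) : 0 <= B -> (forall c, `|component c q| <= B) -> bq_norm q <= 8 * B.
Proof.
move=> B0 h; rewrite bq_normE.
have B8 : 0 <= 8 * B by rewrite mulr_ge0.
rewrite -[leRHS](ger0_norm B8) -sqrtr_sqr ler_wsqrtr//.
apply: le_trans (_ : \sum_(c : 'I_(1 + 3) * bool) B ^+ 2 <= _).
  by apply: ler_sum => c _; rewrite -real_normK ?num_real// lerXn2r// nnegrE.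
rewrite sumr_const card_index -[leLHS]mulr_natl exprMn; apply: ler_wpM2r; first exact: sqr_ge0.
by rewrite -natrX ler_nat.
Qed.

Lemma measurable_bq_norm (D : set (M3 R)) (w : M3 R -> biquat R) : bq_meas D w ->
  measurable_fun D (fun y => bq_norm (w y)).
Proof.
move=> mw; have -> : (fun y => bq_norm (w y)) = (fun y => Num.sqrt (\sum_c component c (w y) ^+ 2)).
  by apply/funext => y; exact: bq_normE.
have ms : measurable_fun setT (Num.sqrt : R -> R) := continuous_measurable_fun (@sqrt_continuous R).
have mf : measurable_fun D (fun y : M3 R => \sum_c component c (w y) ^+ 2).
  by apply: measurable_sum => c; apply: measurable_funX; exact: measurable_component.
exact: (measurableT_comp ms mf).
Qed.

(** Either W <= lam, or (W / lam)^(p - 1) >= 1. Integrated with lam close to the L_p norm, this does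
    the work of the Hoelder inequality. *)
Lemma le_powR_split (p W lam : R) : 1 <= p -> 0 < lam -> 0 <= W ->
  W <= lam + lam `^ (1 - p) * W `^ p.
Proof.
move=> p1 l0 W0; have h0 : 0 <= lam `^ (1 - p) * W `^ p by rewrite mulr_ge0 ?powR_ge0.
have [Wl|lW] := leP W lam; first lra.
have Wp : 0 < W by exact: lt_trans lW.
apply: le_trans (_ : lam `^ (1 - p) * W `^ p <= _); last lra.
have -> : W `^ p = W `^ (p - 1) * W.
  by rewrite -{3}(powRr1 W0) -powRD ?subrK// (gt_eqF Wp) implybT.
rewrite -opprB powRN mulrA; apply: ler_peMl => //.
rewrite mulrC ler_pdivlMr ?powR_gt0// mul1r.
apply: ge0_ler_powR; rewrite ?nnegrE ?subr_ge0// ltW//.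
Qed.

Lemma integral_bq_norm_le (p : R) (G Q : set (M3 R)) (w : R3 R -> biquat R) (V : R) : 1 <= p ->
  measurable G -> measurable Q -> Q `<=` G -> mu Q = V%:E -> bq_meas G w ->
  (\int[mu]_(y in Q) (bq_norm (w y))%:E <= (V + 1)%:E * Lp_norm p G w)%E.
Proof.
move=> p1 mG mQ QG QV mw; have p0 : 0 < p by exact: lt_le_trans p1.
have V0 : 0 <= V by rewrite -lee_fin -QV.
have mn : measurable_fun G (fun y : M3 R => bq_norm (w y)) := measurable_bq_norm mw.
have mp : measurable_fun G (fun y : M3 R => bq_norm (w y) `^ p).
  exact: (measurableT_comp (measurable_powR p) mn).
rewrite /Lp_norm -[X in poweR X _]/(\int[mu]_(y in G) (bq_norm (w y) `^ p)%:E)%E.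
set I := (\int[mu]_(y in G) (bq_norm (w y) `^ p)%:E)%E.
have I0 : (0 <= I)%E by apply: integral_ge0 => y _; rewrite lee_fin powR_ge0.
have pi : p^-1 != 0 by rewrite invr_neq0// gt_eqF.
(* If the L_p norm is infinite, so is the right-hand side, because V + 1 > 0. *)
have [If|] := boolP (I \is a fin_num); last first.
  rewrite ge0_fin_numE// -leNgt leye_eq => /eqP ->.
  rewrite poweRyr// gt0_muley ?leey// lte_fin; lra.
have iE : I = (fine I)%:E by rewrite fineK.
have i0 : 0 <= fine I by exact: fine_ge0.
rewrite iE poweR_EFin -EFinM; set n := fine I `^ p^-1.
have n0 : 0 <= n by exact: powR_ge0.
have nE : fine I = n `^ p by rewrite /n -powRrM mulVf ?gt_eqF// powRr1.
(* The first term of the splitting gives lam V; the second at most lam^(1 - p) n^p <= lam. *)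
have key lam : 0 < lam -> n <= lam -> (\int[mu]_(y in Q) (bq_norm (w y))%:E <= (lam * (V + 1))%:E)%E.
  move=> l0 nl.
  apply: le_trans (_ : \int[mu]_(y in Q) (lam%:E + (lam `^ (1 - p))%:E * (bq_norm (w y) `^ p)%:E) <= _)%E.
    apply: ge0_le_integral => //.
    - by move=> y _; rewrite lee_fin bq_norm_ge0.
    - by apply/measurable_EFinP; exact: measurable_funS mn.
    - apply: emeasurable_funD; first exact: measurable_cst.
      apply: emeasurable_funM; first exact: measurable_cst.
      by apply/measurable_EFinP; exact: measurable_funS mp.
    - by move=> y _; rewrite -EFinM -EFinD lee_fin le_powR_split ?bq_norm_ge0.
  rewrite ge0_integralD//; last 3 first.
  - by move=> y _; rewrite lee_fin ltW.
  - by move=> y _; rewrite -EFinM lee_fin mulr_ge0 ?powR_ge0.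
  - apply: emeasurable_funM; first exact: measurable_cst.
    by apply/measurable_EFinP; exact: measurable_funS mp.
  have -> : (\int[mu]_(_ in Q) lam%:E = (lam * V)%:E)%E.
    by rewrite integral_cst// EFinM; congr (_ * _)%E.
  rewrite ge0_integralZl_EFin//; last 3 first.
  - by move=> y _; rewrite lee_fin powR_ge0.
  - by apply/measurable_EFinP; exact: measurable_funS mp.
  - exact: powR_ge0.
  have sub : (\int[mu]_(y in Q) (bq_norm (w y) `^ p)%:E <= I)%E.
    apply: ge0_subset_integral => //; first exact/measurable_EFinP.
    by move=> y _; rewrite lee_fin powR_ge0.
  apply: le_trans (leeD (lexx _) (lee_wpmul2l _ sub)) _; first by rewrite lee_fin powR_ge0.
  rewrite iE -!EFinM -EFinD lee_fin nE mulrDr mulr1 lerD2l.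
  apply: le_trans (_ : lam `^ (1 - p) * lam `^ p <= _).
    apply: ler_wpM2l; first exact: powR_ge0.
    by apply: ge0_ler_powR; rewrite ?nnegrE// ltW.
  by rewrite -powRD ?subrK ?powRr1 ?(ltW l0)// (gt_eqF l0) implybT.
(* The splitting wants lam > 0 while n may be 0, so lam exceeds n by e / (V + 1). *)
apply/lee_addgt0Pr => e e0.
have V1 : 0 < V + 1 by lra.
have l0 : 0 < n + e / (V + 1) by rewrite ltr_wpDl// divr_gt0.
apply: le_trans (key _ l0 _) _; first by rewrite lerDl divr_ge0 ?(ltW e0)// ltW.
rewrite -EFinD lee_fin mulrDl divfK ?gt_eqF// mulrC; lra.
Qed.
End NormEstimates.

(** * Bounded coefficients, gluing of the representative, and the interior estimate *)

Section Conclusion.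
Context {R : realType}.
Local Open Scope complex_scope.
Local Notation mu := (@lebesgue3 R).
Local Notation index := ('I_(1 + 3) * bool)%type.
Implicit Types (x y : R3 R) (G : set (R3 R)).

Lemma in_Linfty_abs1 G (a : R3 R -> biquat R) : bq_in (in_Linfty G) a ->
  exists2 B : R, 0 <= B & {ae leb3 R, forall y, G y -> bq_abs1 (a y) <= B}.
Proof.
move=> ha; have H j := (ha j).2.
have [B0 h0] := H 0; have [B1 h1] := H 1; have [B2 h2] := H 2%:R; have [B3 h3] := H 3%:R.
exists (2 * (`|B0| + `|B1| + `|B2| + `|B3|)); first by rewrite mulr_ge0// !addr_ge0.
have h01 : {ae leb3 R, forall y, (G y -> Normc.normc (a y 0 0) <= B0) /\ (G y -> Normc.normc (a y 0 1) <= B1)}.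
  by apply: filterS2 h0 h1 => y.
have h23 : {ae leb3 R, forall y, (G y -> Normc.normc (a y 0 2%:R) <= B2) /\ (G y -> Normc.normc (a y 0 3%:R) <= B3)}.
  by apply: filterS2 h2 h3 => y.
apply: filterS2 h01 h23 => y [e0 e1] [e2 e3] Gy.
have l j B : Normc.normc (a y 0 j) <= B -> abs1 (a y 0 j) <= 2 * `|B|.
  by move=> h; have := abs1_normc (a y 0 j); have := ler_norm B; lra.
rewrite bq_abs1E !big_ord_recl big_ord0.
have := l _ _ (e0 Gy); have := l _ _ (e1 Gy); have := l _ _ (e2 Gy); have := l _ _ (e3 Gy).
have E1 : lift ord0 ord0 = 1 :> 'I_(1 + 3) by exact/val_inj.
have E2 : lift ord0 (lift ord0 ord0) = 2%:R :> 'I_(1 + 3) by exact/val_inj.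
have E3 : lift ord0 (lift ord0 (lift ord0 ord0)) = 3%:R :> 'I_(1 + 3) by exact/val_inj.
rewrite E3 E2 E1 (_ : ord0 = 0 :> 'I_(1 + 3))//.
lra.
Qed.

Lemma Q_op_bound G (a1 a2 a3 a4 : R3 R -> biquat R) :
  bq_in (in_Linfty G) a1 -> bq_in (in_Linfty G) a2 ->
  bq_in (in_Linfty G) a3 -> bq_in (in_Linfty G) a4 ->
  exists2 K : R, 0 <= K & forall w,
    {ae leb3 R, forall y, G y -> bq_abs1 (Q_op a1 a2 a3 a4 w y) <= K * bq_abs1 (w y)}.
Proof.
move=> /in_Linfty_abs1[B1 p1 h1] /in_Linfty_abs1[B2 p2 h2].
move=> /in_Linfty_abs1[B3 p3 h3] /in_Linfty_abs1[B4 p4 h4].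
exists (4 * (B1 + B2 + B3 + B4)); first by rewrite mulr_ge0// !addr_ge0.
move=> w.
have h12 : {ae leb3 R, forall y, G y -> bq_abs1 (a1 y) <= B1 /\ bq_abs1 (a2 y) <= B2}.
  by apply: filterS2 h1 h2 => y e1 e2 Gy; split; [exact: e1|exact: e2].
have h34 : {ae leb3 R, forall y, G y -> bq_abs1 (a3 y) <= B3 /\ bq_abs1 (a4 y) <= B4}.
  by apply: filterS2 h3 h4 => y e1 e2 Gy; split; [exact: e1|exact: e2].
apply: filterS2 h12 h34 => y h12y h34y Gy.
have [e1 e2] := h12y Gy; have [e3 e4] := h34y Gy.
have W0 := bq_abs1_ge0 (w y).
have l (q : biquat R) B : bq_abs1 q <= B -> bq_abs1 (w y) * bq_abs1 q <= B * bq_abs1 (w y).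
  by move=> h; rewrite mulrC; exact: ler_wpM2r.
have i1 := bq_abs1M (w y) (a1 y); have i2 := bq_abs1M (bq_conj (w y)) (a2 y).
have i3 := bq_abs1M (a3 y) (w y); have i4 := bq_abs1M (a4 y) (bq_conj (w y)).
rewrite bq_abs1_conj in i2; rewrite bq_abs1_conj [_ * bq_abs1 (w y)]mulrC in i4.
rewrite [_ * bq_abs1 (w y)]mulrC in i3.
have j1 := l _ _ e1; have j2 := l _ _ e2; have j3 := l _ _ e3; have j4 := l _ _ e4.
rewrite /Q_op; apply: le_trans (bq_abs1D _ _) _.
have d1 := bq_abs1D (bq_mul (w y) (a1 y) + bq_mul (bq_conj (w y)) (a2 y)) (bq_mul (a3 y) (w y)).
have d2 := bq_abs1D (bq_mul (w y) (a1 y)) (bq_mul (bq_conj (w y)) (a2 y)).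
set W := bq_abs1 (w y) in W0 i1 i2 i3 i4 j1 j2 j3 j4 *.
have -> : 4 * (B1 + B2 + B3 + B4) * W = 4 * (B1 * W) + 4 * (B2 * W) + 4 * (B3 * W) + 4 * (B4 * W) by ring.
lra.
Qed.

Definition of_components (f : index -> R) : biquat R :=
  \row_j (f (j, true) +i* f (j, false)).

Lemma component_of_components c f : component c (of_components f) = f c.
Proof. by case: c => j []; rewrite /component mxE. Qed.

Lemma component_inj (p q : biquat R) : (forall c, component c p = component c q) -> p = q.
Proof.
move=> h; apply/rowP => j; have := h (j, true); have := h (j, false); rewrite /component /=.
by case: (p 0 j) (q 0 j) => [a b] [a' b'] /= -> ->.
Qed.

Lemma continuous_on_open G (f : R3 R -> R) : open G ->
  (forall x, G x -> {for x, continuous f}) -> {within G, continuous f}.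
Proof. by move=> oG h; rewrite continuous_open_subspace// => x /set_mem; exact: h. Qed.

Lemma representative_continuous G (w v : R3 R -> biquat R) (K c M : R) :
  open G -> 0 < c ->
  (forall r y, 0 < r -> (\int[mu]_x (delta r x y)%:E = c%:E)%E) ->
  0 < M -> (forall r x y, 0 < r -> delta r x y <= M * r ^- 3) ->
  weak_D G w v -> 0 <= K ->
  {ae leb3 R, forall y, G y -> bq_abs1 (v y) <= K * bq_abs1 (w y)} ->
  continuous_representative G w (fun x => of_components (fun i => value c G w i x)).
Proof.
move=> oG c0 cE M0 hM wD K0 vw; split.
  have cont i : {within G, continuous (value c G w i)}.
    apply: continuous_on_open => // x Gx.
    have [m _ /(_ m (leqnn m)) /= /nbhs_singleton QG] := near_cube_sub oG Gx.
    exact: (value_continuous c0 cE M0 hM wD K0 vw QG).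
  move=> j; split.
    have -> : (fun x => complex.Re (of_components (fun i => value c G w i x) 0 j)) = value c G w (j, true).
      by apply/funext => x; rewrite mxE.
    exact: cont.
  have -> : (fun x => complex.Im (of_components (fun i => value c G w i x) 0 j)) = value c G w (j, false).
    by apply/funext => x; rewrite mxE.
  exact: cont.
(* One exceptional set per code of a grid cube; codes of no cube, or of a cube too close to the
   boundary, give an empty condition. *)
have h n : {ae mu, forall x, (exists2 g, unpickle n = Some g & grid_cube G g x) ->
    forall i, component i (w x) = value c G w i x}.
  case: (unpickle n : option grid) => [g|]; last by apply: aeW => x [].
  have [gG|gG] := pselect (cube (grid_point g : R3 R) (3 * 2^-1 ^+ g.2) `<=` G); last first.
    by apply: aeW => x [_ [<-] []].
  have H (i : index) := ae_value c0 cE M0 hM wD K0 vw gG i.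
  (* The eight components are also run through by their codes, to merge their exceptional sets by
     [ae_foralln]. *)
  have : {ae mu, forall x, forall n, forall i, unpickle n = Some i ->
     cube (grid_point g) (2^-1 ^+ g.2) x -> component i (w x) = value c G w i x}.
    apply: ae_foralln => k; case: (unpickle k : option index) => [i|]; last by apply: aeW.
    by apply: filterS (H i) => x hx _ [<-].
  by apply: filterS => x hx [_ [<-] [_ xg]] i; apply: (hx (pickle i)); rewrite ?pickleK.
have := ae_foralln h; apply: filterS => x hx Gx.
have [g xg] := grid_cover oG Gx.
apply: component_inj => i; rewrite component_of_components.
by apply: (hx (pickle g)); exists g; rewrite ?pickleK.
Qed.

(** The constant is fixed before w: the size m of the cubes comes from K and G, and the coefficients
    enter through the bound B alone. *)
Lemma interior_estimate (G : set (R3 R)) (p : R) (a1 a2 a3 a4 : R3 R -> biquat R) (K : set (R3 R)) :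
  open G -> 1 <= p ->
  bq_in (in_Linfty G) a1 -> bq_in (in_Linfty G) a2 ->
  bq_in (in_Linfty G) a3 -> bq_in (in_Linfty G) a4 ->
  compact K -> K `<=` G ->
  exists2 C : R, 0 < C &
    forall w : R3 R -> biquat R, weak_solution p G a1 a2 a3 a4 w ->
      exists2 w' : R3 R -> biquat R, continuous_representative G w w' &
        forall x, K x -> ((bq_norm (w' x))%:E <= C%:E * Lp_norm p G w)%E.
Proof.
move=> oG p1 A1 A2 A3 A4 cK KG.
have [B B0 hB] := Q_op_bound A1 A2 A3 A4.
have [c c0 cE] := @delta_mass R; have [M M0 hM] := @delta_bounded R.
have [m hm] := compact_cube_sub oG cK KG.
pose s : R := 3 * 2^-1 ^+ m; pose V : R := (2 * s) ^+ 3.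
have s0 : 0 <= s by rewrite mulr_ge0// exprn_ge0.
have V0 : 0 <= V by rewrite exprn_ge0// mulr_ge0.
have F0 : 0 <= bound_factor c M B m by exact: bound_factor_ge0.
(* The factors in order: 8 from [bq_norm_le], c^-1 since the mollifier has mass c, the local bound,
   8 from [bq_abs1_norm], and V + 1 from [integral_bq_norm_le]. *)
pose C : R := 8 * (c^-1 * bound_factor c M B m * 8 * (V + 1)).
have C0 : 0 <= C.
  rewrite /C; apply: mulr_ge0 => //; apply: mulr_ge0; last by rewrite addr_ge0.
  by apply: mulr_ge0 => //; apply: mulr_ge0 => //; rewrite invr_ge0 ltW.
exists (C + 1); first by rewrite ltr_wpDl.
move=> w [wL wD]; exists (fun x => of_components (fun i => value c G w i x)).
  exact: representative_continuous oG c0 cE M0 hM wD B0 (hB w).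
move=> x Kx; have QG := hm x Kx.
have mQ : measurable (cube x s : set (M3 R)) := measurable_cube x s.
have wQ : bq_in (in_Lp 1 (cube x s)) w.
  by case: wD => w1 _ _ j; apply: w1; [exact: compact_cube|exact: QG].
set N := mass (localize (cube x s) w).
have N0 : 0 <= N by exact: mass_ge0.
have NE : (N%:E <= (8 * (V + 1))%:E * Lp_norm p G w)%E.
  rewrite /N mass_localize//.
  apply: le_trans (_ : (8%:E * \int[mu]_(y in cube x s) (bq_norm (w y))%:E) <= _)%E.
    rewrite -ge0_integralZl_EFin//; last 2 first.
    - by move=> y _; rewrite lee_fin bq_norm_ge0.
    - by apply/measurable_EFinP; apply: measurable_bq_norm; exact: bq_in_meas wQ.
    apply: ge0_le_integral => //.
    - by move=> y _; rewrite lee_fin bq_abs1_ge0.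
    - by apply/measurable_EFinP; apply: measurable_bq_abs1; exact: bq_in_meas wQ.
    - apply: emeasurable_funM; first exact: measurable_cst.
      by apply/measurable_EFinP; apply: measurable_bq_norm; exact: bq_in_meas wQ.
    - by move=> y _; rewrite -EFinM lee_fin bq_abs1_norm.
  rewrite EFinM -muleA; apply: lee_wpmul2l => //.
  apply: integral_bq_norm_le => //; [exact: measurable_open3|exact: leb3_cube|exact: bq_in_meas wL].
have b i : `|value c G w i x| <= c^-1 * bound_factor c M B m * N.
  have := value_le c0 cE M0 hM wD B0 (hB w) QG i; rewrite normrM (gtr0_norm c0) => h.
  by rewrite -mulrA mulrC ler_pdivlMr// mulrC.
have ci : 0 <= c^-1 * bound_factor c M B m by rewrite mulr_ge0// invr_ge0 ltW.
have nb : bq_norm (of_components (fun i => value c G w i x)) <= 8 * (c^-1 * bound_factor c M B m * N).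
  apply: bq_norm_le; first by rewrite mulr_ge0.
  by move=> i; rewrite component_of_components.
have L0 : (0 <= Lp_norm p G w)%E by exact: poweR_ge0.
apply: le_trans (_ : (8 * (c^-1 * bound_factor c M B m * N))%:E <= _)%E; first by rewrite lee_fin.
apply: le_trans (_ : C%:E * Lp_norm p G w <= _)%E; last first.
  by apply: lee_wpmul2r => //; rewrite lee_fin lerDl.
have -> : 8 * (c^-1 * bound_factor c M B m * N) = 8 * (c^-1 * bound_factor c M B m) * N by ring.
have -> : C = 8 * (c^-1 * bound_factor c M B m) * (8 * (V + 1)) by rewrite /C; ring.
rewrite EFinM [in leRHS]EFinM -[leRHS]muleA; apply: lee_wpmul2l NE.
by rewrite lee_fin mulr_ge0.
Qed.
End Conclusion.
Unset Implicit Arguments.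
Theorem theorem14 (R : realType) (G : set (R3 R)) (p : R)
    (a1 a2 a3 a4 : R3 R -> biquat R) :
  liapunov_domain G ->
  3%:R / 2%:R < p ->
  bq_in (in_Linfty G) a1 -> bq_in (in_Linfty G) a2 ->
  bq_in (in_Linfty G) a3 -> bq_in (in_Linfty G) a4 ->
  forall K : set (R3 R), compact K -> K `<=` G ->
  exists2 C : R, 0 < C &
    forall w : R3 R -> biquat R, weak_solution p G a1 a2 a3 a4 w ->
      exists2 w' : R3 R -> biquat R, continuous_representative G w w' &
        forall x, K x -> ((bq_norm (w' x))%:E <= C%:E * Lp_norm p G w)%E.
Proof.
move=> [[_ oG _] _ _ _] p32 A1 A2 A3 A4 K cK KG.
have p1 : 1 <= p by apply: le_trans (ltW p32); rewrite ler_pdivlMr// mul1r ler_nat.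
exact: interior_estimate.
Qed.
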